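(* Let $T>0$ and fix $(t,x)\in[0,T]\times\mathbb R$. For $K\in\mathbb N$ set $$\Psi^K_{t,x}:=\int_{\mathbb R}\sum_{j=1}^K\left(\int_0^t e_j(B^x_s)\,ds\right)e_j(y)\,dW_y-\frac12\sum_{j=1}^K\left(\int_0^t e_j(B^x_s)\,ds\right)^2.$$ Then, as $K\to\infty$, $\Psi^K_{t,x}$ converges in $\mathbb L^2(\mathbb P^W\otimes\mathbb P^B)$ to a well-defined random variable, denoted $$\Psi_{t,x}=\int_0^t\int_{\mathbb R}\delta(B^x_s-y)\,dW_y\,ds-\frac12\int_{\mathbb R}L_a(t)^2\,da,$$ where the first term is the Wiener integral $\int_{\mathbb R}L^x_y(t)\,dW_y$. Furthermore, conditionally on $\mathcal G^B_T$, $$\Psi_{t,x}\sim N\left(-\frac12\int_{\mathbb R}|L_a(t)|^2\,da,\ \int_{\mathbb R}|L_a(t)|^2\,da\right).$$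
   Context: $(\Omega,\mathfrak B,\mathbb P^W)$ is a complete probability space carrying a one-dimensional Brownian motion $\{W_x\}_{x\in\mathbb R}$ indexed by the whole real line, and $\mathfrak B$ is the sigma-algebra generated by the Wiener integrals $\int_{\mathbb R}h(y)\,dW_y$, $h\in\mathbb L^2(\mathbb R)$. $\{B_t\}_{t\in[0,T]}$ is a one-dimensional standard Brownian motion on an auxiliary filtered probability space $(\tilde\Omega,\mathcal G,\{\mathcal G^B_t\}_{t\in[0,T]},\mathbb P^B)$; $W$ and $B$ are considered jointly on the product space with measure $\mathbb P^W\otimes\mathbb P^B$ (so they are independent), and $\mathcal G^B_T$ is viewed as a sub-sigma-algebra of the product space. $B^x_t:=x+B_t$. $\{e_j\}_{j\ge1}$ are the Hermite functions $$e_j(x)=(-1)^{j-1}\left(\sqrt\pi\,2^{j-1}(j-1)!\right)^{-1/2}e^{x^2/2}\left(\frac{d}{dx}\right)^{j-1}e^{-x^2},$$ a complete orthonormal system of $\mathbb L^2(\mathbb R)$. $\{L_a(t);(t,a)\in[0,T]\times\mathbb R\}$ is the (jointly continuous) local time of $B$, and $L^x_a(t)=L_{a-x}(t)$, formally $\int_0^t\delta_a(B^x_s)\,ds$, is the local time of $B^x$ at level $a$. Almost surely $a\mapsto L^x_a(t)$ is continuous with compact support, hence in $\mathbb L^2(\mathbb R)$; $\int_{\mathbb R}L^x_y(t)\,dW_y$ denotes, for $\mathbb P^B$-a.e. path of $B$, the Wiener integral of this function with respect to $W$. *)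

(* Defs.v *)
From HB Require Import structures.
From mathcomp Require Import all_boot all_order all_algebra.
From mathcomp Require Import all_classical all_reals all_analysis.
Import Order.TTheory GRing.Theory Num.Theory.
Import numFieldNormedType.Exports.

Set Implicit Arguments.
Unset Strict Implicit.
Unset Printing Implicit Defensive.

Local Open Scope classical_set_scope.
Local Open Scope ring_scope.

Section hermite.
Context {R : realType}.

(* Indexed from j = 1. *)
Definition hermite_fun (j : nat) (x : R) : R :=
  (-1) ^+ j.-1 * (Num.sqrt (Num.sqrt pi * 2 ^+ j.-1 * (j.-1)`!%:R))^-1
  * expR (x ^+ 2 / 2) * derive1n j.-1 (fun y : R => expR (- (y ^+ 2))) x.

End hermite.

Section laws.
Context d (T : measurableType d) (R : realType).

(* The normal law of mean m and VARIANCE v >= 0.  The second argument of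
   normal_prob is the standard deviation, and normal_prob m 0 is not the
   Dirac mass at m, whence the case distinction. *)
Definition gaussian_law (m v : R) (A : set R) : \bar R :=
  if v == 0 then \d_m A else normal_prob m (Num.sqrt v) A.

Definition has_law (P : probability T R) (X : T -> R) (mu : set R -> \bar R) :=
  forall A : set R, measurable A -> P (X @^-1` A) = mu A.

Definition mutually_independent (P : probability T R) n (X : 'I_n -> T -> R) :=
  forall A : 'I_n -> set R, (forall i, measurable (A i)) ->
    P (\bigcap_(i in [set: 'I_n]) X i @^-1` A i) =
    (\prod_(i < n) P (X i @^-1` A i))%E.

(* Under P, the map z |-> kappa z is a version of the conditional law of X
   given the sigma-algebra F: for every Borel set A, z |-> kappa z A is P-a.s.
   equal to an F-measurable g satisfying the defining identity of
   P (X \in A | F). *)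
Definition has_cond_law (P : probability T R) (F : set (set T)) (X : T -> R)
    (kappa : T -> set R -> \bar R) :=
  forall A : set R, measurable A -> exists g : T -> R,
    [/\ forall Y : set R, measurable Y -> F (g @^-1` Y),
        {ae P, forall z, (g z)%:E = kappa z A} &
        forall E, F E -> (\int[P]_(z in E) (g z)%:E = P (E `&` X @^-1` A))%E].

Definition cvg_L2 (P : probability T R) (X : nat -> T -> R) (Y : T -> R) :=
  [/\ forall n, X n \in Lfun P 2%:E, Y \in Lfun P 2%:E &
      Lnorm P 2%:E (EFin \o (X n \- Y)) @[n --> \oo] --> 0%E].

End laws.

Section wiener.
Context d (T : measurableType d) (R : realType) (P : probability T R).

Record two_sided_brownian_motion (W : R -> {RV P >-> R}) : Prop := {
  tbm_start : {ae P, forall w, W 0 w = 0} ;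
  tbm_gauss : forall a b : R, a <= b ->
    has_law P (W b \- W a) (gaussian_law 0 (b - a)) ;
  tbm_indep : forall n (a : nat -> R), {homo a : i j / (i <= j)%N >-> i <= j} ->
    mutually_independent P (fun i : 'I_n => W (a i.+1) \- W (a i)) ;
  tbm_cont : {ae P, forall w, continuous (fun y : R => W y w)} }.

(* The list s of triples (c, a, b) encodes the step function
   \sum c * \1_]a, b]; the encoding is meaningful when every a <= b. *)
Definition wf_step (s : seq (R * R * R)) := all (fun p => p.1.2 <= p.2) s.

Definition step_fun (s : seq (R * R * R)) (y : R) : R :=
  \sum_(p <- s) p.1.1 * \1_(`]p.1.2, p.2]%classic) y.

Definition step_integral (W : R -> {RV P >-> R}) (s : seq (R * R * R)) (w : T) : R :=
  \sum_(p <- s) p.1.1 * (W p.2 w - W p.1.2 w).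

(* X is a version of \int_R h(y) dW_y, i.e. an L^2(P)-limit of the integrals
   of step functions that tend to h in L^2(R). *)
Definition wiener_integral (W : R -> {RV P >-> R}) (h : R -> R) (X : T -> R) :=
  [/\ h \in Lfun lebesgue_measure 2%:E, X \in Lfun P 2%:E &
    exists s : nat -> seq (R * R * R),
    [/\ forall n, wf_step (s n),
        Lnorm lebesgue_measure 2%:E (EFin \o (step_fun (s n) \- h))
          @[n --> \oo] --> 0%E &
        Lnorm P 2%:E (EFin \o (step_integral W (s n) \- X))
          @[n --> \oo] --> 0%E]].

(* As the sigma-algebra is generated by all the versions of the Wiener
   integrals, its null sets (versions of the integral of 0) are included. *)
Definition generated_by_wiener_integrals (W : R -> {RV P >-> R}) :=
  @measurable d T = <<s [set E | exists h X (A : set R),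
    [/\ wiener_integral W h X, measurable A & E = X @^-1` A]] >>.

End wiener.

Section brownian.
Context d (T : measurableType d) (R : realType) (P : probability T R).

(* Only the times t \in [0, Tm] are relevant. *)
Record filtration (Tm : R) (G : R -> set (set T)) : Prop := {
  filtration_sigma : forall t : R, 0 <= t <= Tm -> sigma_algebra setT (G t) ;
  filtration_sub : forall t : R, 0 <= t <= Tm -> G t `<=` measurable ;
  filtration_homo : forall s t : R, 0 <= s -> s <= t -> t <= Tm -> G s `<=` G t }.

Record brownian_motion (Tm : R) (G : R -> set (set T))
    (B : R -> {RV P >-> R}) : Prop := {
  bm_adapted : forall t : R, 0 <= t <= Tm ->
    forall A : set R, measurable A -> G t (B t @^-1` A) ;
  bm_start : {ae P, forall w, B 0 w = 0} ;
  bm_gauss : forall s t : R, 0 <= s -> s <= t -> t <= Tm ->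
    has_law P (B t \- B s) (gaussian_law 0 (t - s)) ;
  bm_indep : forall s t : R, 0 <= s -> s <= t -> t <= Tm ->
    forall E (A : set R), G s E -> measurable A ->
    P (E `&` (B t \- B s) @^-1` A) = (P E * P ((B t \- B s)%R @^-1` A))%E ;
  bm_cont : {ae P, forall w, {within `[0, Tm], continuous (fun s : R => B s w)}} }.

(* L a t is the local time L_a(t) of B: the jointly continuous density of the
   occupation measure of B on [0, t]. *)
Record local_time (Tm : R) (B : R -> {RV P >-> R})
    (L : R -> R -> {RV P >-> R}) : Prop := {
  lt_cont : {ae P, forall w,
    {within [set p : R * R | 0 <= p.1 <= Tm],
      continuous (fun p : R * R => L p.2 p.1 w)}} ;
  lt_occupation : {ae P, forall w, forall t : R, 0 <= t <= Tm ->
    forall A : set R, measurable A ->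
    lebesgue_measure (`[0, t]%classic `&` [set s | A (B s w)]) =
    (\int[lebesgue_measure]_(a in A) (L a t w)%:E)%E} }.

End brownian.

Section Psi.
Context d1 (Om1 : measurableType d1) d2 (Om2 : measurableType d2) (R : realType).
Variables (PW : probability Om1 R) (PB : probability Om2 R).

Definition joint_prob : probability (Om1 * Om2)%type R := (PW \x PB)%E.

Variables (W : R -> {RV PW >-> R}) (B : R -> {RV PB >-> R}).
Variable (L : R -> R -> {RV PB >-> R}).

(* I is a jointly measurable version of (w, b) |-> (\int_R h b y dW_y)(w): for
   almost every path b, the section of I at b is the Wiener integral of h b. *)
Definition pathwise_wiener_integral (h : Om2 -> R -> R)
    (I : {RV joint_prob >-> R}) :=
  {ae PB, forall b, wiener_integral W (h b) (fun w => I (w, b))}.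

Definition occupation_coef (t x : R) (j : nat) (b : Om2) : R :=
  \int[lebesgue_measure]_(s in `[0, t]) hermite_fun j (x + B s b).

Definition is_PsiK (t x : R) (K : nat) (Z : {RV joint_prob >-> R}) :=
  exists2 I : {RV joint_prob >-> R},
    pathwise_wiener_integral
      (fun b y => \sum_(1 <= j < K.+1) occupation_coef t x j b * hermite_fun j y) I &
    {ae joint_prob, forall z, Z z = I z
      - 2^-1 * \sum_(1 <= j < K.+1) occupation_coef t x j z.2 ^+ 2}.

Definition local_time_sq (t : R) (b : Om2) : R :=
  \int[lebesgue_measure]_(a in [set: R]) (`|L a t b| ^+ 2).

(* The local time of x + B at the level y is L_(y - x)(t). *)
Definition is_Psi (t x : R) (Z : {RV joint_prob >-> R}) :=
  exists2 I : {RV joint_prob >-> R},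
    pathwise_wiener_integral (fun b y => L (y - x) t b) I &
    {ae joint_prob, forall z, Z z = I z - 2^-1 * local_time_sq t z.2}.

End Psi.

(* Main.v *)
(* The path B being frozen, write l(y) = L_(y - x)(t), a continuous function with
   compact support, and c_j for its Hermite coefficients.  By the occupation formula
   c_j is the integral of e_j(x + B_s) over [0, t], so the K-th stochastic term is the
   Wiener integral of the K-th Hermite partial sum of l, and Parseval's identity
   gives c_1^2 + ... + c_K^2 --> v, where v is the squared norm of l.  Conditionally
   on B, the isometry bounds the squared L^2 distance between the K-th stochastic term
   and the Wiener integral of l by r_K = v - (c_1^2 + ... + c_K^2), so everything
   converges in L^2 as soon as E[v^2] is finite: r_K --> 0 and 0 <= r_K <= v.

   The moment bound comes from v = lim \int\int phi_n(B_s - B_r) ds dr for kernels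
   phi_n concentrating at 0.  After discretization, Cauchy-Schwarz reduces the second
   moment to the probability that three values of B are 1/n-close, which by independence
   of the increments is at most of order n^-2 ((q - p) (r - q))^(-1/2) at times
   p < q < r; this is summable, and Fatou's lemma gives the bound on E[v^2].

   Given B, the Wiener integral of l is N(0, v), and v has a version measurable with
   respect to G_T, as a limit of Riemann sums, which gives the conditional law. *)

Require Import Defs.
From HB Require Import structures.
From mathcomp Require Import all_boot all_order all_algebra.
From mathcomp Require Import all_classical all_reals all_analysis.
From mathcomp Require Import measurable_realfun ring lra.
Import Order.TTheory GRing.Theory Num.Theory.
Import numFieldNormedType.Exports.

Set Implicit Arguments.
Unset Strict Implicit.
Unset Printing Implicit Defensive.

Local Open Scope classical_set_scope.
Local Open Scope ring_scope.

(** * Square integrable functions *)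

(** Two measurability problems shape the proof. An integral chosen path by path is not known to be
    jointly measurable, so the integral of l is obtained as an L^2 limit, on the product space, of
    sums of c_j(b) X_j(w); only afterwards, along a subsequence, are almost all its sections
    recognised as Wiener integrals. And the local time is not assumed to be G_T-measurable, so its
    coefficients and its squared norm are replaced by upper limits that involve B at countably many
    times only. The moment E[v^2], and not just E[v], is needed because v itself enters the
    exponent, whose square has to be integrable. Parseval's identity is required only for continuous
    functions with compact support, which permits an elementary density proof: multiplication by
    exp(-y^2/4) preserves the closed span, Weierstrass's theorem in the variable u = exp(-y^2/4)
    yields the even functions, and a factor y yields the odd ones. Laws of limits are identified by
    testing against bounded continuous ramps, and variances add by the rotation invariance of the
    product of two normal densities. *)

Section square_integrable.
Context d (T : measurableType d) (R : realType) (mu : {measure set T -> \bar R}).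
Implicit Types f g h : T -> R.

(** Plain functions, with no quotient by null sets, so that sums and products are the pointwise
    ones; [L2P] translates to [Lfun]. *)
Definition L2 f := measurable_fun setT f /\
  mu.-integrable setT (EFin \o (fun x => f x ^+ 2)).

Definition ip f g : R := \int[mu]_x (f x * g x).

Definition nsq f : R := ip f f.

Lemma L2_measurable f : L2 f -> measurable_fun setT f.
Proof. by case. Qed.

Lemma Lnorm_sqr f : measurable_fun setT f ->
  Lnorm mu 2%:E (EFin \o f) = ((\int[mu]_x (f x ^+ 2)%:E) `^ (2^-1))%E.
Proof.
move=> mf; rewrite unlock; congr (_ `^ _)%E.
by apply: eq_integral => x _ /=; rewrite powR_mulrn// -normrX ger0_norm// sqr_ge0.
Qed.

Lemma L2_lty f : measurable_fun setT f ->
  (\int[mu]_x (f x ^+ 2)%:E < +oo)%E -> L2 f.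
Proof.
move=> mf fy; split=> //; apply/integrableP; split.
  by apply/measurable_EFinP; exact: measurable_funX.
by under eq_integral do rewrite /= ger0_norm ?sqr_ge0//.
Qed.

Lemma integral_sqr f : L2 f -> (\int[mu]_x (f x ^+ 2)%:E = (nsq f)%:E)%E.
Proof.
move=> [mf fi]; rewrite /nsq /ip /Rintegral fineK//.
exact: (integrable_fin_num _ fi).
Qed.

Lemma nsq_ge0 f : 0 <= nsq f.
Proof. by apply: Rintegral_ge0 => x _; rewrite -expr2 sqr_ge0. Qed.

Lemma L2P f : f \in Lfun mu 2%:E <-> L2 f.
Proof.
split=> [f2|Lf].
  split; last exact: Lfun2_integrable_sqr.
  by move: f2; rewrite inE => /andP[/[!inE]].
have [mf _] := Lf.
rewrite inE; apply/andP; split; rewrite inE//=.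
by rewrite /finite_norm Lnorm_sqr// integral_sqr// poweR_lty// ltry.
Qed.

Lemma L2M f g : L2 f -> L2 g -> mu.-integrable setT (EFin \o (fun x => f x * g x)).
Proof.
move=> /L2P f2 /L2P g2; have := Lfun2_mul_Lfun1 f2 g2.
by move=> /Lfun1_integrable.
Qed.

Lemma L2Z c f : L2 f -> L2 (fun x => c * f x).
Proof.
move=> [mf fi]; split; first exact: measurable_funM.
have := integrableZl measurableT (c ^+ 2) fi; apply: eq_integrable => // x _ /=.
by rewrite exprMn EFinM.
Qed.

Lemma L2D f g : L2 f -> L2 g -> L2 (fun x => f x + g x).
Proof.
move=> [mf fi] [mg gi]; split; first exact: measurable_funD.
have := integrableD measurableT (integrableZl measurableT 2 fi)
  (integrableZl measurableT 2 gi); apply: le_integrable => //.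
  by apply/measurable_EFinP/measurable_funX/measurable_funD.
move=> x _ /=; rewrite lee_fin ger0_norm ?sqr_ge0// ler_normr.
by apply/orP; left; have := sqr_ge0 (f x - g x); lra.
Qed.

Lemma L2N f : L2 f -> L2 (fun x => - f x).
Proof.
move=> /(L2Z (-1)); congr L2; by apply/funext => x; rewrite mulN1r.
Qed.

Lemma L2B f g : L2 f -> L2 g -> L2 (fun x => f x - g x).
Proof. by move=> f2 /L2N; exact: L2D. Qed.

Lemma L20 : L2 (fun=> 0).
Proof.
split=> //; rewrite (_ : _ \o _ = cst 0%E); first exact: integrable0.
by apply/funext => x /=; rewrite expr0n.
Qed.

Lemma L2_sum I (s : seq I) (F : I -> T -> R) : (forall i, L2 (F i)) ->
  L2 (fun x => \sum_(i <- s) F i x).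
Proof.
move=> F2; elim: s => [|i s IH].
  under eq_fun do rewrite big_nil; exact: L20.
by under eq_fun do rewrite big_cons; exact: L2D.
Qed.

Lemma ipC f g : ip f g = ip g f.
Proof. by apply: eq_Rintegral => x _; rewrite mulrC. Qed.

Lemma ipDl f g h : L2 f -> L2 g -> L2 h ->
  ip (fun x => f x + g x) h = ip f h + ip g h.
Proof.
move=> f2 g2 h2; rewrite /ip -RintegralD//; [|exact: L2M..].
by apply: eq_Rintegral => x _; rewrite mulrDl.
Qed.

Lemma ipZl c f g : L2 f -> L2 g -> ip (fun x => c * f x) g = c * ip f g.
Proof.
move=> f2 g2; rewrite /ip -RintegralZl//; last exact: L2M.
by apply: eq_Rintegral => x _; rewrite mulrA.
Qed.


Lemma ip0l f : ip (fun=> 0) f = 0.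
Proof.
rewrite /ip; under eq_Rintegral do rewrite mul0r.
by rewrite /Rintegral integral0.
Qed.

Lemma ip_suml I (s : seq I) (F : I -> T -> R) g : (forall i, L2 (F i)) -> L2 g ->
  ip (fun x => \sum_(i <- s) F i x) g = \sum_(i <- s) ip (F i) g.
Proof.
move=> F2 g2; elim: s => [|i s IH].
  by under eq_fun do rewrite big_nil; rewrite big_nil ip0l.
under eq_fun do rewrite big_cons; rewrite big_cons -IH ipDl//.
exact: L2_sum.
Qed.

Lemma nsqD f g : L2 f -> L2 g ->
  nsq (fun x => f x + g x) = nsq f + 2 * ip f g + nsq g.
Proof.
move=> f2 g2; have fg2 := L2D f2 g2.
rewrite /nsq ipDl// ![ip _ (fun x => f x + g x)]ipC !ipDl// [ip g f]ipC; ring.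
Qed.

Lemma nsqZ c f : L2 f -> nsq (fun x => c * f x) = c ^+ 2 * nsq f.
Proof.
by move=> f2; rewrite /nsq ipZl// ?[ip f _]ipC ?ipZl//; [ring|exact: L2Z].
Qed.

Lemma nsqN f : nsq (fun x => - f x) = nsq f.
Proof. by apply: eq_Rintegral => x _; rewrite mulrNN. Qed.

Lemma nsqB f g : L2 f -> L2 g ->
  nsq (fun x => f x - g x) = nsq f - 2 * ip f g + nsq g.
Proof.
move=> f2 g2; rewrite nsqD//; last exact: L2N.
rewrite nsqN [ip f (fun x => - g x)]ipC (_ : (fun x => - g x) = (fun x => -1 * g x)).
  by rewrite ipZl// [ip g f]ipC; ring.
by apply/funext => x; rewrite mulN1r.
Qed.

Lemma nsqBC f g : nsq (fun x => f x - g x) = nsq (fun x => g x - f x).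
Proof. by rewrite -nsqN; congr nsq; apply/funext => x; rewrite opprB. Qed.

Lemma nsqD_le f g : L2 f -> L2 g ->
  nsq (fun x => f x + g x) <= 2 * nsq f + 2 * nsq g.
Proof.
move=> f2 g2; have := nsq_ge0 (fun x => f x - g x).
by rewrite nsqB// nsqD//; lra.
Qed.


Lemma nsqB_triangle f g h : L2 f -> L2 g -> L2 h ->
  nsq (fun x => f x - h x) <=
  2 * nsq (fun x => f x - g x) + 2 * nsq (fun x => g x - h x).
Proof.
move=> f2 g2 h2; apply: le_trans (nsqD_le (L2B f2 g2) (L2B g2 h2)).
by rewrite le_eqVlt; apply/orP; left; apply/eqP; congr nsq; apply/funext => x; ring.
Qed.

(* Discriminant of the nonnegative quadratic [c |-> nsq (c f + g)]. *)
Lemma ip_CS f g : L2 f -> L2 g -> ip f g ^+ 2 <= nsq f * nsq g.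
Proof.
move=> f2 g2.
have H c : 0 <= c ^+ 2 * nsq f + 2 * (c * ip f g) + nsq g.
  have := nsq_ge0 (fun x => c * f x + g x).
  by rewrite nsqD//; [rewrite nsqZ// ipZl//|exact: L2Z].
have := nsq_ge0 f; rewrite le_eqVlt => /orP[/eqP f0|f0].
  rewrite -f0 mul0r; have [->|fg0] := eqVneq (ip f g) 0; first by rewrite expr0n.
  (* The quadratic is affine when [nsq f] is 0; this value of c makes it equal to -1. *)
  have := H (- (nsq g + 1) / (2 * ip f g)); rewrite -f0 mulr0 add0r.
  have -> : 2 * (- (nsq g + 1) / (2 * ip f g) * ip f g) = - (nsq g + 1).
    by field.
  lra.
have := H (- ip f g / nsq f).
have -> : (- ip f g / nsq f) ^+ 2 * nsq f + 2 * (- ip f g / nsq f * ip f g) + nsq g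
   = (nsq f * nsq g - ip f g ^+ 2) / nsq f.
  by field; rewrite gt_eqF.
by rewrite pmulr_lge0 ?invr_gt0// subr_ge0.
Qed.

Lemma le_nsq f g : L2 f -> L2 g -> (forall x, `|f x| <= `|g x|) -> nsq f <= nsq g.
Proof.
move=> f2 g2 fg; apply: le_Rintegral => //; [exact: L2M..|].
by move=> x _; rewrite -!expr2 -[leLHS]real_normK ?num_real// -[leRHS]real_normK ?num_real// lerXn2r ?nnegrE.
Qed.

Lemma ae_eq_nsq f g : L2 f -> L2 g -> {ae mu, forall x, f x = g x} -> nsq f = nsq g.
Proof.
move=> f2 g2 fg; apply: EFin_inj; rewrite -!integral_sqr//.
apply: ae_eq_integral => //.
- by apply/measurable_EFinP/measurable_funX; exact: L2_measurable.
- by apply/measurable_EFinP/measurable_funX; exact: L2_measurable.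
- by apply: filterS fg => x /= ->.
Qed.

Lemma cvg_Lnorm (f : nat -> T -> R) : (forall n, L2 (f n)) ->
  Lnorm mu 2%:E (EFin \o f n) @[n --> \oo] --> 0%E <->
  nsq (f n) @[n --> \oo] --> (0 : R).
Proof.
move=> f2.
have E n : Lnorm mu 2%:E (EFin \o f n) = (Num.sqrt (nsq (f n)))%:E.
  rewrite Lnorm_sqr; last by case: (f2 n).
  by rewrite integral_sqr// poweR_EFin powR12_sqrt// nsq_ge0.
under eq_fun do rewrite E.
split.
  move/fine_cvgP => [_] /= cf.
  have -> : (fun n => nsq (f n)) = (fun n => Num.sqrt (nsq (f n)) * Num.sqrt (nsq (f n))).
    by apply/funext => n; rewrite -expr2 sqr_sqrtr// nsq_ge0.
  by rewrite -[0 as X in _ --> X](mulr0 0); apply: cvgM.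
move=> cf; apply: cvg_EFin; first exact: nearW.
have := @cvg_comp _ _ _ (fun n => nsq (f n)) Num.sqrt _ _ _ cf (@sqrt_continuous R 0).
by rewrite sqrtr0.
Qed.

(** Expand [F n] as the sum of [F n - f] and [f]; Cauchy-Schwarz makes the cross term vanish in the
    limit. *)
Lemma nsq_cvg (F : nat -> T -> R) f : (forall n, L2 (F n)) -> L2 f ->
  nsq (fun x => F n x - f x) @[n --> \oo] --> (0 : R) ->
  nsq (F n) @[n --> \oo] --> nsq f.
Proof.
move=> F2 f2 cF.
have cI : ip (fun x => F n x - f x) f @[n --> \oo] --> (0 : R).
  apply/norm_cvg0P.
  have B n : `|ip (fun x => F n x - f x) f| <=
     Num.sqrt (nsq (fun x => F n x - f x) * nsq f).
    rewrite -(@ler_pXn2r _ 2)// ?nnegrE// ?sqrtr_ge0//.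
    rewrite sqr_sqrtr ?mulr_ge0 ?nsq_ge0// real_normK ?num_real//.
    by apply: ip_CS => //; exact: L2B.
  apply: (@squeeze_cvgr _ _ _ _ (fun=> 0)
    (fun n => Num.sqrt (nsq (fun x => F n x - f x) * nsq f))).
  - by apply: nearW => n; rewrite normr_ge0 B.
  - exact: cvg_cst.
  - rewrite -[0](sqrtr0 R); apply: (@cvg_comp _ _ _ _ Num.sqrt); last exact: sqrt_continuous.
    by rewrite -(mul0r (nsq f)); apply: cvgM => //; exact: cvg_cst.
have -> : (fun n => nsq (F n)) = (fun n => nsq (fun x => F n x - f x)
     + 2 * ip (fun x => F n x - f x) f + nsq f).
  apply/funext => n; rewrite -nsqD//; last exact: L2B.
  by congr nsq; apply/funext => x; rewrite subrK.
rewrite -[nsq f as X in _ --> X](add0r (nsq f)); apply: cvgD; last exact: cvg_cst.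
rewrite -[0 as X in _ --> X](addr0 0); apply: cvgD => //.
by rewrite -[0 as X in _ --> X](mulr0 2); apply: cvgM => //; exact: cvg_cst.
Qed.

Lemma ae_le_L2 f g : measurable_fun setT f ->
  mu.-integrable setT (EFin \o (fun x => g x ^+ 2)) ->
  {ae mu, forall x, `|f x| <= g x} -> L2 f.
Proof.
move=> mf /integrableP[mg gi] fg; apply: L2_lty => //; apply: le_lt_trans gi.
apply: ae_ge0_le_integral => //.
- by move=> x _; rewrite lee_fin sqr_ge0.
- by apply/measurable_EFinP; exact: measurable_funX.
- exact: measurableT_comp.
- apply: filterS fg => x H _ /=; rewrite lee_fin [leRHS]ger0_norm ?sqr_ge0//.
  by rewrite -real_normK ?num_real// lerXn2r ?nnegrE// (le_trans _ H).
Qed.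

(** Almost everywhere [f] is the lower limit, and dropping the first N terms turns the eventual
    bound into a bound for all terms. *)
Lemma fatou_le (F : nat -> T -> R) f (c : \bar R) :
  (forall k, measurable_fun setT (F k)) -> (forall k x, 0 <= F k x) ->
  measurable_fun setT f -> (forall x, 0 <= f x) ->
  {ae mu, forall x, F k x @[k --> \oo] --> f x} ->
  (\forall k \near \oo, (\int[mu]_x (F k x)%:E <= c)%E) ->
  (\int[mu]_x (f x)%:E <= c)%E.
Proof.
move=> mF F0 mf f0 Ff [N _ HN].
pose G k x := (F (k + N)%N x)%:E.
have mG k : measurable_fun setT (G k) by apply/measurable_EFinP; exact: mF.
apply: (@le_trans _ _ (\int[mu]_x limn_einf (G ^~ x))%E).
  apply: ae_ge0_le_integral => //.
  - by move=> x _; rewrite lee_fin.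
  - exact/measurable_EFinP.
  - move=> x _; rewrite limn_einf_lim; apply: lime_ge; first exact: is_cvg_einfs.
    apply: nearW => n; apply: le_ereal_inf_tmp => _ [k _ <-]; by rewrite lee_fin.
  - have -> : (fun x => limn_einf (G ^~ x)) = (fun x => - limn_esup (fun k => - G k x))%E.
      apply/funext => x; rewrite -limn_einfN; congr limn_einf.
      by apply/funext => k; rewrite /comp oppeK.
    apply: measurableT_comp => //; apply: measurable_fun_limn_esup => k.
    exact: measurableT_comp.
  - apply: filterS Ff => x Fx _.
    suff /cvg_limn_einf_sup[-> //] : G n x @[n --> \oo] --> (f x)%:E.
    apply: cvg_EFin; first exact: nearW.
    by have /(_ N) := (@cvg_shiftn _ _ (F ^~ x) (nbhs (f x))) => ->.
apply: le_trans (fatou _ _ _ _) _ => //.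
  by move=> n x _; rewrite lee_fin.
rewrite limn_einf_lim; apply: lime_le; first exact: is_cvg_einfs.
apply: nearW => n.
apply: (@le_trans _ _ (\int[mu]_x G n x)%E); last by apply: HN; rewrite /= leq_addl.
by apply: ereal_inf_lbound; exists n => /=.
Qed.

(** The bound by [g] passes to the limit [f], so 4 g^2 dominates the squared difference. *)
Lemma dominated_nsq (F : nat -> T -> R) f (g : T -> R) :
  (forall n, measurable_fun setT (F n)) -> measurable_fun setT f ->
  mu.-integrable setT (EFin \o (fun x => g x ^+ 2)) ->
  {ae mu, forall x, F n x @[n --> \oo] --> f x} ->
  {ae mu, forall x n, `|F n x| <= g x} ->
  [/\ forall n, L2 (F n), L2 f &
    nsq (fun x => F n x - f x) @[n --> \oo] --> (0 : R)].
Proof.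
move=> mF mf gi Ff Fg.
have F2 n : L2 (F n).
  by apply: ae_le_L2 (mF n) gi _; apply: filterS Fg => x.
have fg : {ae mu, forall x, `|f x| <= g x}.
  apply: filterS2 Ff Fg => x Fx gx.
  have cF : `|F n x| @[n --> \oo] --> `|f x| by apply: (@cvg_norm _ R^o) => //.
  by rewrite -(cvg_lim _ cF)//; apply: limr_le; [apply/cvg_ex; exists (`|f x|)|exact: nearW].
have f2 : L2 f by exact: ae_le_L2 fg.
split=> //.
have [] := @dominated_convergence _ _ _ mu setT measurableT
   (fun n => EFin \o (fun x => (F n x - f x) * (F n x - f x))) (cst 0%E)
   (fun x => 4%:E * (EFin \o (fun y => g y ^+ 2)%R) x)%E.
- move=> n; apply/measurable_EFinP; apply: measurable_funM; exact: measurable_funB.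
- exact: measurable_cst.
- apply: filterS Ff => x Fx _ /=; apply: cvg_EFin; first exact: nearW.
  have F0 : F n x - f x @[n --> \oo] --> (0 : R) by rewrite -(subrr (f x)); apply: cvgB => //; exact: cvg_cst.
  by rewrite -(mulr0 (0 : R)); apply: cvgM.
- exact: integrableZl.
- apply: filterS2 fg Fg => x H1 H2 n _ /=; rewrite lee_fin -expr2 ger0_norm ?sqr_ge0//.
  move: (H2 n) H1; rewrite !ler_norml => /andP[? ?] /andP[? ?]; nra.
move=> _ _; rewrite integral0 => H.
by move/fine_cvgP : H => [_].
Qed.
Lemma ae_series_cvg (F : nat -> T -> R) :
  (forall k, measurable_fun setT (F k)) -> (forall k x, 0 <= F k x) ->
  (forall k, (\int[mu]_x (F k x)%:E <= (1 / (2 ^ k.+1)%:R)%:E)%E) ->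
  {ae mu, forall x, cvgn (series (F ^~ x))}.
Proof.
move=> mF F0 Fi.
have mE k : measurable_fun setT (fun x => (F k x)%:E) by exact/measurable_EFinP.
have E0 k x : setT x -> (0 <= (F k x)%:E)%E by rewrite lee_fin.
have S : (\int[mu]_x (\sum_(0 <= k <oo) (F k x)%:E) < +oo)%E.
  rewrite integral_nneseries//.
  apply: (@le_lt_trans _ _ 1%E); last exact: ltry.
  apply: le_trans (epsilon_trick0 xpredT ler01).
  by apply: lee_nneseries => [k _ _|k _]; [apply: integral_ge0 => x _; exact: E0|exact: Fi].
have iS : mu.-integrable setT (fun x => \sum_(0 <= k <oo) (F k x)%:E)%E.
  apply/integrableP; split; first by apply: ge0_emeasurable_sum => // k x Dx _; exact: E0.
  under eq_integral => x _.
    rewrite gee0_abs; last by apply: nneseries_ge0 => k _ _; exact: E0.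
    over.
  exact: S.
apply: filterS (integrable_ae measurableT iS) => x /(_ I) H.
apply: nnseries_is_cvg => //; rewrite -ge0_fin_numE//.
by apply: nneseries_ge0 => k _ _; exact: E0.
Qed.

(** Along indices where the n-th integral is at most 2^-(n+1), the sum of the functions has a finite
    integral; it is then finite almost everywhere and its terms tend to 0. *)
Lemma ae_cvg0_subseq (F : nat -> T -> R) :
  (forall k, measurable_fun setT (F k)) -> (forall k x, 0 <= F k x) ->
  (\int[mu]_x (F k x)%:E)%E @[k --> \oo] --> 0%E ->
  exists k : nat -> nat, (forall n, (n <= k n)%N) /\
    {ae mu, forall x, F (k n) x @[n --> \oo] --> (0 : R)}.
Proof.
move=> mF F0 Fi.
have [k Hk] : {k : nat -> nat & forall n, (n <= k n)%N /\
    (\int[mu]_x (F (k n) x)%:E <= (1 / (2 ^ n.+1)%:R)%:E)%E}.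
  apply: (@choice _ _ (fun n m => (n <= m)%N /\ (\int[mu]_x (F m x)%:E <= (1 / (2 ^ n.+1)%:R)%:E)%E)) => n.
  have e0 : (0 < (1 / (2 ^ n.+1)%:R)%:E :> \bar R)%E by rewrite lte_fin divr_gt0// ltr0n expn_gt0.
  have [N _ HN] : \forall m \near \oo, (\int[mu]_x (F m x)%:E < (1 / (2 ^ n.+1)%:R)%:E)%E.
    move/fine_cvgP : Fi => [fi /cvgr_lt/(_ (1 / (2 ^ n.+1)%:R))].
    rewrite -lte_fin => /(_ e0) fl; near=> m.
    rewrite -[ltLHS]fineK; last by near: m.
    by rewrite lte_fin; near: m.
  exists (maxn n N); split; first exact: leq_maxl.
  by apply/ltW/HN; rewrite /= leq_maxr.
exists k; split=> [n|]; first by have [] := Hk n.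
have := @ae_series_cvg (fun n => F (k n)) (fun=> mF _) (fun=> F0 _) (fun n => (Hk n).2).
by apply: filterS => x; exact: cvg_series_cvg_0.
Unshelve. all: by end_near.
Qed.

(** Riesz-Fischer: a rapidly converging subsequence converges almost everywhere, and Fatou's lemma
    compares the whole sequence with its limit. *)
Lemma L2_complete (X : nat -> T -> R) : (forall n, L2 (X n)) ->
  (forall e, 0 < e -> exists N, forall m n, (N <= m)%N -> (N <= n)%N ->
     nsq (fun x => X m x - X n x) <= e) ->
  exists2 Y, L2 Y & nsq (fun x => X n x - Y x) @[n --> \oo] --> (0 : R).
Proof.
move=> X2 CX.
have [k Hk] : {k : nat -> nat & forall n, forall m, (k n <= m)%N ->
    nsq (fun x => X (k n) x - X m x) <= (8 ^+ n.+1)^-1}.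
  apply: (@choice _ _ (fun n N => forall m, (N <= m)%N ->
    nsq (fun x => X N x - X m x) <= (8 ^+ n.+1)^-1)) => n.
  have [|N HN] := CX (8 ^+ n.+1)^-1; first by rewrite invr_gt0 exprn_gt0.
  by exists N => m Nm; exact: HN.
pose K := fix K n := if n is m.+1 then maxn (K m).+1 (k n) else k 0%N.
have KS n : (K n < K n.+1)%N by rewrite /= leq_maxl.
have kK n : (k n <= K n)%N by case: n => //= n; rewrite leq_maxr.
have Kd n m : (k n <= m)%N -> nsq (fun x => X m x - X (K n) x) <= 4 * (8 ^+ n.+1)^-1.
  move=> nm; apply: le_trans (nsqB_triangle (X2 m) (X2 (k n)) (X2 _)) _.
  rewrite (nsqBC (X m)); have := Hk n m nm; have := Hk n _ (kK n); lra.
have K2 n : L2 (fun x => X (K n.+1) x - X (K n) x) by exact: L2B.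
(* The weight 4^n against 8^-n leaves summable integrals, while boundedness of [F n x] in n makes
   the increments O(2^-n), hence summable. *)
pose F n x := 4 ^+ n * (X (K n.+1) x - X (K n) x) ^+ 2.
have mF n : measurable_fun setT (F n).
  by apply: measurable_funM => //; apply: measurable_funX; exact: L2_measurable.
have F0 n x : 0 <= F n x by apply: mulr_ge0; [exact: exprn_ge0|exact: sqr_ge0].
have Fi n : (\int[mu]_x (F n x)%:E <= (1 / (2 ^ n.+1)%:R)%:E)%E.
  under eq_integral do rewrite EFinM.
  rewrite ge0_integralZl_EFin//; last 2 first.
  - by move=> x _; rewrite lee_fin sqr_ge0.
  - by apply/measurable_EFinP/measurable_funX; exact: L2_measurable.
  rewrite integral_sqr// -EFinM lee_fin.
  apply: (@le_trans _ _ (4 ^+ n * (4 * (8 ^+ n.+1)^-1))).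
    rewrite ler_wpM2l ?exprn_ge0//; apply: Kd; exact: leq_trans (kK n) (ltnW (KS n)).
  rewrite natrX (_ : 8 = 4 * 2 :> R); last by rewrite -natrM.
  rewrite exprMn mulrA -exprSr invfM mulrA mulfV ?mul1r//.
have cK : {ae mu, forall x, cvgn (fun n => X (K n) x)}.
  apply: filterS (ae_series_cvg mF F0 Fi) => x /cvg_series_bounded [M [Mr HM]].
  have {}HM n : F n x <= `|M| + 1.
    apply: le_trans (ler_norm _) _; apply: (HM (`|M| + 1)) => //.
    by rewrite (le_lt_trans (ler_norm _))// ltrDl.
  pose C : R := `|M| + 1.
  have dC n : `|X (K n.+1) x - X (K n) x| <= geometric C 2^-1 n.
    rewrite /geometric /= -(@ler_pXn2r _ 2)// ?nnegrE//; last first.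
      by rewrite mulr_ge0// ?exprn_ge0// /C addr_ge0.
    rewrite real_normK ?num_real// exprMn -exprM mulnC exprM.
    have -> : (2^-1 : R) ^+ 2 = 4^-1 by rewrite exprVn -natrX.
    rewrite exprVn ler_pdivlMr ?exprn_gt0// mulrC.
    apply: le_trans (HM n) _; rewrite -/C.
    have : 1 <= C by rewrite /C lerDr.
    nra.
  have cs : cvgn (series (fun n => X (K n.+1) x - X (K n) x)).
    apply: normed_cvg.
    apply: (@series_le_cvg _ _ (geometric C 2^-1)) => [n|n|n|].
    - exact: normr_ge0.
    - exact: le_trans (normr_ge0 _) (dC n).
    - exact: dC.
    - apply: is_cvg_geometric_series.
      by rewrite ger0_norm ?invr_ge0// invf_lt1// ltr1n.
  have -> : (fun n => X (K n) x) =
     (fun n => series (fun n => X (K n.+1) x - X (K n) x) n + X (K 0%N) x).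
    by apply/funext => n; rewrite /series /= telescope_sumr// subrK.
  by apply: is_cvgD => //; exact: is_cvg_cst.
(* The upper limit is measurable on the whole space and equals the limit wherever that exists. *)
pose Y x := fine (limn_esup (fun n => (X (K n) x)%:E)).
have mY : measurable_fun setT Y.
  apply: measurableT_comp => //; apply: measurable_fun_limn_esup => n.
  by apply/measurable_EFinP; exact: L2_measurable.
have cY : {ae mu, forall x, X (K n) x @[n --> \oo] --> Y x}.
  apply: filterS cK => x cx; rewrite /Y.
  suff /cvg_limn_einf_sup[_ -> //] :
    (X (K n) x)%:E @[n --> \oo] --> (limn (fun n => X (K n) x))%:E.
  by apply: cvg_EFin => //; exact: nearW.
have XY n (e : R) : (forall m, (n <= m)%N -> nsq (fun x => X n x - X m x) <= e) ->
    (\int[mu]_x ((X n x - Y x) ^+ 2)%:E <= e%:E)%E.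
  move=> He; apply: (@fatou_le (fun k x => (X n x - X (K k) x) ^+ 2)).
  - by move=> m; apply: measurable_funX; apply: measurable_funB; exact: L2_measurable.
  - by move=> m x; exact: sqr_ge0.
  - by apply: measurable_funX; apply: measurable_funB => //; exact: L2_measurable.
  - by move=> x; exact: sqr_ge0.
  - apply: filterS cY => x cx.
    apply: (@cvg_comp _ _ _ _ (fun y => y ^+ 2) _ (nbhs (X n x - Y x))).
      by apply: cvgB => //; exact: cvg_cst.
    exact: exprn_continuous.
  - exists n => // m /= nm; rewrite integral_sqr; last exact: L2B.
    rewrite lee_fin He//.
    have nK i : (i <= K i)%N by elim: i => // i IH; exact: leq_ltn_trans IH (KS i).
    exact: leq_trans nm (nK m).
have Y2 : L2 Y.
  have [N1 HN1] := CX 1 ltr01.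
  have XY2 : L2 (fun x => X N1 x - Y x).
    apply: L2_lty; first by apply: measurable_funB => //; exact: L2_measurable.
    apply: le_lt_trans (ltry 1); apply: XY => m; exact: HN1.
  have := L2B (X2 N1) XY2; congr L2; apply/funext => x; ring.
have XY2 n : L2 (fun x => X n x - Y x) by exact: L2B.
exists Y => //; apply/cvgrPdist_le => e e0.
have [N HN] := CX e e0.
exists N => // n /= Nn; rewrite sub0r normrN ger0_norm ?nsq_ge0//.
rewrite -lee_fin -integral_sqr//; apply: XY => m nm; apply: HN => //.
exact: leq_trans Nn nm.
Qed.
End square_integrable.

Section density.
Context d (T : measurableType d) (R : realType).
Variables mu nu : {measure set T -> \bar R}.
Local Open Scope ereal_scope.

Import HBNNSimple.

(** By monotone convergence both sides are limits along simple functions increasing to [f], for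
    which the identity is the hypothesis on sets. *)
Lemma ge0_integral_density (g : T -> R) (f : T -> \bar R) :
  measurable_fun setT g -> (forall x, 0 <= g x)%R ->
  measurable_fun setT f -> (forall x, 0 <= f x) ->
  (forall A, measurable A -> nu A = \int[mu]_(x in A) (g x)%:E) ->
  \int[nu]_x f x = \int[mu]_x (f x * (g x)%:E).
Proof.
move=> mg g0 mf f0 nug.
pose f_ := nnsfun_approx measurableT mf.
have f_f x : (f_ n x)%:E @[n --> \oo] --> f x by exact: cvg_nnsfun_approx.
have f_nd x : {homo (fun n => f_ n x) : m n / (m <= n)%N >-> (m <= n)%R}.
  by move=> m n mn; exact/lefP/nd_nnsfun_approx.
transitivity (limn (fun n => \int[nu]_x (f_ n x)%:E)).
  rewrite -monotone_convergence//.
  - by apply: eq_integral => x _; apply/esym/cvg_lim => //; exact: f_f.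
  - by move=> n; exact/measurable_EFinP.
  - by move=> n x _; rewrite lee_fin.
  - by move=> x _ m n mn; rewrite lee_fin; exact: f_nd.
have g0E x : 0 <= (g x)%:E by rewrite lee_fin.
have mgE : measurable_fun setT (fun x => (g x)%:E) by exact/measurable_EFinP.
transitivity (limn (fun n => \int[mu]_x ((f_ n x)%:E * (g x)%:E))); last first.
  rewrite -monotone_convergence//.
  - apply: eq_integral => x _; apply/cvg_lim => //.
    exact: cvgeZr.
  - by move=> n; apply: emeasurable_funM => //; exact/measurable_EFinP.
  - by move=> n x _; rewrite mule_ge0// lee_fin.
  - by move=> x _ m n mn; rewrite lee_wpmul2r// lee_fin; exact: f_nd.
congr (limn _); apply/funext => n.
have mI r : measurable_fun setT (fun x => (r * \1_(f_ n @^-1` [set r]) x)%:E).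
  by apply/measurable_EFinP/measurable_funM.
transitivity (\sum_(k \in range (f_ n))
    \int[mu]_x ((k * \1_(f_ n @^-1` [set k]) x)%:E * (g x)%:E)).
  under eq_integral do rewrite fimfunE -fsumEFin//.
  rewrite ge0_integral_fsum//; last by move=> r x _; rewrite nnfun_muleindic_ge0.
  apply: eq_fsbigr => r _; rewrite integralZl_indic_nnsfun// integral_indic//= setIT.
  under eq_integral do rewrite EFinM -muleA.
  have [r0|r0] := ltP r 0%R.
    rewrite (_ : f_ n @^-1` [set r] = set0) ?measure0 ?mule0; last first.
      by apply: preimage_nnfun0.
    by rewrite integral0_eq// => x _; rewrite indic0 mul0e mule0.
  rewrite ge0_integralZl_EFin//; last 2 first.
  - by move=> x _; rewrite mule_ge0// lee_fin.
  - by apply: emeasurable_funM => //; exact/measurable_EFinP.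
  congr (_ * _); rewrite nug// integral_mkcond; apply: eq_integral => x _.
  by rewrite patchE indicE; case: ifPn => _; rewrite ?mul1e ?mul0e.
rewrite -ge0_integral_fsum//.
- apply: eq_integral => x _; rewrite fimfunE -fsumEFin//.
  by rewrite ge0_mule_fsuml// => r; exact: nnfun_muleindic_ge0.
- by move=> r; apply: emeasurable_funM.
- by move=> r x _; rewrite mule_ge0//; exact: nnfun_muleindic_ge0.
Qed.
End density.

Definition push_measure d d' (T1 : measurableType d) (T2 : measurableType d')
    (R : realFieldType) (mu : {measure set T1 -> \bar R}) (f : T1 -> T2)
    (mf : measurable_fun setT f) : {measure set T2 -> \bar R} :=
  measure_function_pushforward__canonical__measure_function_Measure mu mf.

(** * Gaussian laws *)

Section affine_change_of_variables.
Context (R : realType).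
Notation mu := (@lebesgue_measure R).

Definition affine (m s z : R) : measurableTypeR R := m + s * z.

Lemma measurable_affine (m s : R) : measurable_fun setT (affine m s).
Proof. by apply: measurable_funD => //; exact: measurable_funM. Qed.

(** The right-hand side is a measure in A that gives every ]a, b] its length, and this characterises
    Lebesgue measure. *)
Lemma lebesgue_measure_affine (m s : R) (A : set R) : 0 < s -> measurable A ->
  (mu A = s%:E * mu (affine m s @^-1` A))%E.
Proof.
move=> s0 mA.
pose nu := mscale (NngNum (ltW s0)) (push_measure mu (measurable_affine m s)).
apply: (@lebesgue_measure_unique _ nu) => // _ [[a b]] _ <-.
transitivity (s%:E * mu (affine m s @^-1` `]a, b]))%E; last by [].
rewrite (_ : affine m s @^-1` _ = `](a - m) / s, (b - m) / s]%classic); last first.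
  apply/seteqP; split => z; rewrite /affine /= !in_itv /=;
    rewrite ltr_pdivrMr// ler_pdivlMr// ltrBlDl lerBrDl [s * z]mulrC//.
rewrite !lebesgue_measure_itv/= !lte_fin ltr_pM2r ?invr_gt0// ltrD2r.
case: ifPn => _; last by rewrite mule0.
by rewrite -!EFinB -EFinM; congr EFin; field; rewrite gt_eqF.
Qed.

Lemma ge0_integral_affine (m s : R) (f : R -> \bar R) : 0 < s ->
  measurable_fun setT f -> (forall x, 0 <= f x)%E ->
  (\int[mu]_x f x = s%:E * \int[mu]_x f (m + s * x)%R)%E.
Proof.
move=> s0 mf f0.
pose nu := mscale (NngNum (ltW s0)) (push_measure mu (measurable_affine m s)).
transitivity (\int[nu]_x f x)%E.
  by apply: eq_measure_integral => A mA _; exact: lebesgue_measure_affine.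
rewrite ge0_integral_mscale//; congr (_ * _)%E.
rewrite ge0_integral_pushforward ?preimage_setT//; exact: measurable_affine.
Qed.

End affine_change_of_variables.

Section standard_normal.
Context (R : realType).
Notation mu := (@lebesgue_measure R).
Notation N01 := (normal_prob (0 : R) 1).

Definition phi01 (x : R) : R := normal_pdf 0 1 x.

Lemma phi01E x : phi01 x = (Num.sqrt (pi *+ 2))^-1 * expR (- x ^+ 2 / 2).
Proof.
rewrite /phi01 normal_pdfE ?oner_eq0//= /normal_peak /normal_fun.
by rewrite subr0 !expr1n mul1r.
Qed.

Lemma phi01_ge0 x : 0 <= phi01 x. Proof. exact: normal_pdf_ge0. Qed.

Lemma measurable_phi01 : measurable_fun setT phi01.
Proof. exact: measurable_normal_pdf. Qed.

Lemma ge0_integral_N01 (f : R -> \bar R) :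
  measurable_fun setT f -> (forall x, 0 <= f x)%E ->
  (\int[N01]_x f x = \int[mu]_x (f x * (phi01 x)%:E))%E.
Proof.
move=> mf f0; apply: ge0_integral_density => //.
- exact: measurable_phi01.
- exact: phi01_ge0.
Qed.

Lemma normal_prob_N01 (m s : R) (A : set R) : 0 < s -> measurable A ->
  (normal_prob m s A = N01 ((fun z => m + s * z)%R @^-1` A))%E.
Proof.
move=> s0 mA; have mB : measurable ((fun z => m + s * z) @^-1` A).
  by rewrite -[X in measurable X]setTI; exact: measurable_affine.
rewrite /normal_prob integral_mkcond [RHS]integral_mkcond.
rewrite (ge0_integral_affine m s0)/=; last 2 first.
- apply/(measurable_restrictT _ _).1 => //; apply/measurable_funTS/measurable_EFinP.
  exact: measurable_normal_pdf.
- by move=> x; apply: erestrict_ge0 => y _; rewrite lee_fin normal_pdf_ge0.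
rewrite -ge0_integralZl_EFin//; last 3 first.
- by move=> x _; rewrite /= /patch; case: ifPn => // _; rewrite lee_fin normal_pdf_ge0.
- apply: (measurableT_comp (f := (fun x => (normal_pdf m s x)%:E) \_ A) _ (measurable_affine m s)).
  apply/(measurable_restrictT _ _).1 => //; apply/measurable_funTS/measurable_EFinP.
  exact: measurable_normal_pdf.
- exact: ltW.
apply: eq_integral => x _; rewrite /patch.
have -> : (x \in (fun z => m + s * z) @^-1` A) = (m + s * x \in A).
  by apply/idP/idP; rewrite !inE.
case: ifPn => _; last by rewrite mule0.
rewrite -EFinM; congr EFin; rewrite -/(phi01 x) phi01E normal_pdfE ?gt_eqF//=.
rewrite /normal_peak /normal_fun -mulrnAr sqrtrM ?sqr_ge0// sqrtr_sqr gtr0_norm//.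
rewrite invfM mulrA mulrA mulfV ?gt_eqF// mul1r; congr (_ * expR _).
by rewrite addrAC subrr add0r exprMn -mulr_natr; field; rewrite gt_eqF.
Qed.

(** Writing every law as the image of [N01] under one affine map absorbs the case v = 0: the map is
    then constant and its image law is the Dirac mass. *)
Lemma gaussian_lawE (m v : R) (A : set R) : 0 <= v -> measurable A ->
  gaussian_law m v A = N01 ((fun z => m + Num.sqrt v * z)%R @^-1` A).
Proof.
move=> v0 mA; rewrite /gaussian_law; case: ifPn => [/eqP ->|v1].
  rewrite sqrtr0 diracE; have [mAA|mAA] := boolP (m \in A).
    rewrite (_ : _ @^-1` _ = setT) ?probability_setT//.
    by apply/seteqP; split => // x _ /=; rewrite mul0r addr0; rewrite inE in mAA.
  rewrite (_ : _ @^-1` _ = set0) ?measure0//.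
  apply/seteqP; split => // x /=; rewrite mul0r addr0 => H.
  by move: mAA; rewrite notin_setE.
by apply: normal_prob_N01 => //; rewrite sqrtr_gt0 lt_neqAle eq_sym v1.
Qed.

Lemma continuous_expRsqr (c : R) : continuous (fun x : R => expR (c * x ^+ 2)).
Proof.
move=> x; apply: (@continuous_comp _ _ _ (fun x : R => c * x ^+ 2) expR).
  by apply: cvgM; [exact: cvg_cst|exact: exprn_continuous].
exact: continuous_expR.
Qed.

(* The rotation [(x, y) |-> (z, u)] by the angle of tangent [sqrt b / sqrt a]. *)
Lemma normal_prob_add (a b : R) (A : set R) : 0 < a -> 0 < b -> measurable A ->
  (\int[N01]_x N01 [set y | A (Num.sqrt a * x + Num.sqrt b * y)%R] =
   N01 [set z | A (Num.sqrt (a + b) * z)%R])%E.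
Proof.
move=> a0 b0 mA.
have ra0 : 0 < Num.sqrt a by rewrite sqrtr_gt0.
have rb0 : 0 < Num.sqrt b by rewrite sqrtr_gt0.
set p := Num.sqrt a in ra0 *; set q := Num.sqrt b in rb0 *.
have pa : p ^+ 2 = a by rewrite sqr_sqrtr// ltW.
have qb : q ^+ 2 = b by rewrite sqr_sqrtr// ltW.
set s := Num.sqrt (a + b).
have s0 : 0 < s by rewrite sqrtr_gt0 addr_gt0.
have sab : s ^+ 2 = p ^+ 2 + q ^+ 2 by rewrite sqr_sqrtr ?pa ?qb// ltW// addr_gt0.
pose I z : \bar R := (\1_A z)%:E.
have mI : measurable_fun setT I by apply/measurable_EFinP.
have N01_preimage m r : 0 < r ->
    (N01 [set y | A (m + r * y)%R] =
     \int[mu]_y (I y * (phi01 ((y - m) / r) / r)%:E))%E.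
  move=> r0.
  have mB : measurable [set y | A (m + r * y)].
    by rewrite -[X in measurable X]setTI; exact: (@measurable_affine _ m r).
  rewrite (ge0_integral_affine m r0)/=; last 2 first.
  - apply: emeasurable_funM => //; apply/measurable_EFinP; apply: measurable_funM => //.
    apply: measurableT_comp; first exact: measurable_phi01.
    by apply: measurable_funM => //; exact: measurable_funB.
  - by move=> x; rewrite mule_ge0// lee_fin ?divr_ge0 ?phi01_ge0// ltW.
  rewrite -ge0_integralZl_EFin//; last 3 first.
  - by move=> x _; rewrite mule_ge0// lee_fin ?divr_ge0 ?phi01_ge0// ltW.
  - apply: emeasurable_funM.
      exact: (measurableT_comp (f := I) _ (measurable_affine m r)).
    apply/measurable_EFinP; apply: measurable_funM => //.
    apply: measurableT_comp; first exact: measurable_phi01.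
    apply: measurable_funM => //; apply: measurable_funB => //.
    exact: measurable_affine.
  - exact: ltW.
  rewrite /normal_prob [LHS]integral_mkcond; apply: eq_integral => x _.
  have -> : (m + r * x - m) / r = x by field; rewrite gt_eqF.
  rewrite /patch /I indicE.
  have -> : (x \in [set y | A (m + r * y)]) = (m + r * x \in A).
    by apply/idP/idP; rewrite !inE.
  case: ifPn => _ /=; last by rewrite mul0e mule0.
  by rewrite mul1e -EFinM /phi01; congr EFin; field; rewrite gt_eqF.
have mphic (h : measurableTypeR R * measurableTypeR R -> R) : measurable_fun setT h ->
    measurable_fun setT (fun z => phi01 (h z)).
  by move=> mh; apply: measurableT_comp => //; exact: measurable_phi01.
pose F (z : measurableTypeR R * measurableTypeR R) : \bar R :=
  (* The joint density of x and z = p x + q y, times the indicator of A at z; Tonelli then allows x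
     to be integrated out at fixed z. *)
  (I z.2 * (phi01 ((z.2 - p * z.1) / q) / q * phi01 z.1)%:E)%E.
have mF : measurable_fun setT F.
  apply: emeasurable_funM; first by apply: measurableT_comp => //; exact: measurable_snd.
  apply/measurable_EFinP; apply: measurable_funM; last by apply: mphic; exact: measurable_fst.
  apply: measurable_funM => //; apply: mphic; apply: measurable_funM => //.
  apply: measurable_funB; first exact: measurable_snd.
  by apply: measurable_funM => //; exact: measurable_fst.
have F0 z : (0 <= F z)%E.
  by rewrite mule_ge0// lee_fin// mulr_ge0 ?divr_ge0 ?phi01_ge0// ltW.
transitivity (\int[mu]_x \int[mu]_z F (x, z))%E.
  rewrite ge0_integral_N01//; last first.
    pose D := [set z : measurableTypeR R * measurableTypeR R | A (p * z.1 + q * z.2)].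
    have mD : measurable D.
      rewrite -[X in measurable X]setTI.
      have : measurable_fun setT (fun z : measurableTypeR R * measurableTypeR R => p * z.1 + q * z.2).
        by apply: measurable_funD; apply: measurable_funM.
      by move/(_ measurableT); apply.
    have := measurable_fun_xsection N01 mD; congr measurable_fun; apply/funext => x /=.
    by congr normal_prob; apply/seteqP; split => y; rewrite /xsection /D /= inE.
  apply: eq_integral => x _.
  rewrite N01_preimage// -ge0_integralZr//; last 3 first.
  - apply: emeasurable_funM => //; apply/measurable_EFinP; apply: measurable_funM => //.
    apply: measurableT_comp; first exact: measurable_phi01.
    by apply: measurable_funM => //; exact: measurable_funB.
  - by move=> z _; rewrite mule_ge0// lee_fin ?divr_ge0 ?phi01_ge0// ltW.
  - by rewrite lee_fin phi01_ge0.
  by apply: eq_integral => z _; rewrite /F /= -muleA -EFinM.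
have -> := @fubini_tonelli _ _ _ _ R mu mu F mF F0.
transitivity (\int[mu]_z (I z * (phi01 (z / s) / s)%:E))%E; last first.
  have := N01_preimage 0 s s0; rewrite (_ : [set y | A (0 + s * y)] = [set z | A (s * z)]).
    by move=> ->; apply: eq_integral => z _; rewrite subr0.
  by apply/seteqP; split => y /=; rewrite add0r.
apply: eq_integral => z _; rewrite /fubini_G /F /=.
have mG : measurable_fun setT (fun x => (phi01 ((z - p * x) / q) / q * phi01 x)%:E).
  apply/measurable_EFinP; apply: measurable_funM; last exact: measurable_phi01.
  apply: measurable_funM => //; apply: measurableT_comp; first exact: measurable_phi01.
  by apply: measurable_funM => //; apply: measurable_funB => //; exact: measurable_funM.
have G0 x : (0 <= (phi01 ((z - p * x) / q) / q * phi01 x)%:E)%E.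
  by rewrite lee_fin mulr_ge0 ?divr_ge0 ?phi01_ge0// ltW.
rewrite [LHS](@ge0_integralZl_EFin _ _ _ mu setT)//; congr (_ * _)%E.
(* Given z, the variable x is normal with mean p z / s^2 and deviation q / s; in the standardised
   variable u the density splits into a function of z times [phi01 u]. *)
rewrite (@ge0_integral_affine _ (p * z / s ^+ 2) (q / s))//; last by rewrite divr_gt0.
under eq_integral => u _.
  have -> : phi01 ((z - p * (p * z / s ^+ 2 + q / s * u)) / q) / q *
      phi01 (p * z / s ^+ 2 + q / s * u) = phi01 (z / s) / q * phi01 u.
    rewrite !phi01E.
    have H : - ((z - p * (p * z / s ^+ 2 + q / s * u)) / q) ^+ 2 / 2 +
       - (p * z / s ^+ 2 + q / s * u) ^+ 2 / 2 = - (z / s) ^+ 2 / 2 + - u ^+ 2 / 2.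
      have -> : (z - p * (p * z / s ^+ 2 + q / s * u)) / q = q * z / s ^+ 2 - p / s * u.
        have zE : z = (p ^+ 2 + q ^+ 2) * z / s ^+ 2.
          by rewrite -sab; field; rewrite gt_eqF.
        rewrite {1}zE; field; rewrite !gt_eqF//.
      have -> : - (z / s) ^+ 2 / 2 + - u ^+ 2 / 2 =
         - (s ^+ 2 * (z / s ^+ 2) ^+ 2 + (s ^+ 2) * (u / s) ^+ 2) / 2.
        by field; rewrite gt_eqF.
      have -> : p / s * u = p * (u / s) by ring.
      have -> : q / s * u = q * (u / s) by ring.
      by rewrite -!(mulrA _ z); move: (z / s ^+ 2) (u / s) => w v; rewrite sab; field.
    by rewrite mulrAC mulrACA -expRD H expRD; ring.
  over.
under eq_integral do rewrite EFinM.
rewrite ge0_integralZl_EFin//; last 3 first.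
- by move=> x _; rewrite lee_fin phi01_ge0.
- by apply/measurable_EFinP; exact: measurable_phi01.
- by rewrite divr_ge0 ?phi01_ge0// ltW.
rewrite /phi01 integral_normal_pdf mule1 -EFinM; congr EFin.
by field; rewrite !gt_eqF.
Qed.

End standard_normal.

(** * Gaussian weights: decay and integration by parts *)

Section gaussian_decay.
Context (R : realType).
Notation mu := (@lebesgue_measure R).

(** One family for all Gaussian factors: rate 1 is the weight of the Hermite polynomials, 1/2 that
    of the Hermite functions, 1/4 a weaker decay and the multiplier of the density proof; negative
    rates measure growth. *)
Definition gsb (b x : R) : R := expR (- (b * x ^+ 2)).

Lemma gsb_ge0 b x : 0 <= gsb b x. Proof. exact: expR_ge0. Qed.

Lemma gsbD a b x : gsb (a + b) x = gsb a x * gsb b x.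
Proof. by rewrite /gsb -expRD; congr expR; ring. Qed.

Lemma gsb_le1 b x : 0 <= b -> gsb b x <= 1.
Proof. by move=> b0; rewrite -[leRHS]expR0 ler_expR oppr_le0 mulr_ge0// sqr_ge0. Qed.

Lemma le_gsb a b x : a <= b -> gsb b x <= gsb a x.
Proof. by move=> ab; rewrite ler_expR lerN2 ler_wpM2r// sqr_ge0. Qed.

Lemma continuous_gsb b : continuous (gsb b).
Proof.
have -> : gsb b = (fun x => expR (- b * x ^+ 2)).
  by apply/funext => x; rewrite /gsb mulNr.
exact: continuous_expRsqr.
Qed.

Lemma measurable_gsb b : measurable_fun setT (gsb b).
Proof. by apply: continuous_measurable_fun; exact: continuous_gsb. Qed.

Lemma integrable_gsb b : 0 < b -> mu.-integrable setT (EFin \o gsb b).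
Proof.
move=> b0; apply/integrableP; split.
  by apply/measurable_EFinP; exact: measurable_gsb.
under eq_integral do rewrite /= ger0_norm ?gsb_ge0//.
have s0 : 0 < Num.sqrt b by rewrite sqrtr_gt0.
have := @integralT_gauss R.
rewrite (@ge0_integral_affine _ 0 (Num.sqrt b))//; last 2 first.
- by apply/measurable_EFinP; exact: measurable_gauss_fun.
- by move=> x; rewrite lee_fin gauss_fun_ge0.
have -> : (fun x => (gauss_fun (0 + Num.sqrt b * x))%:E) = (fun x => (gsb b x)%:E).
  by apply/funext => x; rewrite /gauss_fun /gsb add0r exprMn sqr_sqrtr// ltW.
case: (\int[mu]_x (gsb b x)%:E)%E => [r _||//]; first exact: ltry.
by rewrite gt0_muley ?lte_fin.
Qed.

Lemma gsb_integrable (b C : R) (f : R -> R) : 0 < b -> measurable_fun setT f ->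
  (forall x, `|f x| <= C * gsb b x) -> mu.-integrable setT (EFin \o f).
Proof.
move=> b0 mf fC; have := integrableZl measurableT C (integrable_gsb b0).
apply: le_integrable => //; first exact/measurable_EFinP.
by move=> x _ /=; rewrite lee_fin (le_trans (fC x))// ler_norm.
Qed.

(** Each degree is paid for with half of the exponent: |x| <= 1 + x^2 <= (1 + 2/c) (1 + c x^2 / 2)
    <= (1 + 2/c) exp(c x^2 / 2). *)
Lemma horner_le_gsb (p : {poly R}) : forall c, 0 < c -> exists2 C, 0 <= C &
  forall x, `|p.[x]| <= C * gsb (- c) x.
Proof.
elim/poly_ind: p => [|p a IH] c c0.
  by exists 0 => // x; rewrite horner0 normr0 mul0r.
have c20 : 0 < c / 2 by rewrite divr_gt0.
have [C C0 HC] := IH _ c20.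
have k0 : 0 <= 1 + 2 / c by rewrite addr_ge0// divr_ge0// ltW.
exists (C * (1 + 2 / c) + `|a|); first by rewrite addr_ge0// mulr_ge0.
move=> x; rewrite hornerMXaddC (le_trans (ler_normD _ _))// mulrDl lerD//; last first.
  by rewrite ler_peMr// -[leLHS]expR0 ler_expR mulNr opprK mulr_ge0 ?sqr_ge0// ltW.
have -> : - c = - (c / 2) + - (c / 2) by field.
rewrite normrM gsbD mulrACA ler_pM//.
have : 1 + c / 2 * x ^+ 2 <= gsb (- (c / 2)) x.
  by rewrite /gsb mulNr opprK expR_ge1Dx.
have x1 : `|x| <= 1 + x ^+ 2.
  rewrite -[x ^+ 2]real_normK ?num_real//; have := sqr_ge0 (`|x| - 1); have := normr_ge0 x; nra.
move=> H; apply: le_trans (ler_wpM2l k0 H).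
apply: le_trans x1 _.
have -> : (1 + 2 / c) * (1 + c / 2 * x ^+ 2) = 1 + x ^+ 2 + (2 / c + c / 2 * x ^+ 2).
  by field; rewrite gt_eqF.
rewrite lerDl addr_ge0//; last by rewrite mulr_ge0 ?sqr_ge0// ltW.
by rewrite divr_ge0// ltW.
Qed.

Lemma horner_gsb_le (p : {poly R}) a b : b < a -> exists2 C, 0 <= C &
  forall x, `|p.[x] * gsb a x| <= C * gsb b x.
Proof.
rewrite -subr_gt0 => ab; have [C C0 HC] := horner_le_gsb p ab.
exists C => // x; rewrite normrM (ger0_norm (gsb_ge0 _ _)).
apply: le_trans (ler_wpM2r (gsb_ge0 _ _) (HC x)) _.
by rewrite -mulrA -gsbD (_ : - (a - b) + a = b)//; ring.
Qed.

Lemma cvg_gsb_nat b (s : R) : 0 < b -> `|s| = 1 -> gsb b (s * n%:R) @[n --> \oo] --> (0 : R).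
Proof.
move=> b0 s1; have s2 : s ^+ 2 = 1 by rewrite -real_normK ?num_real// s1 expr1n.
apply: (@squeeze_cvgr _ _ _ _ (fun=> 0) (fun n => b^-1 * (n%:R : R)^-1)).
- near=> n; rewrite gsb_ge0/= /gsb exprMn s2 mul1r expRN -invfM lef_pV2 ?posrE ?expR_gt0//; last first.
    by rewrite mulr_gt0// ltr0n; near: n; exists 1%N.
  have n1 : (1 : R) <= n%:R by rewrite ler1n; near: n; exists 1%N.
  have := @expR_ge1Dx R (b * n%:R ^+ 2).
  have : b * n%:R <= b * n%:R ^+ 2 by rewrite ler_pM2l// expr2 ler_peMl// ler0n.
  lra.
- exact: cvg_cst.
- rewrite -(mulr0 b^-1); apply: cvgM; first exact: cvg_cst.
  apply/gtr0_cvgV0; last exact: cvgr_idn.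
  by near=> n; rewrite ltr0n; near: n; exists 1%N.
Unshelve. all: by end_near.
Qed.

(** On [-n, n] the integral is F(n) - F(-n), which tends to 0; the decay of [f] justifies the
    passage to the whole line. *)
Lemma integral_derive0 (F f : R -> R) (b C : R) : 0 < b ->
  (forall x : R, is_derive x 1 F (f x)) -> continuous f ->
  (forall x, `|F x| <= C * gsb b x) -> (forall x, `|f x| <= C * gsb b x) ->
  \int[mu]_x f x = 0.
Proof.
move=> b0 dF cf FC fC.
have mf : measurable_fun setT f by exact: continuous_measurable_fun.
have fi := gsb_integrable b0 mf fC.
have F0 s : `|s| = 1 -> F (s * n%:R) @[n --> \oo] --> (0 : R).
  move=> s1; apply/norm_cvg0P.
  apply: (@squeeze_cvgr _ _ _ _ (fun=> 0) (fun n => C * gsb b (s * n%:R))).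
  - by apply: nearW => n; rewrite normr_ge0 FC.
  - exact: cvg_cst.
  - by rewrite -(mulr0 C); apply: cvgM; [exact: cvg_cst|exact: cvg_gsb_nat].
pose g n x := (f x * \1_(`[- n%:R, n%:R]%classic) x)%:E.
have [|||||_ _ H] := @dominated_convergence _ _ _ mu setT measurableT
  g (EFin \o f) (abse \o (EFin \o f)).
- by move=> n; apply/measurable_EFinP/measurable_funM.
- exact: measurable_int fi.
- apply: aeW => x _; apply: cvg_near_cst; near=> n.
  rewrite /g /= indicE mem_set ?mulr1//= in_itv/= -ler_norml.
  near: n; exact: nbhs_infty_ger.
- exact: integrable_abse.
- apply: aeW => x n _; rewrite /g /= lee_fin normrM ler_piMr//.
  by rewrite indicE; case: (_ \in _); rewrite ?normr1 ?normr0.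
have H2 : (\int[mu]_x g n x)%E @[n --> \oo] --> (0 : \bar R).
  have : ((F n%:R)%:E - (F (- n%:R))%:E)%E @[n --> \oo] --> (0 : \bar R).
    apply: cvg_EFin; first exact: nearW.
    rewrite /= -(subr0 0); apply: cvgB.
      by have := F0 1 (normr1 _); under eq_fun do rewrite mul1r.
    by have := F0 (-1) (normrN1 _); under eq_fun do rewrite mulN1r.
  have cF : continuous F by move=> x; apply: differentiable_continuous; exact/derivable1_diffP.
  apply: cvg_trans; apply: near_eq_cvg; near=> n.
  rewrite -(@continuous_FTC2 _ f F).
  - rewrite integral_mkcond; apply: eq_integral => x _.
    by rewrite patchE /g indicE; case: ifPn => _; rewrite ?mulr1 ?mulr0.
  - have : (1 : R) <= n%:R by rewrite ler1n; near: n; exists 1%N.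
    lra.
  - exact: continuous_subspaceT.
  - split.
    + by move=> x _.
    + exact: cvg_at_right_filter (cF _).
    + exact: cvg_at_left_filter (cF _).
  - by move=> x _; rewrite derive1E; apply: derive_val.
by rewrite /Rintegral; have := cvg_unique _ H H2 => /= -> //.
Unshelve. all: by end_near.
Qed.

Lemma is_derive_gsb (b x : R) : is_derive x 1 (gsb b) (- (2 * b * x) * gsb b x).
Proof.
rewrite /gsb; apply: is_derive_eq.
by rewrite /GRing.scale /=; ring.
Qed.

Lemma is_derive_horner (p : {poly R}) (x : R) : is_derive x 1 (horner p) (p^`()).[x].
Proof.
elim/poly_ind: p => [|p a IH].
  rewrite deriv0 horner0 (_ : horner 0 = cst 0); first exact: is_derive_cst.
  by apply/funext => y; rewrite horner0.
rewrite (_ : horner (p * 'X + a%:P) = (fun y => p.[y] * y + a)); last first.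
  by apply/funext => y; rewrite hornerMXaddC.
apply: is_derive_eq; rewrite derivMXaddC hornerD hornerMX.
by rewrite /GRing.scale /=; ring.
Qed.

Lemma is_derive_horner_gsb (p : {poly R}) (b x : R) :
  is_derive x 1 (fun y => p.[y] * gsb b y) ((p^`() - (2 * b) *: ('X * p)).[x] * gsb b x).
Proof.
have H1 := is_derive_horner p x; have H2 := is_derive_gsb b x.
apply: is_derive_eq; rewrite !(hornerD,hornerN,hornerM,hornerZ,hornerX,hornerC).
by rewrite /GRing.scale /=; ring.
Qed.

Lemma continuous_horner_gsb (p : {poly R}) b : continuous (fun x => p.[x] * gsb b x).
Proof.
by move=> x; apply: cvgM; [exact: continuous_horner|exact: continuous_gsb].
Qed.

Lemma integrable_horner_gsb (p : {poly R}) b : 0 < b ->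
  mu.-integrable setT (EFin \o (fun x => p.[x] * gsb b x)).
Proof.
move=> b0; have b2 : b / 2 < b by lra.
have [C C0 HC] := horner_gsb_le p b2.
apply: (@gsb_integrable (b / 2) C _ _ _ HC); first by rewrite divr_gt0.
by apply: continuous_measurable_fun; exact: continuous_horner_gsb.
Qed.

(** The derivative of p times the weight has integral 0. This one integration by parts yields both
    the normal variance and the orthogonality of the Hermite polynomials. *)
Lemma integral_derive_horner_gsb (p : {poly R}) b : 0 < b ->
  \int[mu]_x (p^`().[x] * gsb b x) = 2 * b * \int[mu]_x (('X * p).[x] * gsb b x).
Proof.
move=> b0; have b2 : b / 2 < b by lra.
pose q := p^`() - (2 * b) *: ('X * p).
have [C1 C10 H1] := horner_gsb_le p b2.
have [C2 C20 H2] := horner_gsb_le q b2.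
have : \int[mu]_x (q.[x] * gsb b x) = 0.
  apply: (@integral_derive0 (fun y => p.[y] * gsb b y) _ (b / 2) (C1 + C2)).
  - by rewrite divr_gt0.
  - by move=> x; exact: is_derive_horner_gsb.
  - exact: continuous_horner_gsb.
  - by move=> x; rewrite (le_trans (H1 x))// ler_wpM2r ?gsb_ge0// lerDl.
  - by move=> x; rewrite (le_trans (H2 x))// ler_wpM2r ?gsb_ge0// lerDr.
have -> : (fun x => q.[x] * gsb b x) = (fun x => p^`().[x] * gsb b x - 2 * b * (('X * p).[x] * gsb b x)).
  by apply/funext => x; rewrite /q !(hornerD,hornerN,hornerM,hornerZ,hornerX,hornerC); ring.
have iX := integrable_horner_gsb ('X * p) b0.
rewrite RintegralB//; last 2 first.
- exact: integrable_horner_gsb.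
- exact: (integrableZl measurableT (2 * b) iX).
by rewrite RintegralZl// => /subr0_eq.
Qed.

End gaussian_decay.

(** * Normal variance, small balls, and uniqueness of laws tested on ramps *)

Section normal_moment.
Context (R : realType).
Notation mu := (@lebesgue_measure R).
Notation N01 := (normal_prob (0 : R) 1).

Lemma phi01_gsb x : phi01 x = (Num.sqrt (pi *+ 2))^-1 * gsb 2^-1 x :> R.
Proof. by rewrite phi01E /gsb; congr (_ * expR _); field. Qed.

Lemma normal_moment2 : (\int[N01]_z (z ^+ 2)%:E = 1)%E.
Proof.
rewrite ge0_integral_N01//; last first.
- by move=> x; rewrite lee_fin sqr_ge0.
- by apply/measurable_EFinP; exact: measurable_funX.
rewrite -[RHS](@integral_normal_pdf R 0 1).
pose c : R := (Num.sqrt (pi *+ 2))^-1.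
have b0 : 0 < 2^-1 :> R by rewrite invr_gt0.
transitivity (\int[mu]_x (c%:E * (('X * 'X).[x] * gsb 2^-1 x)%:E))%E.
  by apply: eq_integral => x _; rewrite -!EFinM phi01_gsb -/c hornerM hornerX; congr EFin; ring.
transitivity (\int[mu]_x (c%:E * (('X)^`().[x] * gsb 2^-1 x)%:E))%E; last first.
  by apply: eq_integral => x _; rewrite -EFinM -/(phi01 x) phi01_gsb derivX hornerC mul1r.
rewrite !integralZl//; [|exact: integrable_horner_gsb..].
congr (_ * _)%E.
(* With p = 'X and b = 1/2, integration by parts says that x^2 and 1 have the same Gaussian
   integral. *)
have := integral_derive_horner_gsb 'X b0; rewrite mulfV// mul1r /Rintegral.
move=> H; rewrite -[LHS]fineK; last by apply: integrable_fin_num => //; exact: integrable_horner_gsb.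
rewrite -[RHS]fineK; last by apply: integrable_fin_num => //; exact: integrable_horner_gsb.
by rewrite H.
Qed.

(** The standard density is at most 1/2, because 2 pi >= 4, and the event is an interval of length 2
    e / s. *)
Lemma normal_small (s e : R) : 0 < s -> 0 <= e ->
  (N01 [set z | (`|s * z| < e)%R] <= (e / s)%:E)%E.
Proof.
move=> s0 e0.
have -> : [set z | `|s * z| < e] = `](- (e / s)), (e / s)[%classic.
  apply/seteqP; split => z /=; rewrite in_itv/= ltr_norml -mulNr ltr_pdivrMr// ltr_pdivlMr//;
  by rewrite (mulrC s z).
have pk : normal_peak 1 <= 2^-1 :> R.
  have p4 : 4 <= pi *+ 2 :> R by have := pi_ge2 R; rewrite -mulr_natr; lra.
  rewrite /normal_peak expr1n mul1r lef_pV2 ?posrE//; last first.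
    by rewrite sqrtr_gt0; lra.
  rewrite -(@ler_pXn2r _ 2) ?nnegrE ?sqrtr_ge0// sqr_sqrtr; lra.
set J := `](- (e / s)), (e / s)[%classic.
have mJ : measurable J by exact: measurable_itv.
apply: (@le_trans _ _ (\int[mu]_(x in J) (2^-1)%:E))%E.
  apply: ge0_le_integral => //.
  - by move=> x _; rewrite lee_fin normal_pdf_ge0.
  - by apply/measurable_funTS/measurable_EFinP; exact: measurable_normal_pdf.
  - by move=> x _; rewrite lee_fin (le_trans _ pk)// normal_pdf_ub ?oner_eq0.
rewrite integral_cst//= /J lebesgue_measure_itv/= lte_fin; case: ifPn => [_|_].
  by rewrite -EFinD -EFinM lee_fin; lra.
by rewrite mule0 lee_fin divr_ge0// ltW.
Qed.

(* Ramps increasing to the indicator of an open lower ray. *)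
Definition ramp (a : R) (k : nat) (x : R) : R := Num.max 0 (Num.min 1 (k%:R * (a - x))).

Lemma continuous_ramp a k : continuous (ramp a k).
Proof.
have -> : ramp a k = (cst 0 : R -> R^o) \max ((cst 1 : R -> R^o) \min (fun x => k%:R * (a - x))) by [].
move=> x; apply: continuous_max; first exact: cvg_cst.
apply: continuous_min; first exact: cvg_cst.
apply: cvgM; first exact: cvg_cst.
by apply: cvgB; [exact: cvg_cst|exact: cvg_id].
Qed.

Lemma ramp_ge0 a k x : 0 <= ramp a k x.
Proof. by rewrite /ramp le_max lexx. Qed.

Lemma ramp_le1 a k x : ramp a k x <= 1.
Proof. by rewrite /ramp ge_max ler01/= ge_min lexx. Qed.

Lemma cvg_ramp a x : ramp a k x @[k --> \oo] --> (\1_(`]-oo, a[%classic) x : R).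
Proof.
rewrite indicE; have [xa|xa] := ltP x a.
  rewrite mem_set /=; last by rewrite in_itv.
  apply: cvg_near_cst; near=> k; rewrite /ramp.
  have H : 1 <= k%:R * (a - x).
    rewrite -ler_pdivrMr ?subr_gt0// mul1r; near: k; exact: nbhs_infty_ger.
  by rewrite min_l// max_r.
rewrite memNset /=; last by rewrite in_itv/=; apply/negP; rewrite -leNgt.
apply: cvg_near_cst; apply: nearW => k; rewrite /ramp max_l//.
by rewrite ge_min; apply/orP; right; rewrite mulr_ge0_le0// subr_le0.
Unshelve. all: by end_near.
Qed.

(** Ramps converge boundedly to the indicators of open lower rays, a family stable under
    intersection that generates the Borel sets. *)
Lemma finite_measure_ramp_unique (m1 m2 : {measure set (measurableTypeR R) -> \bar R}) :
  (m1 setT < +oo)%E -> (m2 setT < +oo)%E ->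
  (forall a k, (\int[m1]_x (ramp a k x)%:E = \int[m2]_x (ramp a k x)%:E)%E) ->
  forall A : set R, measurable A -> m1 A = m2 A.
Proof.
move=> m1y m2y H A mA.
have mr a k : measurable_fun setT (ramp a k).
  by apply: continuous_measurable_fun; exact: continuous_ramp.
have L (m : {measure set (measurableTypeR R) -> \bar R}) a : (m setT < +oo)%E ->
    (\int[m]_x (ramp a k x)%:E)%E @[k --> \oo] --> m `]-oo, a[%classic.
  move=> my; have := @dominated_convergence _ _ _ m setT measurableT
    (fun k x => (ramp a k x)%:E) (fun x => (\1_(`]-oo, a[%classic) x)%:E) (cst 1%E).
  rewrite integral_indic// setIT => -[] //.
  - by move=> k; apply/measurable_EFinP; exact: mr.
  - exact/measurable_EFinP.
  - by apply: aeW => x _; apply: cvg_EFin; [exact: nearW|exact: cvg_ramp].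
  - apply/integrableP; split; first exact: measurable_cst.
    by under eq_integral do rewrite /= normr1; rewrite integral_cst// mul1e.
  - by apply: aeW => x k _ /=; rewrite lee_fin ger0_norm ?ramp_ge0 ?ramp_le1.
have E a : m1 `]-oo, a[%classic = m2 `]-oo, a[%classic.
  have := L m1 a m1y; under eq_fun do rewrite H.
  by move/(cvg_unique (@ereal_hausdorff R)) => /(_ _ (L m2 a m2y)).
apply: (measure_unique (T := measurableTypeR R) (@RGenInftyO.G R) (fun n => `]-oo, n%:R[%classic)) => //.
- exact: RGenInftyO.measurableE.
- move=> _ _ [a ->] [b ->]; exists (Num.min a b).
  by apply/seteqP; split => x /=; rewrite !in_itv/= lt_min => /andP.
- by move=> n; exists n%:R.
- apply/seteqP; split => // x _; have [n _ xn] := nbhs_infty_gtr x.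
  by exists n => //=; rewrite in_itv/=; apply: xn => /=.
- by move=> _ [a ->]; exact: E.
- move=> n; apply: le_lt_trans m1y; apply: le_measure; rewrite ?inE//.
Qed.

End normal_moment.

(** * L^2 limits of Gaussian variables *)

Section gaussian_limit.
Context d (T : measurableType d) (R : realType) (P : probability T R).
Notation N01 := (normal_prob (0 : R) 1).

Lemma push_prob_lty d' (T' : measurableType d') (mu : probability T' R)
    (f : T' -> measurableTypeR R) (mf : measurable_fun setT f) :
  (push_measure mu mf setT < +oo)%E.
Proof.
rewrite /push_measure /= /pushforward preimage_setT.
exact: le_lt_trans (probability_le1 mu measurableT) (ltry 1).
Qed.

Lemma has_law_gaussian_ramp (X : T -> R) (v : R) a k : measurable_fun setT X ->
  0 <= v -> has_law P X (gaussian_law 0 v) ->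
  (\int[P]_w (ramp a k (X w))%:E = \int[N01]_z (ramp a k (Num.sqrt v * z))%:E)%E.
Proof.
move=> mX v0 HX.
have mr : measurable_fun setT (fun x : measurableTypeR R => (ramp a k x)%:E).
  by apply/measurable_EFinP; apply: continuous_measurable_fun; exact: continuous_ramp.
have mX' : measurable_fun setT (X : T -> measurableTypeR R) by [].
have mA := @measurable_affine R 0 (Num.sqrt v).
transitivity (\int[push_measure P mX']_x (ramp a k x)%:E)%E.
  by rewrite ge0_integral_pushforward// => x _; rewrite lee_fin ramp_ge0.
transitivity (\int[push_measure N01 mA]_x (ramp a k x)%:E)%E; last first.
  rewrite ge0_integral_pushforward//; last by move=> x _; rewrite lee_fin ramp_ge0.
  by rewrite preimage_setT; apply: eq_integral => x _ /=; rewrite /affine add0r.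
apply: eq_measure_integral => A mA' _.
by have := HX A mA'; rewrite gaussian_lawE.
Qed.

(** Along an almost everywhere convergent subsequence the expectations of every ramp converge on
    both sides; scaling [N01] by the square root of the variance makes the normal side continuous in
    v, at 0 as well. *)
Lemma has_law_L2_limit (X : nat -> T -> R) (Y : T -> R) (v : nat -> R) (w : R) :
  (forall n, L2 P (X n)) -> L2 P Y ->
  nsq P (fun x => X n x - Y x) @[n --> \oo] --> (0 : R) ->
  (forall n, 0 <= v n) -> v n @[n --> \oo] --> w ->
  (forall n, has_law P (X n) (gaussian_law 0 (v n))) ->
  has_law P Y (gaussian_law 0 w).
Proof.
move=> X2 Y2 cXY v0 vw HX.
have w0 : 0 <= w by rewrite -(cvg_lim _ vw)//; apply: limr_ge; [apply/cvg_ex; exists w|exact: nearW].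
have mY := L2_measurable Y2.
have [K [nK cK]] : exists K : nat -> nat, (forall n, (n <= K n)%N) /\
    {ae P, forall x, (X (K n) x - Y x) ^+ 2 @[n --> \oo] --> (0 : R)}.
  apply: (@ae_cvg0_subseq _ _ _ P (fun n x => (X n x - Y x) ^+ 2)).
  - move=> n; apply: measurable_funX; apply: measurable_funB => //.
    exact: L2_measurable (X2 n).
  - by move=> n x; exact: sqr_ge0.
  - under eq_fun do (rewrite integral_sqr; last exact: L2B).
    by apply: cvg_EFin; first exact: nearW.
have KY : {ae P, forall x, X (K n) x @[n --> \oo] --> Y x}.
  apply: filterS cK => x H.
  have : X (K n) x - Y x @[n --> \oo] --> (0 : R).
    apply/norm_cvg0P.
    have -> : (fun n => `|X (K n) x - Y x|) = (fun n => Num.sqrt ((X (K n) x - Y x) ^+ 2)).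
      by apply/funext => n; rewrite sqrtr_sqr.
    by rewrite -(sqrtr0 R); apply: (@cvg_comp _ _ _ _ Num.sqrt _ _ _ H); exact: sqrt_continuous.
  move=> H2; have -> : (fun n => X (K n) x) = (fun n => (X (K n) x - Y x) + Y x).
    by apply/funext => n; rewrite subrK.
  by rewrite -[Y x as Z in _ --> Z]add0r; apply: cvgD => //; exact: cvg_cst.
have vK : v (K n) @[n --> \oo] --> w.
  apply: (@cvg_comp _ _ _ K v _ \oo) => //.
  move=> A [N _ HN]; exists N => // n /= Nn; apply: HN => /=.
  exact: leq_trans Nn (nK n).
have mr a k : measurable_fun setT (fun x : measurableTypeR R => (ramp a k x)%:E).
  by apply/measurable_EFinP; apply: continuous_measurable_fun; exact: continuous_ramp.
have mY' : measurable_fun setT (Y : T -> measurableTypeR R) by [].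
have mA := @measurable_affine R 0 (Num.sqrt w).
move=> A mAA; rewrite gaussian_lawE//.
have -> : (fun z => 0 + Num.sqrt w * z) @^-1` A = affine 0 (Num.sqrt w) @^-1` A by [].
apply: (@finite_measure_ramp_unique _ (push_measure P mY') (push_measure N01 mA)) => //.
- exact: push_prob_lty.
- exact: push_prob_lty.
move=> a k.
rewrite ge0_integral_pushforward//; last by move=> x _; rewrite lee_fin ramp_ge0.
rewrite ge0_integral_pushforward//; last by move=> x _; rewrite lee_fin ramp_ge0.
rewrite !preimage_setT.
have c1 : (\int[P]_x (ramp a k (X (K n) x))%:E)%E @[n --> \oo] --> (\int[P]_x (ramp a k (Y x))%:E)%E.
  have [] := @dominated_convergence _ _ _ P setT measurableT
    (fun n x => (ramp a k (X (K n) x))%:E) (fun x => (ramp a k (Y x))%:E) (cst 1%E) => //.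
  - by move=> n; apply: measurableT_comp (mr a k) _; exact: L2_measurable (X2 _).
  - by apply: measurableT_comp (mr a k) _.
  - apply: filterS KY => x H _; apply: cvg_EFin; first exact: nearW.
    by apply: (@cvg_comp _ _ _ _ (ramp a k) _ _ _ H); exact: continuous_ramp.
  - exact: finite_measure_integrable_cst.
  - by apply: aeW => x n _ /=; rewrite lee_fin ger0_norm ?ramp_ge0 ?ramp_le1.
have c2 : (\int[N01]_x (ramp a k (Num.sqrt (v (K n)) * x))%:E)%E @[n --> \oo] -->
    (\int[N01]_x (ramp a k (Num.sqrt w * x))%:E)%E.
  have [] := @dominated_convergence _ _ _ N01 setT measurableT
    (fun n x => (ramp a k (Num.sqrt (v (K n)) * x))%:E) (fun x => (ramp a k (Num.sqrt w * x))%:E) (cst 1%E) => //.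
  - by move=> n; apply: measurableT_comp (mr a k) _; exact: measurable_funM.
  - by apply: measurableT_comp (mr a k) _; exact: measurable_funM.
  - apply: aeW => x _; apply: cvg_EFin; first exact: nearW.
    apply: (@cvg_comp _ _ _ _ (ramp a k)); last exact: continuous_ramp.
    apply: cvgM; last exact: cvg_cst.
    by apply: (@cvg_comp _ _ _ _ Num.sqrt _ _ _ vK); exact: sqrt_continuous.
  - exact: finite_measure_integrable_cst.
  - by apply: aeW => x n _ /=; rewrite lee_fin ger0_norm ?ramp_ge0 ?ramp_le1.
move: c1; under eq_fun => n.
  rewrite (has_law_gaussian_ramp a k (L2_measurable (X2 (K n))) (v0 (K n)) (HX (K n))).
  over.
move/(cvg_unique (@ereal_hausdorff R)) => /(_ _ c2) -> /=.
by apply: eq_integral => x _; rewrite /affine add0r.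
Qed.

Lemma has_law_gaussian_L2 (X : T -> R) (v : R) : measurable_fun setT X -> 0 <= v ->
  has_law P X (gaussian_law 0 v) -> L2 P X /\ nsq P X = v.
Proof.
move=> mX v0 HX.
have mX' : measurable_fun setT (X : T -> measurableTypeR R) by [].
have mA := @measurable_affine R 0 (Num.sqrt v).
have ms : measurable_fun setT (fun x : measurableTypeR R => (x ^+ 2)%:E).
  by apply/measurable_EFinP; exact: measurable_funX.
have E : (\int[P]_x (X x ^+ 2)%:E = v%:E)%E.
  transitivity (\int[push_measure P mX']_x (x ^+ 2)%:E)%E.
    by rewrite ge0_integral_pushforward// => x _; rewrite lee_fin sqr_ge0.
  transitivity (\int[push_measure N01 mA]_x (x ^+ 2)%:E)%E.
    by apply: eq_measure_integral => A mA' _; have := HX A mA'; rewrite gaussian_lawE.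
  rewrite ge0_integral_pushforward//; last by move=> x _; rewrite lee_fin sqr_ge0.
  rewrite preimage_setT -[RHS]mule1 -(@normal_moment2 R) -ge0_integralZl_EFin//.
  - by apply: eq_integral => x _ /=; rewrite /affine add0r exprMn sqr_sqrtr// EFinM.
  - by move=> x _; rewrite lee_fin sqr_ge0.
have X2 : L2 P X by apply: L2_lty => //; rewrite E ltry.
by split=> //; apply: EFin_inj; rewrite -integral_sqr.
Qed.

End gaussian_limit.

(** * Sums of independent Gaussian variables *)

Section gaussian_sum.
Context (R : realType).
Notation mu := (@lebesgue_measure R).
Notation N01 := (normal_prob (0 : R) 1).

Lemma normal_prob_opp (A : set R) : measurable A -> N01 (-%R @^-1` A) = N01 A.
Proof.
move=> mA.
have mB : measurable (-%R @^-1` A : set R).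
  by rewrite -[X in measurable X]setTI; exact: oppr_measurable.
rewrite /normal_prob integral_mkcond [RHS]integral_mkcond.
have mN : measurable_fun setT (-%R : measurableTypeR R -> measurableTypeR R).
  exact: oppr_measurable.
transitivity (\int[push_measure mu mN]_x ((fun x => (normal_pdf 0 1 x)%:E) \_ A) x)%E; last first.
  by apply: eq_measure_integral => B mB' _; exact: lebesgue_measureN.
have mg : measurable_fun setT ((fun x => (normal_pdf 0 1 x)%:E) \_ A).
  apply/(measurable_restrictT _ _).1 => //; apply/measurable_funTS/measurable_EFinP.
  exact: measurable_normal_pdf.
rewrite (ge0_integral_pushforward mN _ measurableT mg).
- rewrite preimage_setT; apply: eq_integral => x _ /=; rewrite /patch.
  have -> : (x \in -%R @^-1` A) = (- x \in A) by apply/idP/idP; rewrite !inE.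
  by case: ifPn => // _; rewrite -!/(phi01 _) !phi01E sqrrN.
- by move=> x _; apply: erestrict_ge0 => y _; rewrite lee_fin normal_pdf_ge0.
Qed.

(** The square root of c^2 v only sees |c|; for negative c the symmetry of [N01] supplies the
    sign. *)
Lemma gaussian_lawZ (c v : R) (A : set R) : 0 <= v -> measurable A ->
  gaussian_law 0 v ((fun x => c * x) @^-1` A) = gaussian_law 0 (c ^+ 2 * v) A.
Proof.
move=> v0 mA.
have mB k : measurable ((fun x : R => k * x) @^-1` A).
  have /(_ measurableT) : measurable_fun setT (fun x : R => k * x) by exact: measurable_funM.
  by move/(_ _ mA); rewrite setTI.
have cv0 : 0 <= c ^+ 2 * v by apply: mulr_ge0 => //; exact: sqr_ge0.
rewrite !gaussian_lawE//.
rewrite sqrtrM ?sqr_ge0// sqrtr_sqr.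
have [c0|c0] := leP 0 c.
  by rewrite (ger0_norm c0); congr normal_prob; apply/seteqP; split => x /=; rewrite !add0r mulrA.
rewrite (ltr0_norm c0) -normal_prob_opp; last first.
  have := mB (c * Num.sqrt v); congr (measurable _).
  by apply/seteqP; split => x /=; rewrite !add0r mulrA.
have E x : c * (0 + Num.sqrt v * - x) = 0 + - c * Num.sqrt v * x by ring.
by congr normal_prob; apply/seteqP; split => x /=; rewrite E.
Qed.

Lemma normal_prob_add0 (a b : R) (A : set R) : 0 <= a -> 0 <= b -> measurable A ->
  (\int[N01]_x N01 [set y | A (Num.sqrt a * x + Num.sqrt b * y)%R] =
   N01 [set z | A (Num.sqrt (a + b) * z)%R])%E.
Proof.
rewrite !le_eqVlt => /predU1P[<-|a0].
  move=> _ mA; rewrite sqrtr0 add0r.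
  under eq_integral do under eq_set do rewrite mul0r add0r.
  rewrite integral_cst//= -[RHS]mule1; congr (_ * _)%E; exact: (probability_setT N01).
move=> /predU1P[<-|b0] mA; last exact: normal_prob_add.
rewrite sqrtr0 addr0.
under eq_integral do under eq_set do rewrite mul0r addr0.
have mB : measurable [set x : measurableTypeR R | A (Num.sqrt a * x)].
  have /(_ measurableT) : measurable_fun setT (fun x : R => Num.sqrt a * x) by exact: measurable_funM.
  by move/(_ _ mA); rewrite setTI.
transitivity (\int[N01]_x (\1_[set x | A (Num.sqrt a * x)] x)%:E)%E; last first.
  by rewrite integral_indic// setIT.
apply: eq_integral => x _; rewrite indicE.
have [Ax|Ax] := boolP (x \in [set x | A (Num.sqrt a * x)]).
  rewrite inE /= in Ax; rewrite (_ : [set _ | _] = setT); first exact: (probability_setT N01).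
  by apply/seteqP; split.
rewrite (_ : [set _ | _] = set0) ?measure0//.
by apply/seteqP; split => // y /= H; move: Ax; rewrite notin_setE; exact.
Qed.

Definition gaussian_map (v : R) : measurableTypeR R -> measurableTypeR R := affine 0 (Num.sqrt v).

Lemma measurable_gaussian_map v : measurable_fun setT (gaussian_map v).
Proof. exact: measurable_affine. Qed.

HB.instance Definition _ v :=
  isMeasurableFun.Build _ _ _ _ (gaussian_map v) (measurable_gaussian_map v).

(** Bundled as a probability so that the product [gaussian a \x gaussian b] can be formed. *)
Definition gaussian (v : R) : probability (measurableTypeR R) R :=
  distribution N01 (gaussian_map v : {mfun _ >-> _}).

Lemma gaussianE v (A : set R) : 0 <= v -> measurable A -> gaussian v A = gaussian_law 0 v A.
Proof. by move=> v0 mA; rewrite gaussian_lawE. Qed.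

Lemma gaussian_convolution (a b : R) (A : set R) : 0 <= a -> 0 <= b -> measurable A ->
  ((gaussian a \x gaussian b) [set z | A (z.1 + z.2)%R] = gaussian_law 0 (a + b) A)%E.
Proof.
move=> a0 b0 mA.
have mN v : measurable_fun setT (gaussian_map v) by exact: measurable_gaussian_map.
have mD : measurable [set z : measurableTypeR R * measurableTypeR R | A (z.1 + z.2)].
  have /(_ measurableT) : measurable_fun setT (fun z : measurableTypeR R * measurableTypeR R => z.1 + z.2).
    exact: measurable_funD.
  by move/(_ _ mA); rewrite setTI.
rewrite /product_measure1 /=.
rewrite gaussian_lawE ?addr_ge0//.
transitivity (N01 [set z | A (Num.sqrt (a + b) * z)]); last first.
  by congr normal_prob; apply/seteqP; split => z /=; rewrite add0r.
rewrite -normal_prob_add0//.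
have mG : measurable_fun setT (gaussian b \o xsection [set z | A (z.1 + z.2)]).
  exact: measurable_fun_xsection.
rewrite (ge0_integral_pushforward (mN a) _ measurableT mG); last by move=> x _; exact: measure_ge0.
apply: eq_integral => x _ /=.
rewrite /gaussian /= /distribution /pushforward; congr normal_prob.
by apply/seteqP; split => y; rewrite /= /xsection /gaussian_map /affine /= inE /= !add0r.
Qed.

Context d (T : measurableType d).

(** The measure [m] has mass c and need not be a probability: in the application it is P restricted
    to an event on later increments. For c > 0 the measure m / c gives (X, Y) the product of the two
    Gaussian laws, and the convolution formula applies. *)
Lemma independent_gaussian_sum (m : {measure set T -> \bar R}) (X Y : T -> R) (c a b : R) :
  measurable_fun setT X -> measurable_fun setT Y -> 0 <= c -> 0 <= a -> 0 <= b ->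
  (forall A B, measurable A -> measurable B ->
    (m (X @^-1` A `&` Y @^-1` B) = c%:E * gaussian_law 0 a A * gaussian_law 0 b B)%E) ->
  forall A, measurable A -> (m ((X \+ Y)%R @^-1` A) = c%:E * gaussian_law 0 (a + b) A)%E.
Proof.
move=> mX mY; rewrite le_eqVlt => /predU1P[<-|c0] a0 b0 H A mA.
  rewrite mul0e; apply/eqP; rewrite eq_le measure_ge0 andbT.
  have := H setT setT measurableT measurableT; rewrite !mul0e !preimage_setT setIT => <-.
  apply: le_measure; rewrite ?inE//.
  by rewrite -[X in measurable X]setTI; exact: measurable_funD.
have mXY : measurable_fun setT (fun t => (X t, Y t) : measurableTypeR R * measurableTypeR R).
  exact: measurable_fun_pair.
have ci : 0 <= c^-1 by rewrite invr_ge0 ltW.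
pose m' := mscale (NngNum ci) (push_measure m mXY).
have E := @product_measure_unique _ _ _ _ R (gaussian a) (gaussian b) m'.
have mD : measurable [set z : measurableTypeR R * measurableTypeR R | A (z.1 + z.2)].
  have /(_ measurableT) : measurable_fun setT (fun z : measurableTypeR R * measurableTypeR R => z.1 + z.2).
    exact: measurable_funD.
  by move/(_ _ mA); rewrite setTI.
have {}E : forall D, measurable D -> ((gaussian a \x gaussian b)%E D = m' D).
  apply: E => B C mB mC.
  transitivity (gaussian_law 0 a B * gaussian_law 0 b C)%E; last first.
    by congr (_ * _)%E; apply/esym/gaussianE.
  transitivity (c^-1%:E * m (X @^-1` B `&` Y @^-1` C))%E; first by [].
  by rewrite H// !muleA -EFinM mulVf ?gt_eqF// mul1e.
rewrite -gaussian_convolution// E//.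
transitivity (c%:E * (c^-1%:E * m ((X \+ Y)%R @^-1` A)))%E; last by [].
rewrite muleA -EFinM mulfV ?gt_eqF// mul1e//.
Qed.

End gaussian_sum.

(** * The Wiener integral *)

Section step_functions.
Context (R : realType).
Notation mu := (@lebesgue_measure R).

Definition scale_step (c : R) (s : seq (R * R * R)) := [seq ((c * p.1.1, p.1.2), p.2) | p <- s].

Lemma wf_scale_step c s : wf_step (scale_step c s) = wf_step s.
Proof. by rewrite /wf_step /scale_step all_map. Qed.

Lemma wf_step_cat (s t : seq (R * R * R)) : wf_step (s ++ t) = wf_step s && wf_step t.
Proof. exact: all_cat. Qed.

Lemma step_fun_scale c s y : step_fun (scale_step c s) y = c * step_fun s y.
Proof.
rewrite /step_fun /scale_step big_map mulr_sumr; apply: eq_bigr => p _.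
by rewrite mulrA.
Qed.

Lemma step_fun_cat s t (y : R) : step_fun (s ++ t) y = step_fun s y + step_fun t y.
Proof. by rewrite /step_fun big_cat. Qed.

(* Both the step function and its integral are sums of increments [F b - F a], with
   [F x = \1_(y <= x)] resp. [F x = W x w]; hence the same subdivision serves both. *)
Lemma increments_subdivision (s : seq (R * R * R)) : exists n (e C : nat -> R),
  {homo e : i j / (i <= j)%N >-> i <= j} /\
  forall F : R -> R, \sum_(p <- s) p.1.1 * (F p.2 - F p.1.2) =
    \sum_(k < n) C k * (F (e k.+1) - F (e k)).
Proof.
pose pts := sort <=%R ([seq p.1.2 | p <- s] ++ [seq p.2 | p <- s]).
have sp : sorted <=%R pts by apply: sort_sorted; exact: le_total.
pose n := size pts.
(* The default is the last, hence largest, point, so [e] is constant past the end and monotone on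
   all indices. *)
pose e k := nth (last 0 pts) pts k.
have eh : {homo e : i j / (i <= j)%N >-> i <= j}.
  move=> i j ij; rewrite /e; have [jn|nj] := ltnP j n.
    by apply: sorted_leq_nth => //; [exact: le_trans|rewrite inE (leq_ltn_trans ij)].
  rewrite [leRHS]nth_default//; have [i_n|ni] := ltnP i n; last by rewrite nth_default.
  have n0 : (0 < n)%N by exact: leq_ltn_trans i_n.
  rewrite [leRHS](_ : _ = nth (last 0 pts) pts n.-1); last first.
    by rewrite -(nth_last 0); apply: set_nth_default; rewrite prednK.
  apply: sorted_leq_nth => //; rewrite ?inE ?prednK//; first exact: le_trans.
  by rewrite -ltnS prednK.
(* Cell k lies in the interval of p exactly when its index is at least that of the left end and
   below that of the right end; the difference of the two tests is its signed multiplicity. *)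
exists n, e, (fun k => \sum_(p <- s) p.1.1 * ((k < index p.2 pts)%:R - (k < index p.1.2 pts)%:R)).
split=> // F.
have T j : (j < n)%N -> F (e j) - F (e 0%N) = \sum_(k < n) (k < j)%:R * (F (e k.+1) - F (e k)).
  move=> jn; rewrite -(big_mkord xpredT (fun k => (k < j)%:R * (F (e k.+1) - F (e k)))).
  rewrite (big_cat_nat (n := j))//=; last exact: ltnW.
  rewrite [X in _ = _ + X]big1_seq ?addr0; last first.
    move=> k; rewrite mem_index_iota => /andP[_ /andP[jk _]].
    by rewrite ltnNge jk mul0r.
  rewrite -[LHS](telescope_sumr (fun k => F (e k)))//.
  rewrite !big_nat; apply: eq_bigr => k /andP[_ kj].
  by rewrite kj mul1r.
under [RHS]eq_bigr do rewrite mulr_suml.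
rewrite exchange_big /= big_seq [RHS]big_seq; apply: eq_bigr => p ps.
have bp : p.2 \in pts by rewrite mem_sort mem_cat map_f ?orbT.
have ap : p.1.2 \in pts by rewrite mem_sort mem_cat (map_f (fun p => p.1.2)).
have eE x : x \in pts -> e (index x pts) = x by move=> xp; rewrite /e nth_index.
have Eb := T (index p.2 pts); rewrite index_mem eE// in Eb.
have Ea := T (index p.1.2 pts); rewrite index_mem eE// in Ea.
transitivity (p.1.1 * ((F p.2 - F (e 0%N)) - (F p.1.2 - F (e 0%N)))); first by ring.
rewrite Eb// Ea// -sumrB mulr_sumr; apply: eq_bigr => k _; ring.
Qed.

Lemma indic_itv_increment (a b y : R) : a <= b ->
  \1_(`]a, b]%classic) y = (y <= b)%R%:R - (y <= a)%R%:R :> R.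
Proof.
move=> ab; rewrite indicE.
have -> : (y \in (`]a, b]%classic : set R)) = (a < y <= b).
  by apply/idP/idP; rewrite inE /= in_itv.
have [ya|ay] /= := leP y a; first by rewrite (le_trans ya ab) subrr.
by rewrite subr0.
Qed.

(** With F the indicator of y <= x, the hypothesis rewrites the step function over the cells of the
    subdivision; these are disjoint, so the indicators are orthogonal. *)
Lemma step_fun_subdivision (s : seq (R * R * R)) n (e C : nat -> R) :
  wf_step s -> {homo e : i j / (i <= j)%N >-> i <= j} ->
  (forall F : R -> R, \sum_(p <- s) p.1.1 * (F p.2 - F p.1.2) =
    \sum_(k < n) C k * (F (e k.+1) - F (e k))) ->
  L2 mu (step_fun s) /\ nsq mu (step_fun s) = \sum_(k < n) C k ^+ 2 * (e k.+1 - e k).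
Proof.
move=> ws eh HF.
pose I k : R -> R := \1_(`]e k, e k.+1]%classic).
have sE : step_fun s = (fun y => \sum_(k < n) C k * I k y).
  apply/funext => y; rewrite /step_fun.
  transitivity (\sum_(p <- s) p.1.1 * ((y <= p.2)%R%:R - (y <= p.1.2)%R%:R)).
    rewrite big_seq [RHS]big_seq; apply: eq_bigr => p ps.
    by rewrite indic_itv_increment//; exact: (allP ws).
  rewrite (HF (fun x => (y <= x)%R%:R)); apply: eq_bigr => k _.
  by rewrite /I indic_itv_increment// eh.
have mI k : measurable_fun setT (I k) by exact: measurable_indic.
have ipI k l : ip mu (I k) (I l) = if k == l then e k.+1 - e k else 0.
  rewrite /ip /Rintegral.
  have -> : (fun x => (I k x * I l x)%:E) =
      (fun x => (\1_(`]e k, e k.+1]%classic `&` `]e l, e l.+1]%classic) x)%:E).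
    by apply/funext => x; rewrite indicI.
  have mkl : measurable (`]e k, e k.+1]%classic `&` `]e l, e l.+1]%classic) by exact: measurableI.
  rewrite integral_indic// setIT.
  have [->|kl] := eqVneq k l.
    transitivity (fine (lebesgue_measure (`]e l, e l.+1]%classic : set R))).
      by rewrite setIid.
    rewrite lebesgue_measure_itv /= lte_fin; case: ifPn => //.
    rewrite -leNgt => H; have := eh _ _ (leqnSn l); move=> H2.
    by rewrite /=; apply/esym/eqP; rewrite subr_eq0 eq_le H H2.
  rewrite (_ : _ `&` _ = set0) ?measure0//.
  apply/seteqP; split => // y /=; rewrite !in_itv/=.
  clear mkl; wlog kl' : k l kl / (k < l)%N.
    move=> H [h1 h2]; move: (kl); rewrite neq_ltn => /orP[|] lt; first exact: (H k l).
    by apply: (H l k) => //; rewrite eq_sym.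
  by move=> [/andP[_ h1] /andP[h2 _]]; have := eh _ _ kl'; lra.
have LI k : L2 mu (I k).
  split; first exact: mI.
  have := @integrable_indic_itv R (e k) (e k.+1) false false.
  apply: eq_integrable => // y _ /=.
  by rewrite /I indicE; case: (_ \in _); rewrite ?expr1n ?expr0n.
have L : forall i : 'I_n, L2 mu (fun y => C i * I i y) by move=> i; exact: L2Z.
rewrite sE; split; first exact: L2_sum.
rewrite /nsq ip_suml//; last exact: L2_sum.
apply: eq_bigr => i _; rewrite ipC ip_suml//.
rewrite (bigD1 i)//= big1 ?addr0; last first.
  move=> j ji; rewrite ipZl// ipC ipZl// ipI.
  by case: eqP => [/val_inj ij|_]; [rewrite ij eqxx in ji|rewrite !mulr0].
by rewrite ipZl// ipC ipZl// ipI eqxx; ring.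
Qed.

Lemma L2_step_fun (s : seq (R * R * R)) : wf_step s -> L2 mu (step_fun s).
Proof.
move=> ws; have [n [e [C [eh HF]]]] := increments_subdivision s.
by have [] := step_fun_subdivision ws eh HF.
Qed.

Definition grid (a h : R) (i : nat) : R := a + i%:R * h.

Definition grid_step (f : R -> R) (a h : R) (m : nat) : seq (R * R * R) :=
  [seq ((f (grid a h i), grid a h i), grid a h i.+1) | i <- iota 0 m].

Lemma grid0 a h : grid a h 0 = a.
Proof. by rewrite /grid mul0r addr0. Qed.

Lemma gridS a h i : grid a h i.+1 = grid a h i + h.
Proof. by rewrite /grid -natr1; ring. Qed.

Lemma le_grid a h i j : 0 <= h -> (i <= j)%N -> grid a h i <= grid a h j.
Proof. by move=> h0 ij; rewrite lerD2l ler_wpM2r// ler_nat. Qed.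

Lemma wf_grid_step f a h m : 0 <= h -> wf_step (grid_step f a h m).
Proof.
by move=> h0; rewrite /wf_step /grid_step all_map; apply/allP => i _ /=; exact: le_grid.
Qed.

Lemma step_fun_gridE f a h m y : step_fun (grid_step f a h m) y =
  \sum_(i < m) f (grid a h i) * \1_(`]grid a h i, grid a h i.+1]%classic) y.
Proof.
rewrite /step_fun /grid_step big_map.
by rewrite -(big_mkord xpredT (fun i => f (grid a h i) * \1_(`]grid a h i, grid a h i.+1]%classic) y)) /index_iota subn0.
Qed.

Lemma step_fun_grid f a h m (y : R) : 0 <= h ->
  [/\ ~~ (a < y <= grid a h m) & step_fun (grid_step f a h m) y = 0] \/
  exists i, [/\ (i < m)%N, grid a h i < y <= grid a h i + h &
    step_fun (grid_step f a h m) y = f (grid a h i)].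
Proof.
move=> h0; have E := step_fun_gridE f a h m y.
(* The cell indicators telescope, so a point of the window lying in no cell would give 1 = 0. *)
have S1 : \sum_(i < m) \1_(`]grid a h i, grid a h i.+1]%classic) y = (y <= grid a h m)%R%:R - (y <= a)%R%:R :> R.
  under eq_bigr do (rewrite indic_itv_increment; last exact: le_grid).
  rewrite -(big_mkord xpredT (fun i => (y <= grid a h i.+1)%R%:R - (y <= grid a h i)%R%:R)).
  by rewrite (telescope_sumr (fun i => (y <= grid a h i)%R%:R))// grid0.
have ind i : \1_(`]grid a h i, grid a h i.+1]%classic) y = (grid a h i < y <= grid a h i.+1)%R%:R :> R.
  by rewrite indicE; congr ((_ : bool)%:R); apply/idP/idP; rewrite inE /= in_itv.
have [/existsP[i Hi]|] := boolP [exists i : 'I_m, grid a h i < y <= grid a h i.+1].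
  right; exists i; rewrite -gridS; split=> //.
  rewrite E (bigD1 i)//= ind Hi mulr1 big1 ?addr0// => j ji.
  rewrite ind; have [/andP[j1 j2]|_] := boolP (grid a h j < y <= grid a h j.+1); last by rewrite mulr0.
  move: Hi => /andP[i1 i2]; move: ji; rewrite -val_eqE /= neq_ltn => /orP[] lt.
    by have := le_grid a h0 lt; lra.
  by have := le_grid a h0 lt; lra.
rewrite negb_exists => /forallP H; left; split.
  apply/negP => /andP[y1 y2]; move: S1; rewrite y2 leNgt y1 subr0 big1.
    by move/eqP; rewrite eq_sym oner_eq0.
  by move=> i _; rewrite ind (negbTE (H i)).
by rewrite E big1// => i _; rewrite ind (negbTE (H i)) mulr0.
Qed.


(* The square window [-N, N] cut into cells of length 1/N, for [N = n.+1]. *)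
Definition window_step (f : R -> R) (n : nat) : seq (R * R * R) :=
  grid_step f (- n.+1%:R) n.+1%:R^-1 (n.+1 * n.+1).*2.

Lemma window_step_wf f n : wf_step (window_step f n).
Proof. by apply: wf_grid_step; rewrite invr_ge0. Qed.

Lemma window_stepP f n (y : R) :
  [/\ ~~ (- n.+1%:R < y <= n.+1%:R) & step_fun (window_step f n) y = 0] \/
  exists x, x < y <= x + n.+1%:R^-1 /\ step_fun (window_step f n) y = f x.
Proof.
have h0 : 0 <= n.+1%:R^-1 :> R by rewrite invr_ge0.
have [[]|[i [_ H1 H2]]] := step_fun_grid f (- n.+1%:R) (n.+1 * n.+1).*2 y h0; last first.
  by right; exists (grid (- n.+1%:R) n.+1%:R^-1 i).
rewrite (_ : grid _ _ _ = n.+1%:R); first by left.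
by rewrite /grid -addnn natrD natrM; field; rewrite ?pnatr_eq0.
Qed.

End step_functions.

(** * Law, isometry, linearity and existence of the Wiener integral *)

Section wiener_integral_theory.
Context d (T : measurableType d) (R : realType) (P : probability T R).
Variable W : R -> {RV P >-> R}.
Hypothesis HW : two_sided_brownian_motion W.
Notation mu := (@lebesgue_measure R).


(** Induction on k: the first k increments are merged into one Gaussian variable while the events on
    the later ones stay free parameters. Carrying these events is what yields the independence of
    the merged sum and of increment k at the next step. *)
Lemma increments_joint_law n (e C : nat -> R) :
  {homo e : i j / (i <= j)%N >-> i <= j} ->
  forall k, (k <= n)%N -> forall (A_ : nat -> set R) A,
  (forall i, measurable (A_ i)) -> measurable A ->
  P [set w | A (\sum_(i < k) C i * (W (e i.+1) w - W (e i) w)) /\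
             forall i, (k <= i)%N -> (i < n)%N -> A_ i (W (e i.+1) w - W (e i) w)] =
  (gaussian_law 0 (\sum_(i < k) C i ^+ 2 * (e i.+1 - e i)) A *
   (\prod_(k <= i < n) fine (P ((W (e i.+1) \- W (e i))%R @^-1` A_ i)))%:E)%E.
Proof.
move=> eh.
pose D i := (W (e i.+1) \- W (e i))%R.
have mD i : measurable_fun setT (D i) by exact: measurable_funB.
have mDA i B : measurable B -> measurable (D i @^-1` B).
  by move=> mB; rewrite -[X in measurable X]setTI; exact: mD.
have Pf (E : set T) : measurable E -> (fine (P E))%:E = P E.
  by move=> mE; rewrite fineK// fin_num_measure.
pose S k w := \sum_(i < k) C i * D i w.
have mS k : measurable_fun setT (S k).
  by apply: measurable_sum => i; exact: measurable_funM.
pose Q (A_ : nat -> set R) k := [set w | forall i, (k <= i)%N -> (i < n)%N -> A_ i (D i w)].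
have mQ A_ k : (forall i, measurable (A_ i)) -> measurable (Q A_ k).
  move=> mA_; rewrite (_ : Q A_ k = \bigcap_(i in [set i | (k <= i < n)%N]) (D i @^-1` A_ i)).
    by apply: bigcap_measurableType => i _; by apply: mDA; exact: mA_.
  apply/seteqP; split => w /= H i.
    by move=> /= /andP[ki i_n]; exact: H.
  by move=> ki i_n; apply: H => /=; rewrite ki.
elim=> [_ A_ A mA_ mA|k IH kn A_ A mA_ mA].
  rewrite big_ord0.
  have -> : gaussian_law 0 0 A = (\1_A (0 : R))%:E by rewrite /gaussian_law eqxx diracE indicE.
  have := @tbm_indep _ _ _ _ _ HW n e eh (fun i => A_ i) (fun i => mA_ i) => HI.
  rewrite indicE; have [A0|A0] := boolP ((0 : R) \in A); last first.
    rewrite mul0e (_ : [set _ | _] = set0) ?measure0//.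
    by apply/seteqP; split => // w /= [+ _]; rewrite big_ord0 => H; move: A0; rewrite notin_setE.
  rewrite mul1e; transitivity (P (\bigcap_(i in [set: 'I_n]) (D i @^-1` A_ i))).
    congr (P _); apply/seteqP; split => w /=.
      by move=> [_ H] i _; exact: H.
    by move=> H; split => [|i _ i_n]; [rewrite big_ord0; rewrite inE in A0|exact: (H (Ordinal i_n))].
  rewrite HI big_mkord -prodEFin; apply: eq_bigr => i _.
  by rewrite Pf//; apply: mDA; exact: mA_.
have kn' : (k <= n)%N by exact: ltnW.
pose v := \sum_(i < k) C i ^+ 2 * (e i.+1 - e i).
have v0 : 0 <= v.
  by apply: sumr_ge0 => i _; rewrite mulr_ge0 ?sqr_ge0// subr_ge0 eh.
pose c := \prod_(k.+1 <= i < n) fine (P (D i @^-1` A_ i)).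
have c0 : 0 <= c by apply: prodr_ge0 => i _; rewrite fine_ge0// measure_ge0.
(* The events on the increments after k are built into the measure; their probability becomes the
   mass c. *)
pose m : {measure set T -> \bar R} := mrestr P (mQ A_ k.+1 mA_).
have mC B : measurable B -> measurable ((fun x => C k * x) @^-1` B).
  have /(_ measurableT) H : measurable_fun setT (fun x : R => C k * x) by exact: measurable_funM.
  by move=> mB; have := H _ mB; rewrite setTI.
have := @independent_gaussian_sum R _ T m (S k) (fun w => C k * D k w) c v (C k ^+ 2 * (e k.+1 - e k)).
move=> /(_ (mS k) (measurable_funM (measurable_cst _) (mD k)) c0 v0).
have w0 : 0 <= C k ^+ 2 * (e k.+1 - e k).
  by rewrite mulr_ge0 ?sqr_ge0// subr_ge0 eh.
move=> /(_ w0) H.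
rewrite big_ord_recr/= -/v -/c muleC.
rewrite -H//.
  rewrite /m /mrestr /=; congr (P _).
  by apply/seteqP; split => w /=; rewrite big_ord_recr.
move=> A' B mA' mB.
(* The event on C k times increment k enters the induction hypothesis as the k-th free parameter. *)
pose A2 i := if i == k then (fun x => C k * x) @^-1` B else A_ i.
have mA2 i : measurable (A2 i) by rewrite /A2; case: ifPn => // _; exact: mC.
have := IH kn' A2 A' mA2 mA'.
have A2k : A2 k = (fun x => C k * x) @^-1` B by rewrite /A2 eqxx.
rewrite big_ltn// A2k -/v.
have -> : \prod_(k.+1 <= i < n) fine (P ((W (e i.+1) \- W (e i))%R @^-1` A2 i)) = c.
  rewrite /c !big_nat; apply: eq_bigr => i /andP[ki _].
  by rewrite /A2 (gtn_eqF ki).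
rewrite EFinM Pf; last by apply: mDA; exact: mC.
rewrite (tbm_gauss HW (eh _ _ (leqnSn k)) (mC _ mB)) gaussian_lawZ//; last by rewrite subr_ge0 eh.
move=> E; rewrite -[RHS]muleA [RHS]muleC -[RHS]muleA -E /m /mrestr /=; congr (P _).
apply/seteqP; split => w /=.
  move=> [[HA HB] HQ]; split=> // i ki i_n; rewrite /A2; case: eqP => [->//|/eqP ik].
  by apply: HQ => //; rewrite ltn_neqAle eq_sym ik.
move=> [HA HQ]; split; [split=> //|].
  by have := HQ k (leqnn k) kn; rewrite /A2 eqxx.
move=> i ki i_n; have := HQ i (ltnW ki) i_n; by rewrite /A2 (gtn_eqF ki).
Qed.

Lemma step_integral_law s : wf_step s ->
  [/\ L2 P (step_integral W s), nsq P (step_integral W s) = nsq mu (step_fun s) &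
      has_law P (step_integral W s) (gaussian_law 0 (nsq mu (step_fun s)))].
Proof.
move=> ws; have [n [e [C [eh HF]]]] := increments_subdivision s.
have [_ E] := step_fun_subdivision ws eh HF.
have v0 : 0 <= nsq mu (step_fun s) by exact: nsq_ge0.
have SE : step_integral W s = (fun w => \sum_(i < n) C i * (W (e i.+1) w - W (e i) w)).
  by apply/funext => w; rewrite /step_integral (HF (fun x => W x w)).
have mS : measurable_fun setT (step_integral W s).
  rewrite SE; apply: measurable_sum => i; apply: measurable_funM => //.
  exact: measurable_funB.
have HL : has_law P (step_integral W s) (gaussian_law 0 (nsq mu (step_fun s))).
  move=> A mA; have := increments_joint_law C eh (leqnn n) (fun=> measurableT) mA.
  rewrite big_geq// mule1 -E => <-; congr (P _); rewrite SE.
  by apply/seteqP; split => w /= => [H|[]//]; split=> // i ni /(leq_ltn_trans ni); rewrite ltnn.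
by have [? ?] := has_law_gaussian_L2 mS v0 HL.
Qed.

Lemma step_integral_cat s t w : step_integral W (s ++ t) w = step_integral W s w + step_integral W t w.
Proof. by rewrite /step_integral big_cat. Qed.

Lemma step_integral_scale c s w : step_integral W (scale_step c s) w = c * step_integral W s w.
Proof.
rewrite /step_integral /scale_step big_map mulr_sumr; apply: eq_bigr => p _.
by rewrite mulrA.
Qed.

Lemma wiener_integralP h X : wiener_integral W h X <->
  [/\ L2 mu h, L2 P X & exists s : nat -> seq (R * R * R),
    [/\ forall n, wf_step (s n),
        nsq mu (fun y => step_fun (s n) y - h y) @[n --> \oo] --> (0 : R) &
        nsq P (fun w => step_integral W (s n) w - X w) @[n --> \oo] --> (0 : R)]].
Proof.
split => [[/L2P h2 /L2P X2 [s [ws c1 c2]]]|[h2 X2 [s [ws c1 c2]]]].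
  split=> //; exists s; split=> //.
    apply/(@cvg_Lnorm _ _ _ mu (fun n y => step_fun (s n) y - h y)) => //.
    by move=> n; apply: L2B => //; exact: L2_step_fun.
  apply/(@cvg_Lnorm _ _ _ P (fun n y => step_integral W (s n) y - X y)) => //.
  by move=> n; apply: L2B => //; have [] := step_integral_law (ws n).
split; [exact/L2P|exact/L2P|exists s; split=> //].
  apply/(@cvg_Lnorm _ _ _ mu (fun n y => step_fun (s n) y - h y)) => //.
  by move=> n; apply: L2B => //; exact: L2_step_fun.
apply/(@cvg_Lnorm _ _ _ P (fun n y => step_integral W (s n) y - X y)) => //.
by move=> n; apply: L2B => //; have [] := step_integral_law (ws n).
Qed.

(** The Gaussian law passes to the limit from the step integrals; the isometry is then read off as
    the variance of that law. *)
Lemma wiener_integral_law h X : wiener_integral W h X ->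
  [/\ L2 mu h, L2 P X, nsq P X = nsq mu h & has_law P X (gaussian_law 0 (nsq mu h))].
Proof.
move=> /wiener_integralP[h2 X2 [s [ws c1 c2]]].
have S2 n := L2_step_fun (ws n).
have I2 n : L2 P (step_integral W (s n)) by have [] := step_integral_law (ws n).
have HL : has_law P X (gaussian_law 0 (nsq mu h)).
  apply: (@has_law_L2_limit _ _ _ P (fun n => step_integral W (s n)) X (fun n => nsq mu (step_fun (s n)))) => //.
  - by move=> n; exact: nsq_ge0.
  - exact: nsq_cvg.
  - by move=> n; have [] := step_integral_law (ws n).
split=> //.
by have [] := has_law_gaussian_L2 (L2_measurable X2) (nsq_ge0 mu h) HL.
Qed.

Lemma wiener_integral_lin c h g X Y : wiener_integral W h X -> wiener_integral W g Y ->
  wiener_integral W (fun y => c * h y + g y) (fun w => c * X w + Y w).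
Proof.
move=> /wiener_integralP[h2 X2 [s [ws s1 s2]]] /wiener_integralP[g2 Y2 [t [wt t1 t2]]].
apply/wiener_integralP; split; [by apply: L2D => //; exact: L2Z..|].
exists (fun n => scale_step c (s n) ++ t n); split.
- by move=> n; rewrite wf_step_cat wf_scale_step ws wt.
- apply: (@squeeze_cvgr _ _ _ _ (fun=> 0) (fun n =>
    2 * (c ^+ 2 * nsq mu (fun y => step_fun (s n) y - h y)) + 2 * nsq mu (fun y => step_fun (t n) y - g y))).
  + apply: nearW => n; rewrite nsq_ge0 /=.
    rewrite -nsqZ; last by apply: L2B => //; exact: L2_step_fun.
    apply: le_trans (nsqD_le _ _); last 2 first.
    * by apply: L2Z; apply: L2B => //; exact: L2_step_fun.
    * by apply: L2B => //; exact: L2_step_fun.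
    rewrite le_eqVlt; apply/orP; left; apply/eqP; congr nsq; apply/funext => y.
    rewrite step_fun_cat step_fun_scale; ring.
  + exact: cvg_cst.
  + rewrite -[0 as Z in _ --> Z](addr0 0); apply: cvgD.
      rewrite -[0 as Z in _ --> Z](mulr0 2); apply: cvgM; first exact: cvg_cst.
      by rewrite -[0 as Z in _ --> Z](mulr0 (c ^+ 2)); apply: cvgM => //; exact: cvg_cst.
    by rewrite -[0 as Z in _ --> Z](mulr0 2); apply: cvgM => //; exact: cvg_cst.
- have I2 n : L2 P (step_integral W (s n)) by have [] := step_integral_law (ws n).
  have J2 n : L2 P (step_integral W (t n)) by have [] := step_integral_law (wt n).
  apply: (@squeeze_cvgr _ _ _ _ (fun=> 0) (fun n =>
    2 * (c ^+ 2 * nsq P (fun y => step_integral W (s n) y - X y)) + 2 * nsq P (fun y => step_integral W (t n) y - Y y))).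
  + apply: nearW => n; rewrite nsq_ge0 /=.
    rewrite -nsqZ; last exact: L2B.
    apply: le_trans (nsqD_le _ _); last 2 first.
    * by apply: L2Z; exact: L2B.
    * exact: L2B.
    rewrite le_eqVlt; apply/orP; left; apply/eqP; congr nsq; apply/funext => y.
    rewrite step_integral_cat step_integral_scale; ring.
  + exact: cvg_cst.
  + rewrite -[0 as Z in _ --> Z](addr0 0); apply: cvgD.
      rewrite -[0 as Z in _ --> Z](mulr0 2); apply: cvgM; first exact: cvg_cst.
      by rewrite -[0 as Z in _ --> Z](mulr0 (c ^+ 2)); apply: cvgM => //; exact: cvg_cst.
    by rewrite -[0 as Z in _ --> Z](mulr0 2); apply: cvgM => //; exact: cvg_cst.
Qed.

Lemma wiener_integral_step s : wf_step s -> wiener_integral W (step_fun s) (step_integral W s).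
Proof.
move=> ws; have [I2 _ _] := step_integral_law ws; have s2 := L2_step_fun ws.
apply/wiener_integralP; split=> //; exists (fun=> s); split=> //.
  by rewrite (_ : (fun y => _ - _) = fun=> 0); [rewrite /nsq ip0l; exact: cvg_cst|apply/funext => y; rewrite subrr].
by rewrite (_ : (fun y => _ - _) = fun=> 0); [rewrite /nsq ip0l; exact: cvg_cst|apply/funext => y; rewrite subrr].
Qed.

Lemma wiener_integral0 : wiener_integral W (fun=> 0) (fun=> 0).
Proof.
have := @wiener_integral_step [::] isT; congr wiener_integral.
  by apply/funext => y; rewrite /step_fun big_nil.
by apply/funext => y; rewrite /step_integral big_nil.
Qed.

Lemma wiener_integral_sum I (r : seq I) (c : I -> R) (h : I -> R -> R) (X : I -> T -> R) :
  (forall i, wiener_integral W (h i) (X i)) ->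
  wiener_integral W (fun y => \sum_(i <- r) c i * h i y) (fun w => \sum_(i <- r) c i * X i w).
Proof.
move=> HX; elim: r => [|i r IH].
  by under eq_fun do rewrite big_nil; under [X in wiener_integral _ _ X]eq_fun do rewrite big_nil; exact: wiener_integral0.
under eq_fun do rewrite big_cons; under [X in wiener_integral _ _ X]eq_fun do rewrite big_cons.
exact: wiener_integral_lin.
Qed.

Lemma wiener_integralB h g X Y : wiener_integral W h X -> wiener_integral W g Y ->
  wiener_integral W (fun y => h y - g y) (fun w => X w - Y w).
Proof.
move=> hX gY; have := wiener_integral_lin (-1) gY hX; congr wiener_integral;
by apply/funext => y; rewrite mulN1r addrC.
Qed.

Lemma wiener_isometry h g X Y : wiener_integral W h X -> wiener_integral W g Y ->
  nsq P (fun w => X w - Y w) = nsq mu (fun y => h y - g y).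
Proof.
by move=> hX gY; have [] := wiener_integral_law (wiener_integralB hX gY).
Qed.

(** A diagonal choice: the n-th step function is 1/(n+1)-close to the n-th integrand and,
    simultaneously, its integral to the n-th integral. *)
Lemma wiener_integral_limit (h_ : nat -> R -> R) (X_ : nat -> T -> R) h X :
  (forall n, wiener_integral W (h_ n) (X_ n)) -> L2 mu h -> L2 P X ->
  nsq mu (fun y => h_ n y - h y) @[n --> \oo] --> (0 : R) ->
  nsq P (fun w => X_ n w - X w) @[n --> \oo] --> (0 : R) ->
  wiener_integral W h X.
Proof.
move=> HX h2 X2 ch cX; apply/wiener_integralP; split=> //.
have hn2 n : L2 mu (h_ n) by have [] := wiener_integral_law (HX n).
have Xn2 n : L2 P (X_ n) by have [] := wiener_integral_law (HX n).
have [t Ht] : {t : nat -> seq (R * R * R) & forall n, [/\ wf_step (t n),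
    nsq mu (fun y => step_fun (t n) y - h_ n y) <= n.+1%:R^-1 &
    nsq P (fun w => step_integral W (t n) w - X_ n w) <= n.+1%:R^-1]}.
  apply: (@choice _ _ (fun n t => [/\ wf_step t, nsq mu (fun y => step_fun t y - h_ n y) <= n.+1%:R^-1 &
    nsq P (fun w => step_integral W t w - X_ n w) <= n.+1%:R^-1])) => n.
  have [_ _ [s [ws c1 c2]]] := (wiener_integralP _ _).1 (HX n).
  have n0 : 0 < n.+1%:R^-1 :> R by rewrite invr_gt0.
  near \oo => k; exists (s k); split; first exact: ws.
    by near: k; exact: (cvgr_le _ c1 _ n0).
  by near: k; exact: (cvgr_le _ c2 _ n0).
have wt n : wf_step (t n) by have [] := Ht n.
have I2 n : L2 P (step_integral W (t n)) by have [] := step_integral_law (wt n).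
have S2 n := L2_step_fun (wt n).
have c0 : (fun n : nat => n.+1%:R^-1) @ \oo --> (0 : R) by exact: cvg_harmonic.
exists t; split=> //.
- apply: (@squeeze_cvgr _ _ _ _ (fun=> 0) (fun n => 2 * n.+1%:R^-1 + 2 * nsq mu (fun y => h_ n y - h y))).
  + apply: nearW => n; rewrite nsq_ge0 /=.
    apply: le_trans (nsqB_triangle (S2 n) (hn2 n) h2) _.
    by rewrite lerD2r ler_pM2l//; have [] := Ht n.
  + exact: cvg_cst.
  + by rewrite -[0 as Z in _ --> Z](addr0 0) -[X in X + _](mulr0 2) -[X in _ + X](mulr0 2);
    apply: cvgD; apply: cvgM => //; exact: cvg_cst.
- apply: (@squeeze_cvgr _ _ _ _ (fun=> 0) (fun n => 2 * n.+1%:R^-1 + 2 * nsq P (fun y => X_ n y - X y))).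
  + apply: nearW => n; rewrite nsq_ge0 /=.
    apply: le_trans (nsqB_triangle (I2 n) (Xn2 n) X2) _.
    by rewrite lerD2r ler_pM2l//; have [] := Ht n.
  + exact: cvg_cst.
  + by rewrite -[0 as Z in _ --> Z](addr0 0) -[X in X + _](mulr0 2) -[X in _ + X](mulr0 2);
    apply: cvgD; apply: cvgM => //; exact: cvg_cst.
Unshelve. all: by end_near.
Qed.

(** The isometry turns the convergence of the integrands into a Cauchy property of the integrals. *)
Lemma wiener_integral_exists_limit (h_ : nat -> R -> R) (X_ : nat -> T -> R) h :
  (forall n, wiener_integral W (h_ n) (X_ n)) -> L2 mu h ->
  nsq mu (fun y => h_ n y - h y) @[n --> \oo] --> (0 : R) ->
  exists X, wiener_integral W h X.
Proof.
move=> HX h2 ch.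
have hn2 n : L2 mu (h_ n) by have [] := wiener_integral_law (HX n).
have Xn2 n : L2 P (X_ n) by have [] := wiener_integral_law (HX n).
have [e e0|X X2 cX] := L2_complete Xn2.
  have e4 : 0 < e / 4 by rewrite divr_gt0.
  have [N _ HN] := cvgr_le _ ch _ e4.
  exists N => m n Nm Nn; rewrite (wiener_isometry (HX m) (HX n)).
  apply: le_trans (nsqB_triangle (hn2 m) h2 (hn2 n)) _.
  rewrite [nsq _ (fun x => h x - _)]nsqBC.
  have := HN m Nm; have := HN n Nn; lra.
by exists X; exact: wiener_integral_limit HX h2 X2 ch cX.
Qed.

(** Meant for the Hermite functions: step functions on growing windows converge pointwise by
    continuity, and the Gaussian decay of [h] dominates them. *)
Lemma wiener_integral_exists (h : R -> R) (b C : R) : 0 < b -> continuous h ->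
  (forall x, `|h x| <= C * gsb b x) -> exists X, wiener_integral W h X.
Proof.
move=> b0 ch hC.
have mh : measurable_fun setT h by exact: continuous_measurable_fun.
have C0 : 0 <= C.
  have := le_trans (normr_ge0 _) (hC 0); rewrite pmulr_lge0//; exact: expR_gt0.
(* From y^2 <= 2 x^2 + 2 (y - x)^2: moving the argument by at most 1 halves the rate and costs a
   factor exp b. *)
have bd x y : `|y - x| <= 1 -> gsb b x <= expR b * gsb (b / 2) y.
  move=> xy; rewrite /gsb -expRD ler_expR.
  have : (y - x) ^+ 2 <= 1.
    by rewrite -real_normK ?num_real// exprn_ile1// normr_ge0.
  move: xy; have := sqr_ge0 (y - 2 * x); nra.
pose g y := C * expR b * gsb (b / 2) y.
have gi : mu.-integrable setT (EFin \o (fun y => g y ^+ 2)).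
  have := integrableZl measurableT ((C * expR b) ^+ 2) (integrable_gsb b0).
  apply: eq_integrable => // y _ /=; have -> : gsb b y = gsb (b / 2) y ^+ 2.
    by rewrite expr2 -gsbD -splitr.
  by rewrite -EFinM /g -exprMn.
have [_ h2 cS] : [/\ forall n, L2 mu (step_fun (window_step h n)), L2 mu h &
    nsq mu (fun y => step_fun (window_step h n) y - h y) @[n --> \oo] --> (0 : R)].
  apply: (@dominated_nsq _ _ _ mu (fun n => step_fun (window_step h n)) h g) => //.
  - by move=> n; exact/L2_measurable/L2_step_fun/window_step_wf.
  - apply: aeW => y; apply/cvgrPdist_le => e e0.
    have /cvgrPdist_le/(_ e e0) [r r0 Hr] := ch y.
    near=> n.
    have [[H ->]|[x [/andP[x1 x2] ->]]] := window_stepP h n y.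
      exfalso; move/negP : H; apply; rewrite -ltrNl.
      have : `|y| < n.+1%:R.
        by rewrite -natr1 ltr_wpDr//; near: n; exact: nbhs_infty_gtr.
      by rewrite ltr_norml => /andP[h1 h2]; rewrite ltrNl h1 ltW.
    apply: Hr; rewrite /= ger0_norm; last by rewrite subr_ge0 ltW.
    have H : n.+1%:R^-1 < r by near: n; apply: (cvgr_lt _ (@cvg_harmonic R)).
    by apply: le_lt_trans H; rewrite lerBlDl.
  - apply: aeW => y n; rewrite /g.
    have [[_ ->]|[x [/andP[x1 x2] ->]]] := window_stepP h n y.
      by rewrite normr0 mulr_ge0 ?gsb_ge0// mulr_ge0// expR_ge0.
    apply: le_trans (hC x) _; rewrite -mulrA ler_wpM2l// bd//.
    rewrite ger0_norm; last by rewrite subr_ge0 ltW.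
    have H : n.+1%:R^-1 <= 1 :> R by rewrite invf_le1// ler1n.
    by apply: le_trans H; rewrite lerBlDl.
apply: (wiener_integral_exists_limit (fun n => wiener_integral_step (window_step_wf h n))) => //.
Unshelve. all: by end_near.
Qed.

End wiener_integral_theory.

(** * Completeness of the Hermite functions *)

Section bernstein.
Context (R : realType).
Implicit Types (f g : nat -> R) (u : R).

(* The Bernstein polynomial [\sum_k f k 'C(n, k) 'X^k (1 - 'X)^(n - k)]. *)
Fixpoint bernstein (n : nat) f : {poly R} :=
  if n is m.+1 then (1 - 'X) * bernstein m f + 'X * bernstein m (fun k => f k.+1)
  else (f 0%N)%:P.

Lemma bernsteinS n f u : (bernstein n.+1 f).[u] =
  (1 - u) * (bernstein n f).[u] + u * (bernstein n (fun k => f k.+1)).[u].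
Proof. by rewrite /= !(hornerD,hornerN,hornerM,hornerX,hornerC). Qed.

Lemma bernstein_lin n (a b : R) f g u :
  (bernstein n (fun k => a * f k + b * g k)).[u] = a * (bernstein n f).[u] + b * (bernstein n g).[u].
Proof.
elim: n f g => [|n IH] f g; first by rewrite /= !hornerC.
by rewrite !bernsteinS !IH; ring.
Qed.

Lemma bernstein_cst n (c : R) u : (bernstein n (fun=> c)).[u] = c.
Proof. by elim: n => [|n IH]; [rewrite /= hornerC|rewrite bernsteinS IH; ring]. Qed.

Lemma le_bernstein n f g u : 0 <= u <= 1 -> (forall k, f k <= g k) ->
  (bernstein n f).[u] <= (bernstein n g).[u].
Proof.
move=> /andP[u0 u1]; elim: n f g => [|n IH] f g fg; first by rewrite /= !hornerC.
by rewrite !bernsteinS lerD// ler_wpM2l ?subr_ge0// IH.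
Qed.

(** The value at u is the expectation of f(k) for k binomial with parameters n and u; the formula is
    variance plus squared bias. *)
Lemma bernstein_variance n (c u : R) :
  (bernstein n (fun k => (k%:R - c) ^+ 2)).[u] = n%:R * u * (1 - u) + (n%:R * u - c) ^+ 2.
Proof.
elim: n c => [|n IH] c; first by rewrite /= hornerC; ring.
rewrite bernsteinS IH.
have -> : (fun k : nat => (k.+1%:R - c) ^+ 2) = (fun k : nat => (k%:R - (c - 1)) ^+ 2).
  by apply/funext => k; rewrite -natr1; congr (_ ^+ 2); ring.
by rewrite IH -natr1; ring.
Qed.

(** Pairs of points violating uniformity at scale 1/(n+1) have, by Bolzano-Weierstrass, a common
    limit, where continuity fails. *)
Lemma unif_continuous_itv (G : R -> R) (a b e : R) : continuous G -> 0 < e ->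
  exists2 r : R, 0 < r & forall u v : R, a <= u <= b -> a <= v <= b ->
    `|u - v| < r -> `|G u - G v| <= e.
Proof.
move=> cG e0; apply: contrapT => H.
have [w Hw] : {w : nat -> R * R & forall n, [/\ a <= (w n).1 <= b, a <= (w n).2 <= b,
    `|(w n).1 - (w n).2| < n.+1%:R^-1 & e < `|G (w n).1 - G (w n).2| ]}.
  apply: (@choice _ _ (fun n w => [/\ a <= w.1 <= b, a <= w.2 <= b,
    `|w.1 - w.2| < n.+1%:R^-1 & e < `|G w.1 - G w.2| ])) => n.
  apply: contrapT => H2; apply: H; exists n.+1%:R^-1; first by rewrite invr_gt0.
  move=> u v ua va uv; rewrite leNgt; apply/negP => He.
  by apply: H2; exists (u, v).
have ub : bounded_fun (fun n => (w n).1).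
  exists (`|a| + `|b|); split; first exact: num_real.
  move=> M MB n _ /=; apply: (le_trans _ (ltW MB)); have [/andP[h1 h2] _ _ _] := Hw n.
  rewrite ler_norml; apply/andP; split.
    by have := ler_norm (- a); rewrite normrN; have := normr_ge0 b; lra.
  by have := ler_norm b; have := normr_ge0 a; lra.
have [f fi /cvg_ex[l cl]] := bolzano_weierstrass ub.
have fn n : (n <= f n)%N.
  elim: n => // n IH; apply: leq_ltn_trans IH _.
  by rewrite ltnNge; apply/negP => h; have := fi n.+1 n; rewrite leEnat h ltnn.
have c0 : (w (f n)).1 - (w (f n)).2 @[n --> \oo] --> (0 : R).
  apply/norm_cvg0P; apply: (@squeeze_cvgr _ _ _ _ (fun=> 0) (fun n => n.+1%:R^-1)).
  - apply: nearW => n; rewrite normr_ge0/=; have [_ _ h _] := Hw (f n).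
    apply: (le_trans (ltW h)); rewrite lef_pV2 ?posrE// ler_nat ltnS; exact: fn.
  - exact: cvg_cst.
  - exact: cvg_harmonic.
have c1 : (w (f n)).1 @[n --> \oo] --> (l : R) by [].
have c2 : (w (f n)).2 @[n --> \oo] --> (l : R).
  have -> : (fun n => (w (f n)).2) = (fun n => (w (f n)).1 - ((w (f n)).1 - (w (f n)).2)).
    by apply/funext => n; ring.
  by rewrite -[l as Z in _ --> Z]subr0; apply: cvgB.
have : `|G (w (f n)).1 - G (w (f n)).2| @[n --> \oo] --> `|G l - G l|.
  apply: (@cvg_norm _ R^o); apply: cvgB.
    by apply: (@cvg_comp _ _ _ _ G _ _ _ c1); exact: cG.
  by apply: (@cvg_comp _ _ _ _ G _ _ _ c2); exact: cG.
rewrite subrr normr0 => /(cvgr_lt (0 : R))/(_ e e0)[n _ /(_ n (leqnn n))] /=.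
by have [_ _ _ h] := Hw (f n); rewrite ltNge (ltW h).
Qed.

(** Bernstein's proof: continuity at scale r and boundedness beyond it give |G u - G v| <= e/2 + K
    (u - v)^2, and averaging the quadratic term produces the binomial variance. *)
Lemma weierstrass (G : R -> R) (e : R) : continuous G -> 0 < e ->
  exists p : {poly R}, forall u, 0 <= u <= 1 -> `|G u - p.[u]| <= e.
Proof.
move=> cG e0; have e2 : 0 < e / 2 by rewrite divr_gt0.
have [M HM] : exists M : R, forall u, 0 <= u <= 1 -> `|G u| <= M.
  have cN : continuous (fun x => `|G x|).
    by move=> x; apply: continuous_comp; [exact: cG|exact: norm_continuous].
  have [c _ Hc] := @EVT_max R (fun x => `|G x|) 0 1 ler01 (continuous_subspaceT cN).
  by exists `|G c| => u u01; apply: Hc; rewrite in_itv.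
have M0 : 0 <= M by apply: le_trans (normr_ge0 _) (HM 0 _); rewrite lexx ler01.
have [r r0 Hr] : exists2 r : R, 0 < r & forall u v : R, 0 <= u <= 1 -> 0 <= v <= 1 ->
    `|u - v| < r -> `|G u - G v| <= e / 2.
  exact: unif_continuous_itv.
pose K := 2 * M / r ^+ 2.
have K0 : 0 <= K by rewrite divr_ge0 ?sqr_ge0// mulr_ge0.
have HK u v : 0 <= u <= 1 -> 0 <= v <= 1 -> `|G u - G v| <= e / 2 + K * (u - v) ^+ 2.
  move=> u01 v01; have [uv|uv] := ltP `|u - v| r.
    by rewrite (le_trans (Hr _ _ u01 v01 uv))// lerDl mulr_ge0// sqr_ge0.
  apply: (@le_trans _ _ (2 * M)).
    by apply: le_trans (ler_normB _ _) _; rewrite mulr2n mulrDl mul1r lerD// HM.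
  apply: (@le_trans _ _ (K * (u - v) ^+ 2)); last by rewrite lerDr ltW.
  rewrite /K mulrAC ler_pdivlMr ?exprn_gt0// ler_wpM2l ?mulr_ge0//.
  by rewrite -[leRHS]real_normK ?num_real// lerXn2r ?nnegrE// ltW.
have [n Hn] : exists n : nat, K / n.+1%:R <= e / 2.
  have [n _ /(_ n (leqnn n))] := nbhs_infty_ger (K / (e / 2)).
  move=> Kn; exists n; rewrite ler_pdivrMr// mulrC -ler_pdivrMr//; apply: le_trans Kn _.
  by rewrite ler_nat.
set N : R := n.+1%:R in Hn.
have N0 : 0 < N by rewrite ltr0n.
(* [le_bernstein] compares values at all k, also those above the degree, so the nodes are clamped to
   [0, 1]. *)
pose t (k : nat) : R := Num.min (k%:R / N) 1.
exists (bernstein n.+1 (fun k => G (t k))) => u u01.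
have t01 k : 0 <= t k <= 1.
  by rewrite /t ge_min lexx orbT andbT le_min ler01 andbT divr_ge0// ltW.
have tu k : (u - t k) ^+ 2 <= (k%:R - N * u) ^+ 2 / N ^+ 2.
  have -> : (k%:R - N * u) ^+ 2 / N ^+ 2 = (u - k%:R / N) ^+ 2.
    by field; rewrite gt_eqF.
  rewrite /t; move: (k%:R / N) => q; have [q1|h] := leP q 1; first by [].
  move/andP: u01 => [_ u1].
  rewrite -subr_ge0 (_ : _ - _ = (q - 1) * (q + 1 - 2 * u)); last by ring.
  by rewrite mulr_ge0//; lra.
(* Taking s = 1 and s = -1 gives the two halves of the absolute value. *)
have B (s : R) : s ^+ 2 = 1 -> s * (G u - (bernstein n.+1 (fun k => G (t k))).[u]) <= e.
  move=> s2.
  have := @le_bernstein n.+1 (fun k => s * G u + (- s) * G (t k))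
    (fun k => 1 * (e / 2) + K / N ^+ 2 * (k%:R - N * u) ^+ 2) u u01.
  rewrite !bernstein_lin !bernstein_cst bernstein_variance subrr expr0n addr0.
  have H : K / N ^+ 2 * (N * u * (1 - u)) <= e / 2.
    apply: le_trans Hn; rewrite (_ : K / N ^+ 2 * (N * u * (1 - u)) = K / N * (u * (1 - u))); last first.
      by field; rewrite gt_eqF.
    rewrite ler_piMr ?divr_ge0// ?(ltW N0)//; move/andP: u01 => [? ?]; nra.
  have -> : s * (G u - (bernstein n.+1 (fun k => G (t k))).[u]) =
     s * G u + - s * (bernstein n.+1 (fun k => G (t k))).[u] by ring.
  move=> H2.
  apply: le_trans (H2 _) _; last by rewrite mul1r [leRHS]splitr lerD2l; exact: H.
  move=> k; rewrite mul1r; apply: (@le_trans _ _ `|G u - G (t k)|).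
    have -> : s * G u + - s * G (t k) = s * (G u - G (t k)) by ring.
    apply: le_trans (ler_norm _) _; rewrite normrM (_ : `|s| = 1) ?mul1r//.
    by apply/eqP; rewrite -(@eqrXn2 _ 2)// ?real_normK ?num_real// s2 expr1n.
  apply: (le_trans (HK _ _ u01 (t01 k))); rewrite lerD2l -mulrA ler_wpM2l//.
  by rewrite mulrC; exact: tu.
rewrite ler_norml; apply/andP; split.
  by have := B (-1); rewrite sqrrN expr1n => /(_ erefl); lra.
by have := B 1; rewrite expr1n => /(_ erefl); lra.
Qed.
End bernstein.

(** * Orthonormality of the Hermite functions *)

Section hermite_orthonormal.
Context (R : realType).
Notation mu := (@lebesgue_measure R).

(** The physicists' Hermite polynomials: weight exp(-x^2) and leading coefficient 2^n. *)
Fixpoint hermite_poly (n : nat) : {poly R} :=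
  if n is m.+1 then 2 *: ('X * hermite_poly m) - (hermite_poly m)^`() else 1.

Lemma derive1n_gauss n (x : R) : derive1n n (fun y : R => expR (- y ^+ 2)) x =
  (-1) ^+ n * ((hermite_poly n).[x] * gsb 1 x).
Proof.
elim: n x => [|n IH] x.
  by rewrite /= expr0 hornerC !mul1r /gsb mul1r.
rewrite derive1nS (_ : derive1n n _ = (fun x => (-1) ^+ n * ((hermite_poly n).[x] * gsb 1 x))); last exact/funext.
rewrite derive1E; have H := is_derive_horner_gsb (hermite_poly n) 1 x.
have H2 : is_derive x 1 (fun x => (-1) ^+ n * ((hermite_poly n).[x] * gsb 1 x))
   ((-1) ^+ n *: (((hermite_poly n)^`() - (2 * 1) *: ('X * hermite_poly n)).[x] * gsb 1 x)).
  exact: is_deriveZ.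
rewrite derive_val /GRing.scale/= exprS !(hornerD,hornerN,hornerM,hornerZ,hornerX,hornerC); ring.
Qed.

Definition hermite_norm (n : nat) : R := (Num.sqrt (Num.sqrt pi * 2 ^+ n * n`!%:R))^-1.

Lemma hermite_funE n (x : R) :
  hermite_fun n.+1 x = hermite_norm n * ((hermite_poly n).[x] * gsb 2^-1 x).
Proof.
rewrite /hermite_fun /= derive1n_gauss -/(hermite_norm n).
have -> : gsb 2^-1 x = expR (x ^+ 2 / 2) * gsb 1 x.
  by rewrite /gsb -expRD; congr expR; field.
have : (-1) ^+ n * (-1) ^+ n = 1 :> R by rewrite -exprMn mulrNN mulr1 expr1n.
set s := (-1) ^+ n; set e := expR _; set g := gsb 1 x; set h := _.[x] => s1.
transitivity ((s * s) * (hermite_norm n * (h * (e * g)))); first by ring.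
by rewrite s1 mul1r.
Qed.

Lemma size_hermite_poly n : size (hermite_poly n) = n.+1 /\ (hermite_poly n)`_n = 2 ^+ n.
Proof.
elim: n => [|n [IHs IHc]]; first by rewrite /= size_poly1 coefC eqxx expr0.
have h0 : hermite_poly n != 0 by rewrite -size_poly_gt0 IHs.
have sX : size (2 *: ('X * hermite_poly n)) = n.+2.
  by rewrite size_scale ?pnatr_eq0// mulrC size_mulX// IHs.
have sd : (size (hermite_poly n)^`() < n.+2)%N.
  by apply: ltn_trans (lt_size_deriv h0) _; rewrite IHs.
split.
  by rewrite /= size_polyDl ?size_polyN sX.
rewrite /= coefB coefZ coefXM /= IHc -exprS.
by rewrite [X in _ - X]nth_default ?subr0.
Qed.

Definition gauss_int (p : {poly R}) : R := \int[mu]_x (p.[x] * gsb 1 x).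

Lemma gauss_intB p q : gauss_int (p - q) = gauss_int p - gauss_int q.
Proof.
rewrite /gauss_int -RintegralB//; try exact: integrable_horner_gsb.
by apply: eq_Rintegral => x _; rewrite hornerD hornerN; ring.
Qed.

Lemma gauss_intZ c p : gauss_int (c *: p) = c * gauss_int p.
Proof.
rewrite /gauss_int -RintegralZl//; last exact: integrable_horner_gsb.
by apply: eq_Rintegral => x _; rewrite hornerZ; ring.
Qed.

Lemma gauss_int_deriv p : gauss_int p^`() = 2 * gauss_int ('X * p).
Proof. by rewrite /gauss_int integral_derive_horner_gsb// mulr1. Qed.

(** Times the weight, [hermite_poly n.+1] is minus the derivative of [hermite_poly n] times the
    weight; integration by parts moves that derivative onto [q]. *)
Lemma gauss_int_hermite n q : gauss_int (hermite_poly n * q) = gauss_int q^`(n).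
Proof.
elim: n q => [|n IH] q; first by rewrite /= mul1r.
transitivity (gauss_int (hermite_poly n * q^`())); last by rewrite IH derivSn.
have -> : hermite_poly n.+1 * q = 2 *: ('X * (hermite_poly n * q)) - (hermite_poly n)^`() * q.
  by rewrite /= mulrBl -scalerAl mulrA.
rewrite gauss_intB gauss_intZ -gauss_int_deriv derivM.
by rewrite -gauss_intB addrC addKr.
Qed.

Lemma gauss_intC c : gauss_int c%:P = c * Num.sqrt pi.
Proof.
rewrite -[c%:P]mulr1 mul_polyC gauss_intZ; congr (_ * _).
rewrite /gauss_int /Rintegral -[RHS]/(fine (Num.sqrt pi)%:E) -integralT_gauss; congr fine.
by apply: eq_integral => x _; rewrite hornerC mul1r /gsb mul1r.
Qed.

(** The derivatives kill a factor of lower degree; in equal degree they leave the constant n!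
    2^n. *)
Lemma gauss_int_hermite_orth m n : gauss_int (hermite_poly m * hermite_poly n) =
  if m == n then Num.sqrt pi * 2 ^+ n * n`!%:R else 0.
Proof.
have lt_case k l : (k < l)%N -> gauss_int (hermite_poly l * hermite_poly k) = 0.
  move=> kl; rewrite gauss_int_hermite derivn_poly0; last first.
    by have [-> _] := size_hermite_poly k.
  by rewrite (gauss_intC 0) mul0r.
case: ltngtP => [mn|nm|->]; [by rewrite mulrC lt_case|exact: lt_case|].
rewrite gauss_int_hermite.
have [sn cn] := size_hermite_poly n.
have -> : (hermite_poly n)^`(n) = ((hermite_poly n)`_n *+ n`!)%:P.
  apply/polyP => i; rewrite coef_derivn coefC; case: i => [|i] /=.
    by rewrite addn0 ffactnn.
  by rewrite nth_default ?mul0rn// sn addnS ltnS leq_addr.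
by rewrite gauss_intC cn -mulr_natr; ring.
Qed.

Lemma continuous_hermite_fun n : continuous (hermite_fun n.+1 : R -> R).
Proof.
have -> : hermite_fun n.+1 = (fun x : R => hermite_norm n * ((hermite_poly n).[x] * gsb 2^-1 x)).
  by apply/funext => x; rewrite hermite_funE.
by move=> x; apply: cvgM; [exact: cvg_cst|exact: continuous_horner_gsb].
Qed.

Lemma hermite_fun_decay n : exists C : R, forall x, `|hermite_fun n.+1 x| <= C * gsb 4^-1 x.
Proof.
have b : 4^-1 < 2^-1 :> R by lra.
have [C C0 HC] := horner_gsb_le (hermite_poly n) b.
exists (`|hermite_norm n| * C) => x; rewrite hermite_funE normrM -mulrA ler_wpM2l//.
Qed.

Lemma L2_horner_gsb p b : 0 < b -> L2 mu (fun x => p.[x] * gsb b x).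
Proof.
move=> b0; split.
  by apply: continuous_measurable_fun; exact: continuous_horner_gsb.
have b2 : 0 < b + b by rewrite addr_gt0.
have := integrable_horner_gsb (p * p) b2; apply: eq_integrable => // x _ /=.
by rewrite hornerM gsbD; congr EFin; ring.
Qed.

Lemma L2_hermite_fun n : L2 mu (hermite_fun n.+1).
Proof.
have b0 : 0 < 2^-1 :> R by lra.
have := L2Z (hermite_norm n) (L2_horner_gsb (hermite_poly n) b0).
by congr L2; apply/funext => x; rewrite hermite_funE.
Qed.

Lemma hermite_norm_neq0 n : hermite_norm n != 0.
Proof.
rewrite invr_eq0 sqrtr_eq0 -ltNge !mulr_gt0// ?exprn_gt0// ?sqrtr_gt0 ?pi_gt0//.
Qed.

Lemma hermite_orthonormal m n : ip mu (hermite_fun m.+1) (hermite_fun n.+1) = (m == n)%:R.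
Proof.
transitivity (hermite_norm m * hermite_norm n * gauss_int (hermite_poly m * hermite_poly n)).
  rewrite /gauss_int -RintegralZl//; last exact: integrable_horner_gsb.
  apply: eq_Rintegral => x _; rewrite !hermite_funE hornerM.
  have e1 : (1 : R) = 2^-1 + 2^-1 by field.
  by rewrite [in RHS]e1 gsbD; ring.
rewrite gauss_int_hermite_orth; case: eqP => [->|_]; last by rewrite mulr0.
rewrite /hermite_norm -invfM -expr2 sqr_sqrtr.
  rewrite mulVf// !mulf_neq0// ?expf_neq0// ?pnatr_eq0 -?lt0n ?fact_gt0//.
  by rewrite sqrtr_eq0 -ltNge pi_gt0.
by rewrite !mulr_ge0// ?exprn_ge0// sqrtr_ge0.
Qed.

(** The system is triangular: the nonzero leading coefficient 2^n lets the top term be removed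
    degree by degree. *)
Lemma hermite_poly_span (p : {poly R}) : exists n (a : nat -> R),
  p = \sum_(j < n) a j *: hermite_poly j.
Proof.
suff H n : (size p <= n)%N -> exists a : nat -> R, p = \sum_(j < n) a j *: hermite_poly j.
  by exists (size p); exact: H.
elim: n p => [|n IH] p.
  by rewrite leqn0 size_poly_eq0 => /eqP ->; exists (fun=> 0); rewrite big_ord0.
move=> sp; pose c := p`_n / 2 ^+ n.
have [sn cn] := size_hermite_poly n.
have : (size (p - c *: hermite_poly n)%R <= n)%N.
  apply/leq_sizeP => j; rewrite leq_eqVlt => /predU1P[<-|nj].
    by rewrite coefB coefZ cn /c divfK ?subrr// expf_neq0.
  by rewrite coefB coefZ !nth_default ?mulr0 ?subr0 ?sn// (leq_trans sp).
move=> /IH[a Ha]; exists (fun j => if (j < n)%N then a j else c).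
rewrite big_ord_recr /= ltnn -[LHS](subrK (c *: hermite_poly n)) Ha; congr (_ + _).
by apply: eq_bigr => j _; rewrite ltn_ord.
Qed.

End hermite_orthonormal.

(** * Density of the Hermite span and Parseval's identity *)

Section hermite_parseval.
Context (R : realType).
Notation mu := (@lebesgue_measure R).

Definition hermite_coef (f : R -> R) (j : nat) : R := ip mu f (hermite_fun j.+1).

Definition hermite_sum (a : nat -> R) (K : nat) (y : R) : R :=
  \sum_(j < K) a j * hermite_fun j.+1 y.

Lemma L2_hermite_sum a K : L2 mu (hermite_sum a K).
Proof. by apply: L2_sum => j; apply: L2Z; exact: L2_hermite_fun. Qed.

Lemma nsq_hermite_sum a K : nsq mu (hermite_sum a K) = \sum_(j < K) a j ^+ 2.
Proof.
have L (i : 'I_K) : L2 mu (fun y => a i * hermite_fun i.+1 y) by apply: L2Z; exact: L2_hermite_fun.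
rewrite /nsq ip_suml//; last exact: L2_hermite_sum.
apply: eq_bigr => i _; rewrite ipC ip_suml//.
rewrite (bigD1 i)//= big1 ?addr0; last first.
  move=> j ji; rewrite ipZl; [|exact: L2_hermite_fun|exact: L].
  rewrite ipC ipZl; [|exact: L2_hermite_fun..].
  by rewrite hermite_orthonormal eq_sym (negbTE (ji : _ != _ :> nat)) !mulr0.
rewrite ipZl; [|exact: L2_hermite_fun|exact: L].
rewrite ipC ipZl; [|exact: L2_hermite_fun..].
by rewrite hermite_orthonormal eqxx mulr1 expr2.
Qed.

(** Completing the square. The last sum vanishes for the Hermite coefficients of [f], which are
    therefore the best choice of [a]. *)
Lemma nsq_sub_hermite_sum f a K : L2 mu f -> nsq mu (fun y => f y - hermite_sum a K y) =
  nsq mu f - \sum_(j < K) hermite_coef f j ^+ 2 + \sum_(j < K) (a j - hermite_coef f j) ^+ 2.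
Proof.
move=> f2; rewrite nsqB//; last exact: L2_hermite_sum.
rewrite nsq_hermite_sum.
have -> : ip mu f (hermite_sum a K) = \sum_(j < K) a j * hermite_coef f j.
  rewrite ipC /hermite_sum ip_suml//; last by move=> i; apply: L2Z; exact: L2_hermite_fun.
  by apply: eq_bigr => i _; rewrite ipZl//; [rewrite ipC|exact: L2_hermite_fun].
rewrite mulr_sumr -!addrA; congr (_ + _); rewrite -!sumrN -!big_split /=.
by apply: eq_bigr => i _; ring.
Qed.

(* Membership in the closed span of the Hermite functions. *)
Definition hermite_closure f := forall e, 0 < e -> exists2 p : {poly R},
  L2 mu f & nsq mu (fun y => f y - p.[y] * gsb 2^-1 y) <= e.

Let h0 : 0 < 2^-1 :> R. Proof. by lra. Qed.

Lemma hermite_closure_L2 f : hermite_closure f -> L2 mu f.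
Proof. by move=> /(_ 1 ltr01)[]. Qed.

Lemma hermite_closure_poly p : hermite_closure (fun y => p.[y] * gsb 2^-1 y).
Proof.
move=> e e0; exists p; first exact: L2_horner_gsb.
rewrite (_ : (fun y => _ - _) = fun=> 0); last by apply/funext => y; rewrite subrr.
by rewrite /nsq ip0l ltW.
Qed.

Lemma hermite_closureD f g : hermite_closure f -> hermite_closure g ->
  hermite_closure (fun y => f y + g y).
Proof.
move=> Hf Hg e e0; have e4 : 0 < e / 4 by rewrite divr_gt0.
have [p f2 Hp] := Hf _ e4; have [q g2 Hq] := Hg _ e4.
exists (p + q); first exact: L2D.
have pf2 := L2B f2 (L2_horner_gsb p h0); have qg2 := L2B g2 (L2_horner_gsb q h0).
have := nsqD_le pf2 qg2.
rewrite (_ : (fun x => _ + _) = (fun y => f y + g y - (p + q).[y] * gsb 2^-1 y)); last first.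
  by apply/funext => y; rewrite hornerD; ring.
move/le_trans; apply; lra.
Qed.

Lemma hermite_closureZ c f : hermite_closure f -> hermite_closure (fun y => c * f y).
Proof.
move=> Hf e e0; have c0 : 0 < c ^+ 2 + 1 by rewrite ltr_wpDl// sqr_ge0.
have ec : 0 < e / (c ^+ 2 + 1) by rewrite divr_gt0.
have [p f2 Hp] := Hf _ ec; exists (c *: p); first exact: L2Z.
have pf2 := L2B f2 (L2_horner_gsb p h0).
rewrite (_ : (fun y => _ - _) = (fun y => c * (f y - p.[y] * gsb 2^-1 y))); last first.
  by apply/funext => y; rewrite hornerZ; ring.
rewrite nsqZ//; move: Hp; rewrite ler_pdivlMr//.
have := nsq_ge0 mu (fun y => f y - p.[y] * gsb 2^-1 y); nra.
Qed.

Lemma hermite_closure_limit f : L2 mu f ->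
  (forall e, 0 < e -> exists2 g, hermite_closure g & nsq mu (fun y => f y - g y) <= e) ->
  hermite_closure f.
Proof.
move=> f2 H e e0; have e4 : 0 < e / 4 by rewrite divr_gt0.
have [g Hg fg] := H _ e4; have [p g2 Hp] := Hg _ e4.
exists p => //; apply: le_trans (nsqB_triangle f2 g2 (L2_horner_gsb p h0)) _.
lra.
Qed.

Lemma hermite_closure_cvg (F : nat -> R -> R) f : L2 mu f -> (forall n, hermite_closure (F n)) ->
  nsq mu (fun y => F n y - f y) @[n --> \oo] --> (0 : R) -> hermite_closure f.
Proof.
move=> f2 HF cF; apply: hermite_closure_limit => // e e0.
have [N _ /(_ N (leqnn N)) HN] := cvgr_le _ cF _ e0.
by exists (F N) => //; rewrite nsqBC.
Qed.

(** The K-th partial sum is the best approximation by the first K functions, which for large K span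
    any given polynomial approximation. *)
Lemma hermite_closure_parseval f : hermite_closure f ->
  nsq mu (fun y => hermite_sum (hermite_coef f) K y - f y) @[K --> \oo] --> (0 : R) /\
  \sum_(j < K) hermite_coef f j ^+ 2 @[K --> \oo] --> nsq mu f.
Proof.
move=> Hf; have f2 := hermite_closure_L2 Hf.
have E K : nsq mu (fun y => hermite_sum (hermite_coef f) K y - f y) =
    nsq mu f - \sum_(j < K) hermite_coef f j ^+ 2.
  rewrite nsqBC nsq_sub_hermite_sum// [X in _ + X]big1 ?addr0// => i _.
  by rewrite subrr expr0n.
have c0 : nsq mu (fun y => hermite_sum (hermite_coef f) K y - f y) @[K --> \oo] --> (0 : R).
  apply/cvgrPdist_le => e e0; have [p _ Hp] := Hf _ e0.
  have [n [a pE]] := hermite_poly_span p.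
  exists n => // K /= nK; rewrite sub0r normrN ger0_norm ?nsq_ge0//.
  (* Padding with zeros makes the polynomial approximation a Hermite sum of every length K >= n; the
     norms are divided out. *)
  pose b j := if (j < n)%N then a j / hermite_norm R j else 0.
  have pb : (fun y => p.[y] * gsb 2^-1 y) = hermite_sum b K.
    apply/funext => y; rewrite pE horner_sum mulr_suml /hermite_sum.
    rewrite -(big_mkord xpredT (fun j => b j * hermite_fun j.+1 y)).
    rewrite (big_cat_nat (n := n))//= [X in _ = _ + X]big1_seq ?addr0; last first.
      by move=> j; rewrite mem_index_iota => /andP[_ /andP[nj _]]; rewrite /b ltnNge nj mul0r.
    rewrite big_mkord; apply: eq_bigr => i _.
    rewrite /b ltn_ord hornerZ hermite_funE mulrA divfK -?mulrA//.
    exact: hermite_norm_neq0.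
  have {}pb : (fun y => f y - p.[y] * gsb 2^-1 y) = (fun y => f y - hermite_sum b K y).
    by apply/funext => y; congr (_ - _); exact: (congr1 (fun F : R -> R => F y) pb).
  apply: le_trans Hp; rewrite pb E nsq_sub_hermite_sum// lerDl.
  by apply: sumr_ge0 => i _; exact: sqr_ge0.
split=> //.
have -> : (fun K => \sum_(j < K) hermite_coef f j ^+ 2) =
   (fun K => nsq mu f - nsq mu (fun y => hermite_sum (hermite_coef f) K y - f y)).
  by apply/funext => K; rewrite E subKr.
by rewrite -[nsq mu f as Z in _ --> Z]subr0; apply: cvgB => //; exact: cvg_cst.
Qed.

(** The Taylor polynomial of [gsb 4^-1] at 0. *)
Definition taylor_gauss (N : nat) : {poly R} := \sum_(i < N) (i`!%:R^-1 * (- 4^-1) ^+ i) *: 'X^(i.*2).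

Lemma taylor_gaussE N x : (taylor_gauss N).[x] = series (exp_coeff (- (4^-1 * x ^+ 2))) N.
Proof.
rewrite /taylor_gauss horner_sum /series /= big_mkord; apply: eq_bigr => i _.
rewrite hornerZ hornerXn /exp_coeff /= -mulNr exprMn -exprM mul2n; ring.
Qed.

Lemma cvg_taylor_gauss x : (taylor_gauss N).[x] @[N --> \oo] --> gsb 4^-1 x.
Proof.
under eq_fun do rewrite taylor_gaussE.
exact: is_cvg_series_exp_coeff.
Qed.

(** The absolute values of the terms sum to at most exp(x^2/4). Since 1/4 < 1/2, this bound times
    [gsb 2^-1] is still square integrable, uniformly in N. *)
Lemma taylor_gauss_le N x : `|(taylor_gauss N).[x]| <= gsb (- 4^-1) x.
Proof.
rewrite taylor_gaussE (_ : gsb _ _ = limn (series (exp_coeff (4^-1 * x ^+ 2)))); last first.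
  by rewrite /gsb mulNr opprK.
have c0 : 0 <= 4^-1 * x ^+ 2 by rewrite mulr_ge0 ?sqr_ge0// invr_ge0.
apply: (@le_trans _ _ (series (exp_coeff (4^-1 * x ^+ 2)) N)).
  rewrite /series /= (le_trans (ler_norm_sum _ _ _))// ler_sum// => i _.
  by rewrite /exp_coeff /= normrM normrX normrN ger0_norm// ger0_norm// invr_ge0.
apply: nondecreasing_cvgn_le; last exact: is_cvg_series_exp_coeff.
apply/nondecreasing_seqP => k; rewrite /series /= big_nat_recr//= lerDl.
exact: exp_coeff_ge0.
Qed.

(* Multiplying by [gsb 4^-1] preserves the class of multipliers of the closed span,
   by expanding it into its Taylor series. *)
Lemma hermite_closure_gauss_mul k q :
  hermite_closure (fun y => gsb 4^-1 y ^+ k * (q.[y] * gsb 2^-1 y)).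
Proof.
elim: k q => [|k IH] q.
  by have := hermite_closure_poly q; congr hermite_closure; apply/funext => y; rewrite expr0 mul1r.
have b4 : 0 <= 4^-1 :> R by rewrite invr_ge0.
have gk (y : R) : gsb 4^-1 y ^+ k <= 1 by rewrite exprn_ile1 ?gsb_ge0 ?gsb_le1.
have gk0 (y : R) : 0 <= gsb 4^-1 y ^+ k by rewrite exprn_ge0 ?gsb_ge0.
have mk : measurable_fun setT (fun y : R => gsb 4^-1 y ^+ k).
  by apply: measurable_funX; exact: measurable_gsb.
have mh p b : measurable_fun setT (fun y : R => p.[y] * gsb b y).
  by apply: continuous_measurable_fun; exact: continuous_horner_gsb.
have [_ f2 cF] : [/\ forall N, L2 mu (fun y => gsb 4^-1 y ^+ k * ((q * taylor_gauss N).[y] * gsb 2^-1 y)),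
    L2 mu (fun y => gsb 4^-1 y ^+ k.+1 * (q.[y] * gsb 2^-1 y)) &
    nsq mu (fun y => gsb 4^-1 y ^+ k * ((q * taylor_gauss N).[y] * gsb 2^-1 y) -
      gsb 4^-1 y ^+ k.+1 * (q.[y] * gsb 2^-1 y)) @[N --> \oo] --> (0 : R)].
  apply: (@dominated_nsq _ _ _ mu (fun N y => gsb 4^-1 y ^+ k * ((q * taylor_gauss N).[y] * gsb 2^-1 y))
    (fun y => gsb 4^-1 y ^+ k.+1 * (q.[y] * gsb 2^-1 y)) (fun y => `|q.[y] * gsb 4^-1 y|)).
  - by move=> N; apply: measurable_funM; [exact: mk|exact: mh].
  - by apply: measurable_funM; [apply: measurable_funX; exact: measurable_gsb|exact: mh].
  - have [_ +] := L2_horner_gsb q (ltac:(lra) : 0 < 4^-1 :> R).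
    apply: eq_integrable => // y _ /=.
    by rewrite real_normK ?num_real.
  - apply: aeW => y; rewrite exprSr -mulrA; apply: cvgM; first exact: cvg_cst.
    rewrite [gsb 4^-1 y * _]mulrCA; under eq_fun do rewrite hornerM -mulrA.
    apply: cvgM; first exact: cvg_cst.
    by apply: cvgM; [exact: cvg_taylor_gauss|exact: cvg_cst].
  - apply: aeW => y N; rewrite normrM ger0_norm//.
    apply: (@le_trans _ _ `|(q * taylor_gauss N).[y] * gsb 2^-1 y|); first by rewrite ler_piMl.
    rewrite hornerM -mulrA !normrM ler_wpM2l//.
    apply: le_trans (ler_wpM2r (normr_ge0 _) (taylor_gauss_le N y)) _.
    rewrite !ger0_norm ?gsb_ge0// -gsbD.
    by apply: le_gsb; lra.
by apply: (hermite_closure_cvg f2 _ cF) => N; exact: IH.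
Qed.

Lemma hermite_closure_gauss_poly (B q : {poly R}) :
  hermite_closure (fun y => B.[gsb 4^-1 y] * (q.[y] * gsb 2^-1 y)).
Proof.
have : forall n (a : nat -> R), hermite_closure (fun y => (\sum_(i < n) a i * gsb 4^-1 y ^+ i) * (q.[y] * gsb 2^-1 y)).
  move=> n a; elim: n => [|n IH].
    have := hermite_closure_poly 0; congr hermite_closure; apply/funext => y.
    by rewrite horner0 big_ord0 !mul0r.
  have := hermite_closureD IH (hermite_closureZ (a n) (hermite_closure_gauss_mul n q)).
  congr hermite_closure; apply/funext => y; rewrite big_ord_recr /=; ring.
move=> /(_ (size B) (fun i => B`_i)); congr hermite_closure.
by apply/funext => y; rewrite (horner_coef B).
Qed.

(** The variable u = [gsb 4^-1 y] determines |y|, so h divided by [gsb 2^-1] is a continuous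
    function G of u on [0, 1], which Weierstrass's theorem approximates by polynomials in u. *)
Lemma hermite_closure_even (h : R -> R) (q : {poly R}) (M : R) : continuous h ->
  (forall y, h (- y) = h y) -> 0 <= M -> (forall y, M < `|y| -> h y = 0) ->
  hermite_closure (fun y => q.[y] * h y).
Proof.
move=> ch he M0 hM.
(* The value of u at |y| = M + 1. Freezing u below it avoids the logarithm at 0 and is harmless, as
   h vanishes there. *)
pose dl := gsb 4^-1 (M + 1).
have dl0 : 0 < dl by exact: expR_gt0.
(* Here -4 ln u = y^2 recovers |y|, and exp(-2 ln u) = exp(y^2/2) undoes the factor [gsb 2^-1]. *)
pose G u := h (Num.sqrt (- 4 * ln (Num.max u dl))) * expR (- 2 * ln (Num.max u dl)).
have m0 u : 0 < Num.max u dl by rewrite lt_max dl0 orbT.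
have cm : continuous (fun u : R => Num.max u dl).
  have -> : (fun u : R => Num.max u dl) = (id : R -> R^o) \max (cst dl : R -> R^o) by [].
  by move=> u; apply: continuous_max; [exact: cvg_id|exact: cvg_cst].
have cl : continuous (fun u : R => ln (Num.max u dl)).
  move=> u; apply: (@continuous_comp _ _ _ (fun u : R => Num.max u dl) (@ln R)); first exact: cm.
  exact: continuous_ln.
have cG : continuous G.
  move=> u; apply: cvgM.
    apply: (@continuous_comp _ _ _ (fun u : R => Num.sqrt (- 4 * ln (Num.max u dl))) h); last exact: ch.
    apply: (@continuous_comp _ _ _ (fun u : R => - 4 * ln (Num.max u dl)) (@Num.sqrt R)).
      by apply: cvgM; [exact: cvg_cst|exact: cl].
    exact: sqrt_continuous.
  apply: (@continuous_comp _ _ _ (fun u : R => - 2 * ln (Num.max u dl)) (@expR R)).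
    by apply: cvgM; [exact: cvg_cst|exact: cl].
  exact: continuous_expR.
have GE y : G (gsb 4^-1 y) * gsb 2^-1 y = h y.
  have habs : h `|y| = h y.
    by have [y0|y0] := leP 0 y; [rewrite ger0_norm|rewrite ltr0_norm].
  rewrite /G; have [yM|yM] := leP `|y| (M + 1).
    rewrite max_l; last first.
      rewrite /dl /gsb ler_expR lerN2 ler_wpM2l ?invr_ge0// -[y ^+ 2]real_normK ?num_real//.
      by rewrite lerXn2r ?nnegrE// addr_ge0.
    rewrite {1 2}/gsb expRK (_ : - 4 * - (4^-1 * y ^+ 2) = y ^+ 2); last by field.
    rewrite sqrtr_sqr habs -mulrA -expRD (_ : _ + _ = 0) ?expR0 ?mulr1//.
    by field.
  rewrite max_r; last first.
    rewrite /dl /gsb ler_expR lerN2 ler_wpM2l ?invr_ge0// -[y ^+ 2]real_normK ?num_real//.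
    by rewrite lerXn2r ?nnegrE ?addr_ge0// ltW.
  rewrite [RHS]hM; last by rewrite (le_lt_trans _ yM)// lerDl.
  rewrite /dl {1 2}/gsb expRK (_ : - 4 * - (4^-1 * (M + 1) ^+ 2) = (M + 1) ^+ 2); last by field.
  rewrite sqrtr_sqr hM ?mul0r//; rewrite normr_id ger0_norm ?addr_ge0// ltrDl//.
have u01 (y : R) : 0 <= gsb 4^-1 y <= 1 by rewrite gsb_ge0 gsb_le1// invr_ge0.
pose w y := q.[y] * gsb 2^-1 y.
have w2 : L2 mu w by exact: L2_horner_gsb.
have mqh : measurable_fun setT (fun y => q.[y] * h y).
  apply: continuous_measurable_fun => y; apply: cvgM; last exact: ch.
  exact: continuous_horner.
have qhE y : q.[y] * h y = G (gsb 4^-1 y) * w y by rewrite -GE /w; ring.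
have cN : continuous (fun x => `|G x|).
  by move=> y; apply: continuous_comp; [exact: cG|exact: norm_continuous].
have [c _ Hc] := @EVT_max R (fun x => `|G x|) 0 1 ler01 (continuous_subspaceT cN).
have qh2 : L2 mu (fun y => q.[y] * h y).
  have [_ wi] : L2 mu (fun y => `|G c| * `|w y|).
    apply: L2Z; split; first by apply: measurableT_comp => //; case: w2.
    by case: w2 => _; apply: eq_integrable => // y _ /=; rewrite real_normK ?num_real.
  apply: (@ae_le_L2 _ _ _ mu _ (fun y => `|G c| * `|w y|) mqh wi); apply: aeW => y.
  by rewrite qhE normrM ler_wpM2r// Hc// in_itv /= u01.
apply: (hermite_closure_limit qh2) => e e0.
have Q0 : 0 < nsq mu w + 1 by rewrite ltr_wpDl// nsq_ge0.
(* The uniform error gets multiplied by [w], so this tolerance makes its squared norm at most e; the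
   + 1 covers a null [w]. *)
have eQ : 0 < Num.sqrt (e / (nsq mu w + 1)) by rewrite sqrtr_gt0 divr_gt0.
have [B HB] := weierstrass cG eQ.
exists (fun y => B.[gsb 4^-1 y] * w y); first exact: hermite_closure_gauss_poly.
have Bw2 := hermite_closure_L2 (hermite_closure_gauss_poly B q).
have rw2 := L2Z (Num.sqrt (e / (nsq mu w + 1))) w2.
apply: (@le_trans _ _ (nsq mu (fun y => Num.sqrt (e / (nsq mu w + 1)) * w y))).
  apply: le_nsq => //; first exact: L2B.
  move=> y; rewrite qhE -mulrBl !normrM ler_wpM2r//.
  by rewrite (ger0_norm (ltW eQ)) HB.
rewrite nsqZ// sqr_sqrtr; last by rewrite divr_ge0// ltW.
rewrite mulrAC ler_pdivrMr// ler_wpM2l ?(ltW e0)// lerDl//.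
Qed.

Lemma compact_support_decay (f : R -> R) (M : R) : continuous f -> 0 <= M ->
  (forall y, M < `|y| -> f y = 0) -> exists C, forall y, `|f y| <= C * gsb 1 y.
Proof.
move=> cf M0 fM.
have cN : continuous (fun x => `|f x|).
  by move=> y; apply: continuous_comp; [exact: cf|exact: norm_continuous].
have MM : - M <= M by lra.
have [c _ Hc] := @EVT_max R (fun x => `|f x|) (- M) M MM (continuous_subspaceT cN).
exists (`|f c| * expR (M ^+ 2)) => y; have [yM|yM] := leP `|y| M; last first.
  by rewrite fM// normr0 mulr_ge0 ?gsb_ge0// mulr_ge0// expR_ge0.
have yy : y ^+ 2 <= M ^+ 2 by rewrite -[y ^+ 2]real_normK ?num_real// lerXn2r ?nnegrE.
apply: (@le_trans _ _ `|f c|); first by apply: Hc; rewrite in_itv /= -ler_norml.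
rewrite -mulrA ler_peMr// /gsb -expRD -[leLHS]expR0 ler_expR mul1r; lra.
Qed.

(** Functions of u are even, so the odd part is written as y times the even function fo(y) / y,
    regularised to fo(y) y / (y^2 + 1/(n+1)) for continuity at 0. *)
Lemma hermite_closure_compact (f : R -> R) (M : R) : continuous f -> 0 <= M ->
  (forall y, M < `|y| -> f y = 0) -> hermite_closure f.
Proof.
move=> cf M0 fM.
have cfN : continuous (fun y => f (- y)).
  by move=> y; apply: (@continuous_comp _ _ _ (-%R) f); [exact: opp_continuous|exact: cf].
pose fe y := 2^-1 * (f y + f (- y)); pose fo y := 2^-1 * (f y - f (- y)).
have cfe : continuous fe.
  by move=> y; apply: cvgM; [exact: cvg_cst|apply: cvgD; [exact: cf|exact: cfN]].
have cfo : continuous fo.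
  by move=> y; apply: cvgM; [exact: cvg_cst|apply: cvgB; [exact: cf|exact: cfN]].
have foM y : M < `|y| -> fo y = 0.
  by move=> yM; rewrite /fo !fM ?normrN// subrr mulr0.
have He : hermite_closure fe.
  have := @hermite_closure_even fe 1 M cfe; set A := hermite_closure _ => H.
  have : A by apply: H => // y; [rewrite /fe opprK addrC|move=> yM; rewrite /fe !fM ?normrN// addr0 mulr0].
  by rewrite /A; congr hermite_closure; apply/funext => y; rewrite hornerC mul1r.
have Ho : hermite_closure fo.
  pose F n y := 'X.[y] * (fo y * y / (y ^+ 2 + n.+1%:R^-1)).
  have d0 n y : 0 < y ^+ 2 + n.+1%:R^-1 :> R by rewrite ltr_wpDl// sqr_ge0.
  have HF n : hermite_closure (F n).
    apply: (@hermite_closure_even _ _ M) => //.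
    - move=> y; apply: cvgM; first by apply: cvgM; [exact: cfo|exact: cvg_id].
      apply: cvgV; first by rewrite gt_eqF.
      by apply: cvgD; [exact: exprn_continuous|exact: cvg_cst].
    - by move=> y; rewrite /fo opprK sqrrN; congr (_ / _); ring.
    - by move=> y yM; rewrite foM// !mul0r.
  have [fo2 Fo] : L2 mu fo /\ nsq mu (fun y => F n y - fo y) @[n --> \oo] --> (0 : R).
    have mfo : measurable_fun setT fo by exact: continuous_measurable_fun.
    have [|||||_ ? ?] := @dominated_nsq _ _ _ mu F fo (fun y => `|fo y|).
    - by move=> n; have [] := hermite_closure_L2 (HF n).
    - exact: mfo.
    - have [C HC] := compact_support_decay cfo M0 foM.
      have [_ +] : L2 mu (fun y => C * gsb 1 y).
        apply: L2Z; have := L2_horner_gsb 1 (ltr01 : 0 < 1 :> R).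
        by congr L2; apply/funext => y; rewrite hornerC mul1r.
      move=> Ci; have [] : L2 mu fo.
        by apply: (@ae_le_L2 _ _ _ mu _ (fun y => C * gsb 1 y) mfo Ci); apply: aeW => y; exact: HC.
      move=> _; by apply: eq_integrable => // y _ /=; rewrite real_normK ?num_real.
    - apply: aeW => y; rewrite /F hornerX; have [->|y0] := eqVneq y 0.
        have fo0 : fo 0 = 0 by rewrite /fo oppr0 subrr mulr0.
        by rewrite fo0; apply: cvg_near_cst; apply: nearW => n; rewrite mul0r.
      have -> : (fun n => y * (fo y * y / (y ^+ 2 + n.+1%:R^-1))) =
          (fun n => fo y * (y ^+ 2 * (y ^+ 2 + n.+1%:R^-1)^-1)).
        by apply/funext => n; ring.
      have y2 : y ^+ 2 != 0 by rewrite sqrf_eq0.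
      have H : y ^+ 2 * (y ^+ 2 + harmonic n)^-1 @[n --> \oo] --> y ^+ 2 * (y ^+ 2)^-1.
        apply: cvgM; first exact: cvg_cst.
        apply: cvgV => //; rewrite -[y ^+ 2 as Z in _ --> Z]addr0.
        by apply: cvgD; [exact: cvg_cst|exact: cvg_harmonic].
      rewrite mulfV// in H.
      by rewrite -[fo y as Z in _ --> Z]mulr1; apply: cvgM; [exact: cvg_cst|exact: H].
    - apply: aeW => y n; rewrite /F hornerX.
      have -> : y * (fo y * y / (y ^+ 2 + n.+1%:R^-1)) = fo y * (y ^+ 2 / (y ^+ 2 + n.+1%:R^-1)) by ring.
      rewrite normrM ler_piMr// ger0_norm; last by rewrite divr_ge0 ?sqr_ge0// ltW.
      by rewrite ler_pdivrMr// mul1r lerDl.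
    by [].
  exact: hermite_closure_cvg fo2 HF Fo.
have := hermite_closureD He Ho; congr hermite_closure.
by apply/funext => y; rewrite /fe /fo; field.
Qed.

End hermite_parseval.

Lemma continuous_comp_within (T U V : topologicalType) (A : set U) (g : T -> U) (f : U -> V) :
  continuous g -> (forall x, A (g x)) -> {within A, continuous f} -> continuous (f \o g).
Proof.
move=> cg Ag /subspace_continuousP fA x.
apply: (@cvg_comp _ _ _ g f _ (within A (nbhs (g x)))); last exact: fA.
move=> P; rewrite /within /= => HP.
apply: (@filterS _ (nbhs x) _ _ _ _ (cg x _ HP)) => y /= Hy; exact: (Hy (Ag y)).
Qed.

(** * Continuous occupation densities *)

Section riemann_sum.
Context (R : realType).
Notation mu := (@lebesgue_measure R).

Lemma continuous_integrable_itv (g : R -> R) (a b : R) (b0 b1 : bool) : continuous g ->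
  mu.-integrable [set` Interval (BSide b0 a) (BSide b1 b)] (EFin \o g).
Proof.
move=> cg; apply: (@integrableS _ _ _ mu `[a, b]%classic) => //.
  by move=> x /=; rewrite !in_itv /=; case: b0 b1 => [] [] /= /andP[h1 h2]; apply/andP; split=> //; exact: ltW.
apply: continuous_compact_integrable; first exact: segment_compact.
exact: continuous_subspaceT.
Qed.

(** Each cell contributes at most h w to the error. *)
Lemma riemann_sum_error (g : R -> R) (h w : R) n : continuous g -> 0 <= h ->
  (forall r s, 0 <= r <= n%:R * h -> 0 <= s <= n%:R * h -> `|r - s| <= h -> `|g r - g s| <= w) ->
  `|h * (\sum_(i < n) g (i%:R * h)) - \int[mu]_(s in `[0, n%:R * h]) g s| <= n%:R * h * w.
Proof.
move=> cg h0; elim: n => [|n IHn] gw.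
  by rewrite big_ord0 mul0r set_itv1 Rintegral_set1 mulr0 subr0 mul0r normr0.
have nh : n%:R * h <= n.+1%:R * h by rewrite ler_wpM2r// ler_nat.
have nh0 : 0 <= n%:R * h by rewrite mulr_ge0.
have {}IHn : `|h * (\sum_(i < n) g (i%:R * h)) - \int[mu]_(s in `[0, n%:R * h]) g s| <= n%:R * h * w.
  apply: IHn => r s /andP[r0 rn] /andP[s0 sn]; apply: gw.
    by rewrite r0 (le_trans rn).
  by rewrite s0 (le_trans sn).
have E := @Rintegral_itvB R g (BLeft 0) (BRight (n.+1%:R * h)) (n%:R * h)
  (continuous_integrable_itv _ _ _ _ cg).
have {}E : \int[mu]_(s in `[0, n.+1%:R * h]) g s =
  \int[mu]_(s in `[0, n%:R * h]) g s + \int[mu]_(s in `]n%:R * h, n.+1%:R * h]) g s.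
  by rewrite -E ?bnd_simp//; ring.
have muJ : mu `]n%:R * h, n.+1%:R * h] = h%:E.
  rewrite lebesgue_measure_itv /= lte_fin; case: ltP => H.
    by rewrite -EFinB -natr1; congr EFin; ring.
  suff -> : h = 0 by [].
  by apply/eqP; rewrite eq_le h0 andbT -natr1 mulrDl mul1r -subr_ge0 in H *; lra.
have Ic (c : R) : \int[mu]_(s in `]n%:R * h, n.+1%:R * h]) c = c * h.
  by rewrite Rintegral_cst//; congr (_ * _); exact: (congr1 fine muJ).
have cst_i (c : R) : mu.-integrable `]n%:R * h, n.+1%:R * h] (EFin \o (fun=> c)).
  by apply: continuous_integrable_itv => x; exact: cvg_cst.
have step : `|h * g (n%:R * h) - \int[mu]_(s in `]n%:R * h, n.+1%:R * h]) g s| <= h * w.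
  rewrite [h * g _]mulrC -(Ic (g (n%:R * h))) -RintegralB//; last exact: continuous_integrable_itv.
  apply: le_trans (le_normr_Rintegral _ _) _ => //.
    by apply: continuous_integrable_itv => x; apply: cvgB; [exact: cvg_cst|exact: cg].
  rewrite [leRHS]mulrC -(Ic w); apply: le_Rintegral => //.
    apply: (@continuous_integrable_itv (fun s => `|g (n%:R * h) - g s|)) => x.
    by apply: cvg_norm; apply: cvgB; [exact: cvg_cst|exact: cg].
  move=> s /=; rewrite in_itv /= => /andP[s1 s2]; apply: gw.
  - by rewrite nh0.
  - by rewrite (le_trans nh0 (ltW s1)).
  - by rewrite distrC ger0_norm ?subr_ge0 ?(ltW s1)// lerBlDl (le_trans s2)// -natr1; lra.
rewrite big_ord_recr /= E mulrDr.
apply: le_trans (_ : n%:R * h * w + h * w <= _); last first.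
  by rewrite le_eqVlt; apply/orP; left; apply/eqP; rewrite -natr1; ring.
by apply: le_trans (lerD IHn step); rewrite opprD addrACA ler_normD.
Qed.

End riemann_sum.

Section hat.
Context (R : realType).

(* A Lipschitz kernel of mass 2: it dominates a uniform kernel of mass 1, and an upper
   bound of the local time by its averages is all that the moment estimate needs. *)
Definition hat n (x : R) : R := n.+1%:R * Num.max 0 (2 - 2 * n.+1%:R * `|x|).

Lemma hat_ge0 n x : 0 <= hat n x.
Proof. by rewrite mulr_ge0// le_max lexx. Qed.

Lemma hat_le n x : hat n x <= 2 * n.+1%:R * (`|x| < n.+1%:R^-1)%R%:R.
Proof.
rewrite /hat; case: ltP => /= H.
  rewrite mulr1 mulrC ler_wpM2r// ge_max ler0n /= gerBl mulr_ge0// mulr_ge0//.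
rewrite mulr0 max_l ?mulr0// subr_le0 -mulrA ler_peMr// mulrC.
by rewrite -ler_pdivrMr// div1r.
Qed.

Lemma normr_hat_le n x : `|hat n x| <= 2 * n.+1%:R.
Proof.
rewrite ger0_norm ?hat_ge0//; apply: le_trans (hat_le _ _) _.
by rewrite ler_piMr ?mulr_ge0//; case: (_ < _).
Qed.

Lemma hat_ge n x : `|x| <= (2 * n.+1%:R)^-1 -> n.+1%:R <= hat n x.
Proof.
move=> H; rewrite /hat ler_peMr// le_max; apply/orP; right.
have : 2 * n.+1%:R * `|x| <= 1 by rewrite mulrC -ler_pdivlMr ?div1r// mulr_gt0.
by lra.
Qed.

Lemma hat_lipschitz n x y : `|hat n x - hat n y| <= 2 * n.+1%:R ^+ 2 * `|x - y|.
Proof.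
have -> : 2 * n.+1%:R ^+ 2 * `|x - y| = n.+1%:R * (2 * n.+1%:R * `|x - y|) by ring.
rewrite /hat -mulrBr normrM ger0_norm// ler_wpM2l//.
set p := 2 * _ * `|x|; set q := 2 * _ * `|y|.
have pq : `|p - q| <= 2 * n.+1%:R * `|x - y|.
  rewrite /p /q -mulrBr normrM ger0_norm ?mulr_ge0// ler_wpM2l ?mulr_ge0//.
  exact: ler_dist_dist.
apply: le_trans pq; have [h|h] := leP 0 (2 - p); have [h'|h'] := leP 0 (2 - q).
- by rewrite (_ : 2 - p - (2 - q) = q - p); [rewrite distrC|ring].
- by rewrite subr0 ger0_norm// ler0_norm; lra.
- by rewrite sub0r normrN ger0_norm// ger0_norm; lra.
- by rewrite subr0 normr0.
Qed.

Lemma continuous_hat n y : continuous (fun x => hat n (x - y)).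
Proof.
have LN : 0 < 2 * n.+1%:R ^+ 2 :> R by rewrite mulr_gt0// exprn_gt0.
move=> x; apply/cvgrPdist_le => e e0; near=> z.
apply: le_trans (hat_lipschitz _ _ _) _.
rewrite (_ : x - y - (z - y) = x - z); last by ring.
rewrite mulrC -ler_pdivlMr//; near: z.
by apply: cvgr_dist_le; [exact: cvg_id|rewrite divr_gt0].
Unshelve. all: by end_near. Qed.

End hat.

Section occupation_density.
Context (R : realType).
Notation mu := (@lebesgue_measure R).
Variables (Tm t : R) (b l : R -> R).
Hypothesis t_ge0 : 0 <= t.
Hypothesis t_leT : t <= Tm.
Hypothesis b_cont : {within `[0, Tm], continuous b}.
Hypothesis l_cont : continuous l.
Hypothesis l_occ : forall A : set R, measurable A ->
  mu (`[0, t]%classic `&` [set s | A (b s)]) = (\int[mu]_(a in A) (l a)%:E)%E.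

(* Freezing the path outside [0, t] makes it continuous on the whole line. *)
Definition frozen (s : R) : measurableTypeR R := b (Num.max 0 (Num.min s t)).

Lemma frozenE s : 0 <= s <= t -> frozen s = b s.
Proof. by move=> /andP[s0 st]; rewrite /frozen min_l// max_r. Qed.

Lemma continuous_frozen : continuous (frozen : R -> R).
Proof.
apply: (@continuous_comp_within _ _ _ `[0, Tm]%classic (fun s : R => Num.max 0 (Num.min s t)) b) => //.
  have -> : (fun s : R => Num.max 0 (Num.min s t)) =
    (cst 0 : R -> R^o) \max ((id : R -> R^o) \min (cst t : R -> R^o)) by [].
  move=> s; apply: continuous_max; first exact: cvg_cst.
  by apply: continuous_min; [exact: cvg_id|exact: cvg_cst].
move=> s /=; rewrite in_itv /= le_max lexx /= ge_max (le_trans t_ge0 t_leT) /=.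
by have [st|st] := leP s t; [exact: le_trans t_leT|].
Qed.

Lemma measurable_frozen : measurable_fun setT (frozen : R -> measurableTypeR R).
Proof. by apply: continuous_measurable_fun; exact: continuous_frozen. Qed.

Let D : set (measurableTypeR R) := `[0, t]%classic.

Let mD : measurable D. Proof. exact: measurable_itv. Qed.

Lemma frozen_occ (A : set R) : measurable A ->
  push_measure (mrestr mu mD) measurable_frozen A = (\int[mu]_(a in A) (l a)%:E)%E.
Proof.
move=> mA; rewrite -l_occ// /push_measure /= /pushforward /mrestr /=; congr (lebesgue_measure _).
apply/seteqP; split => s /=.
  by move=> [As Ds]; split=> //; move: Ds; rewrite /D /= in_itv /= => /frozenE <-.
by move=> [Ds As]; split=> //; rewrite frozenE//; move: Ds; rewrite in_itv.
Qed.

Lemma ball_itv (a r : R) : ball a r = `]a - r, a + r[%classic.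
Proof.
apply/seteqP; split => x; rewrite /ball /= in_itv /= ltr_distlC.
  by [].
by [].
Qed.

(** By continuity a negative value would produce an interval of negative occupation measure. *)
Lemma density_ge0 a : 0 <= l a.
Proof.
rewrite leNgt; apply/negP => la.
have c0 : 0 < - l a / 2 by lra.
have /cvgrPdist_lt /(_ _ c0) [r /= r0 Hr] : l x @[x --> a] --> l a by exact: l_cont.
pose J : set (measurableTypeR R) := `]a - r, a + r[%classic.
have mJ : measurable J by exact: measurable_itv.
have Jl x : J x -> l x <= l a / 2.
  rewrite /J -ball_itv => /Hr; rewrite ltr_norml => /andP[h1 h2]; lra.
have : (0 <= \int[mu]_(x in J) (l x)%:E)%E by rewrite -(frozen_occ mJ); exact: measure_ge0.
rewrite leNgt => /negP; apply.
have : (0 < \int[mu]_(x in J) (- l x)%:E)%E.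
  apply: (@lt_le_trans _ _ (\int[mu]_(x in J) (- l a / 2)%:E)%E).
    rewrite integral_cst//= /J lebesgue_measure_itv /= lte_fin ltrD2l gtrN//.
    by rewrite -EFinB -EFinM lte_fin mulr_gt0//; lra.
  apply: ge0_le_integral => //.
  - by move=> x _; rewrite lee_fin ltW.
  - apply/measurable_funTS/measurable_EFinP; apply: measurableT_comp => //.
    exact: continuous_measurable_fun.
  - by move=> x Jx; rewrite lee_fin; have := Jl x Jx; lra.
have -> : (\int[mu]_(x in J) (l x)%:E = - \int[mu]_(x in J) (- l x)%:E)%E.
  rewrite -integral_ge0N; last by move=> x Jx; rewrite lee_fin; have := Jl x Jx; lra.
  by apply: eq_integral => x _; rewrite EFinN oppeK.
by rewrite oppe_lt0.
Qed.

Lemma frozen_bounded : exists2 M, 0 <= M & forall s, `|frozen s| <= M.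
Proof.
have cN : continuous (fun s => `|frozen s|).
  by move=> s; apply: continuous_comp; [exact: continuous_frozen|exact: norm_continuous].
have [c _ Hc] := @EVT_max R (fun s => `|frozen s|) 0 t t_ge0 (continuous_subspaceT cN).
exists `|frozen c| => // s.
have -> : frozen s = frozen (Num.max 0 (Num.min s t)).
  rewrite [RHS]frozenE// le_max lexx /= ge_max t_ge0 /=.
  by have [st|st] := leP s t.
apply: Hc; rewrite in_itv /= le_max lexx /= ge_max t_ge0 /=.
by have [st|st] := leP s t.
Qed.

(** The path is bounded, so levels beyond its bound are never occupied; continuity turns the missing
    mass into a vanishing density. *)
Lemma density_support : exists2 M, 0 <= M & forall a, M < `|a| -> l a = 0.
Proof.
have [M M0 HM] := frozen_bounded; exists M => // a Ma.
apply/eqP; rewrite eq_le density_ge0 andbT leNgt; apply/negP => la.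
have c0 : 0 < l a / 2 by lra.
have /cvgrPdist_lt /(_ _ c0) [r /= r0 Hr] : l x @[x --> a] --> l a by exact: l_cont.
(* The second bound keeps the interval around a outside the range of the path. *)
pose r' := Num.min r (`|a| - M).
have r'0 : 0 < r' by rewrite lt_min r0 subr_gt0.
pose J : set (measurableTypeR R) := `]a - r', a + r'[%classic.
have mJ : measurable J by exact: measurable_itv.
have Jb x : J x -> `|a - x| < r'.
  by rewrite /J -ball_itv.
have Jl x : J x -> l a / 2 <= l x.
  move=> /Jb; rewrite lt_min => /andP[/Hr + _].
  by rewrite ltr_norml => /andP[h1 h2]; lra.
have : (0 < \int[mu]_(x in J) (l x)%:E)%E.
  apply: (@lt_le_trans _ _ (\int[mu]_(x in J) (l a / 2)%:E)%E).
    rewrite integral_cst//= /J lebesgue_measure_itv /= lte_fin ltrD2l gtrN//.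
    by rewrite -EFinB -EFinM lte_fin mulr_gt0//; lra.
  apply: ge0_le_integral => //.
  - by move=> x _; rewrite lee_fin ltW.
  - apply/measurable_funTS/measurable_EFinP.
    exact: continuous_measurable_fun.
rewrite -(frozen_occ mJ) /push_measure /= /pushforward /mrestr.
suff -> : frozen @^-1` J `&` D = set0 by rewrite measure0 ltxx.
apply/seteqP; split => // s [/Jb + _]; rewrite lt_min => /andP[_].
have := HM s.
have := lerB_dist a (frozen s); lra.
Qed.


Lemma ge0_occupation_formula (f : R -> R) : measurable_fun setT f -> (forall x, 0 <= f x) ->
  (\int[mu]_(s in `[0%R, t]) (f (b s))%:E = \int[mu]_a (f a * l a)%:E)%E.
Proof.
move=> mf f0; pose nu := push_measure (mrestr mu mD) measurable_frozen.
transitivity (\int[nu]_a (f a)%:E)%E; last first.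
  under [RHS]eq_integral do rewrite EFinM.
  apply: ge0_integral_density.
  - exact: continuous_measurable_fun.
  - exact: density_ge0.
  - exact/measurable_EFinP.
  - by move=> x; rewrite lee_fin.
  - exact: frozen_occ.
rewrite ge0_integral_pushforward//; last first.
- by move=> x _; rewrite lee_fin.
- exact/measurable_EFinP.
- exact: measurable_frozen.
rewrite preimage_setT.
under eq_integral do rewrite /=.
rewrite (@ge0_integral_density _ _ _ mu (mrestr mu mD) (\1_D)) //.
- rewrite [LHS]integral_mkcond; apply: eq_integral => s _.
  rewrite /patch /= indicE; case: ifPn => [sD|sD]; last by rewrite mule0.
  rewrite mule1 frozenE//.
  by move: sD; rewrite inE /D /= in_itv.
- by apply/measurable_EFinP; apply: measurableT_comp => //; exact: measurable_frozen.
- by move=> x; rewrite lee_fin.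
- by move=> A mA; rewrite integral_indic// setIC.
Qed.

Let mu_D : mu D = t%:E.
Proof.
have := lebesgue_measure_itv `[0, t]%R; rewrite /D => ->; rewrite /= lte_fin -EFinB subr0.
by case: ltP => // t0; congr EFin; apply/eqP; rewrite eq_le t0 t_ge0.
Qed.

Let mu_D_lty : (mu D < +oo)%E. Proof. by rewrite mu_D ltry. Qed.

Lemma measurable_path : measurable_fun D b.
Proof.
apply: (@eq_measurable_fun _ _ _ _ D frozen); last first.
  by apply: measurable_funTS; exact: measurable_frozen.
by move=> s; rewrite inE /D /= in_itv /= => sD; rewrite frozenE.
Qed.

Lemma density_integral : \int[mu]_a l a = t.
Proof.
have := l_occ measurableT; rewrite (_ : [set s | setT (b s)] = setT)// setIT.
rewrite lebesgue_measure_itv /= /Rintegral => <-.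
rewrite lte_fin; have [t0|t0] := ltP 0 t; first by rewrite -EFinB subr0.
by have -> : t = 0 by apply/eqP; rewrite eq_le t0 t_ge0.
Qed.

Lemma density_integrable : mu.-integrable setT (EFin \o l).
Proof.
apply/integrableP; split; first by apply/measurable_EFinP; exact: continuous_measurable_fun.
have := l_occ measurableT; rewrite (_ : [set s | setT (b s)] = setT)// setIT.
have -> : (\int[mu]_x `|(EFin \o l) x| = \int[mu]_x (l x)%:E)%E.
  by apply: eq_integral => x _ /=; rewrite ger0_norm// density_ge0.
move=> <-; rewrite lebesgue_measure_itv /=; case: ifP => _; rewrite ?ltry//.
Qed.

Let path_integrable (f : R -> R) (C : R) : measurable_fun setT f -> (forall x, `|f x| <= C) ->
  mu.-integrable D (EFin \o (fun s => f (b s))).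
Proof.
move=> mf fC; apply: measurable_bounded_integrable => //.
- by apply: (@measurable_comp _ _ _ _ _ _ setT) => //; exact: measurable_path.
- exists C; split; first exact: num_real.
  by move=> M CM s _ /=; rewrite (le_trans (fC _))// ltW.
Qed.

Let integral_cst_D (C : R) : \int[mu]_(s in D) C = C * t.
Proof.
rewrite (_ : \int[mu]_(s in D) C = \int[mu]_(s in D) cst C s)//.
by rewrite Rintegral_cst//; congr (_ * _); exact: (congr1 fine mu_D).
Qed.

(** Adding C to [f] reduces to the nonnegative case; the total mass t of [l] makes both sides grow
    by C t. *)
Lemma occupation_formula (f : R -> R) (C : R) : measurable_fun setT f -> (forall x, `|f x| <= C) ->
  \int[mu]_(s in `[0, t]) f (b s) = ip mu f l.
Proof.
move=> mf fC.
have mg : measurable_fun setT (fun x => f x + C) by apply: measurable_funD.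
have g0 x : 0 <= f x + C by have := fC x; rewrite ler_norml => /andP[]; lra.
have := ge0_occupation_formula mg g0.
have if_ : mu.-integrable setT (EFin \o (fun x => f x * l x)).
  apply: (le_integrable measurableT _ _ (integrableZl measurableT C density_integrable)).
  - by apply/measurable_EFinP; apply: measurable_funM => //; exact: continuous_measurable_fun.
  - move=> x _ /=; rewrite lee_fin normrM normrM ler_wpM2r//.
    by rewrite (le_trans (fC x))// ler_norm.
have iD : mu.-integrable D (EFin \o (fun s => f (b s))).
  exact: path_integrable fC.
have iC : mu.-integrable D (EFin \o (fun s : R => C)).
  apply: measurable_bounded_integrable => //.
  by exists `|C|; split=> [|M CM s _ /=]; [exact: num_real|exact: ltW].
move=> /(congr1 fine).
rewrite -/(Rintegral _ _ _) -/(Rintegral _ _ _) => H.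
have : \int[mu]_(s in D) (f (b s) + C) = \int[mu]_s ((f s + C) * l s) by exact: H.
rewrite RintegralD//.
under [RHS]eq_Rintegral do rewrite mulrDl.
rewrite RintegralD//; last exact: (integrableZl measurableT C density_integrable).
rewrite RintegralZl//; last exact: density_integrable.
rewrite integral_cst_D.
by rewrite density_integral => /addIr.
Qed.

Lemma frozen_modulus (d : R) : 0 < d -> \forall m \near \oo,
  forall r s, 0 <= r <= t -> 0 <= s <= t -> `|r - s| <= t / m.+1%:R -> `|frozen r - frozen s| <= d.
Proof.
move=> d0; have [r r0 Hr] := unif_continuous_itv 0 t continuous_frozen d0.
have H : t / m.+1%:R @[m --> \oo] --> (0 : R).
  rewrite -[0 as Z in _ --> Z](mulr0 t); apply: cvgMr; exact: cvg_harmonic.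
near=> m => u v u0 v0 uv; apply: Hr => //; apply: le_lt_trans uv _.
near: m; exact: (cvgr_lt _ H).
Unshelve. all: by end_near. Qed.

Lemma sampled_integral (g : R -> R) (w : R) m :
  continuous g ->
  (forall r s, 0 <= r <= t -> 0 <= s <= t -> `|r - s| <= t / m.+1%:R ->
    `|g (frozen r) - g (frozen s)| <= w) ->
  `|t / m.+1%:R * (\sum_(i < m.+1) g (b (i%:R * (t / m.+1%:R))))
    - \int[mu]_(s in `[0, t]) g (b s)| <= t * w.
Proof.
move=> cg gw; have h0 : 0 <= t / m.+1%:R by rewrite divr_ge0.
have mh : m.+1%:R * (t / m.+1%:R) = t by rewrite mulrC divfK.
have cgf : continuous (fun s => g (frozen s)).
  by move=> s; apply: continuous_comp; [exact: continuous_frozen|exact: cg].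
have := @riemann_sum_error R (fun s => g (frozen s)) (t / m.+1%:R) w m.+1 cgf h0.
rewrite mh => /(_ gw).
have -> : \int[mu]_(s in `[0, t]) g (frozen s) = \int[mu]_(s in `[0, t]) g (b s).
  by apply: eq_Rintegral => s; rewrite inE /= in_itv /= => H; rewrite frozenE.
congr (`|_ * _ - _| <= _); apply: eq_bigr => i _; rewrite frozenE//.
by rewrite mulr_ge0//= -[leRHS]mh ler_wpM2r// ler_nat ltnW.
Qed.

Lemma cvg_sampled_integral (g : R -> R) : continuous g ->
  t / m.+1%:R * (\sum_(i < m.+1) g (b (i%:R * (t / m.+1%:R)))) @[m --> \oo] -->
  \int[mu]_(s in `[0, t]) g (b s).
Proof.
move=> cg; have [M M0 HM] := frozen_bounded.
apply/cvgrPdist_le => e e0.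
have t1 : 0 < t + 1 by have := t_ge0; lra.
have e'0 : 0 < e / (t + 1) by rewrite divr_gt0.
have [r r0 Hr] := unif_continuous_itv (- M) M cg e'0.
have r20 : 0 < r / 2 by lra.
near=> m; rewrite distrC.
apply: le_trans (_ : t * (e / (t + 1)) <= _); last first.
  rewrite mulrCA ler_piMr ?(ltW e0)// ler_pdivrMr// mul1r; lra.
apply: sampled_integral => // u v u0 v0 uv; apply: Hr.
- by have := HM u; rewrite ler_norml.
- by have := HM v; rewrite ler_norml.
apply: (@le_lt_trans _ _ (r / 2)); last by lra.
move: u v u0 v0 uv; near: m; exact: frozen_modulus.
Unshelve. all: by end_near. Qed.

Definition self_intersection n m : R :=
  (t / m.+1%:R) ^+ 2 * \sum_(k < m.+1) \sum_(j < m.+1)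
    hat n (b (j%:R * (t / m.+1%:R)) - b (k%:R * (t / m.+1%:R))).

(** The kernel is at least n + 1 on an interval of length 1/(n + 1) around y, where uniform
    continuity keeps [l] above [l y - w]; elsewhere the integrand is nonnegative. *)
Lemma hat_average w : 0 < w -> \forall n \near \oo, forall y, l y - w <= ip mu (fun a => hat n (a - y)) l.
Proof.
move=> w0; have [M M0 HM] := density_support.
have [r r0 Hr] := unif_continuous_itv (- (M + 1)) (M + 1) l_cont w0.
have lw u v : `|u - v| < Num.min r 1 -> `|l u - l v| <= w.
  rewrite lt_min => /andP[uvr uv1].
  have [uM|uM] := leP `|u| (M + 1); last first.
    rewrite !HM ?subrr ?normr0 ?ltW//; last by lra.
    by have := lerB_dist u v; lra.
  have [vM|vM] := leP `|v| (M + 1); last first.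
    rewrite !HM ?subrr ?normr0 ?ltW//; first by lra.
    by have := lerB_dist v u; rewrite distrC; lra.
  by apply: Hr => //; rewrite -ler_norml.
near=> n => y.
set c := l y - w; set N : R := n.+1%:R.
have N0 : 0 < N by rewrite ltr0n.
have f0 a : 0 <= hat n (a - y) * l a by rewrite mulr_ge0// ?hat_ge0// density_ge0.
have mhat : measurable_fun setT (fun a : R => hat n (a - y)).
  by apply: continuous_measurable_fun; exact: continuous_hat.
have mf : measurable_fun setT (fun a : R => hat n (a - y) * l a).
  by apply: measurable_funM => //; exact: continuous_measurable_fun.
have [c0|c0] := leP c 0; first by apply: le_trans c0 _; apply: Rintegral_ge0.
pose J : set (measurableTypeR R) := `[y - (2 * N)^-1, y + (2 * N)^-1]%classic.
have mJ : measurable J by exact: measurable_itv.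
have muJ : mu J = (N^-1)%:E.
  rewrite /J; have := lebesgue_measure_itv `[y - (2 * N)^-1, y + (2 * N)^-1]%R => ->.
  rewrite /= lte_fin ltrBlDr -addrA ltrDl addr_gt0 ?invr_gt0 ?mulr_gt0// -EFinB.
  by congr EFin; field; rewrite gt_eqF.
have fin : mu.-integrable setT (EFin \o (fun a => hat n (a - y) * l a)).
  apply: (le_integrable measurableT _ _ (integrableZl measurableT (2 * N) density_integrable)).
  - exact/measurable_EFinP.
  - move=> x _ /=; rewrite lee_fin normrM [leRHS]normrM ler_wpM2r//.
    rewrite [leRHS]ger0_norm; last by rewrite mulr_ge0// ltW.
    exact: normr_hat_le.
have HJ (a : R) : y - (2 * N)^-1 <= a <= y + (2 * N)^-1 -> N * c <= hat n (a - y) * l a.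
  move=> /andP[a1 a2].
  have ay : `|a - y| <= (2 * N)^-1 by rewrite ler_distl a1 a2.
  apply: ler_pM; [exact: ltW|exact: ltW|exact: hat_ge|].
  suff : `|l y - l a| <= w by rewrite ler_norml /c => /andP[_]; lra.
  apply: lw; rewrite distrC; apply: le_lt_trans ay _.
  apply: (@le_lt_trans _ _ N^-1); first by rewrite lef_pV2 ?posrE ?mulr_gt0// ler_peMl ?ltW//; lra.
  rewrite /N; near: n; apply: (cvgr_lt _ cvg_harmonic); rewrite lt_min r0; exact: ltr01.
rewrite /ip -lee_fin /Rintegral fineK; last exact: integrable_fin_num.
apply: (@le_trans _ _ (\int[mu]_(a in J) (N * c)%:E)%E).
  rewrite integral_cst//= [X in (_ * X)%E](_ : _ = (N^-1)%:E)// -EFinM lee_fin.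
  by rewrite mulrAC mulfV ?mul1r// gt_eqF.
apply: (@le_trans _ _ (\int[mu]_(a in J) (hat n (a - y) * l a)%:E)%E); last first.
  apply: ge0_subset_integral => //; first exact/measurable_EFinP.
  by move=> a _; rewrite lee_fin.
apply: ge0_le_integral => //.
- by move=> a _; rewrite lee_fin mulr_ge0// ltW.
- by apply: measurable_funTS; exact/measurable_EFinP.
Unshelve. all: by end_near. Qed.

(** The occupation formula writes [nsq mu l] as the time integral of l(b_s), and l is at most its
    kernel average F plus an error; F is again a time integral. Both are replaced by grid sums, with
    m chosen after n because the Lipschitz constant of the kernel grows like n^2. *)
Lemma self_intersection_lower e : 0 < e ->
  \forall n \near \oo, \forall m \near \oo, nsq mu l <= self_intersection n m + e.
Proof.
move=> e0; have t1 : 0 < t + 1 by have := t_ge0; lra.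
have w0 : 0 < e / 2 / (t + 1) by rewrite !divr_gt0.
near=> n; have Hn : forall y, l y - e / 2 / (t + 1) <= ip mu (fun a => hat n (a - y)) l.
  by near: n; exact: hat_average.
pose F y := \int[mu]_(s in `[0, t]) hat n (b s - y).
have hatC := @normr_hat_le R n.
have mhat y : measurable_fun setT (fun a : R => hat n (a - y)).
  by apply: continuous_measurable_fun; exact: continuous_hat.
have FE y : F y = ip mu (fun a => hat n (a - y)) l.
  by rewrite /F; apply: (@occupation_formula (fun a => hat n (a - y))).
pose LN : R := 2 * n.+1%:R ^+ 2.
have LN0 : 0 < LN by rewrite mulr_gt0// exprn_gt0.
have K0 : 0 < 2 * t * LN * (t + 1) + 1 by have := t_ge0; have := mulr_ge0 (mulr_ge0 t_ge0 (ltW LN0)) (ltW t1); nra.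
(* The inner and the outer sum each cost t t LN w, together at most e / 2; the + 1 in the
   denominators covers t = 0. *)
pose w := e / 2 / (2 * t * LN * (t + 1) + 1).
have w00 : 0 < w by rewrite !divr_gt0.
near=> m.
have Hm : forall r s, 0 <= r <= t -> 0 <= s <= t -> `|r - s| <= t / m.+1%:R ->
    `|frozen r - frozen s| <= w.
  by near: m; exact: frozen_modulus.
have FL y y' : `|F y - F y'| <= t * (LN * `|y - y'|).
  have hL (z : R) : `|hat n (z - y) - hat n (z - y')| <= LN * `|y - y'|.
    apply: le_trans (hat_lipschitz _ _ _) _.
    by rewrite (_ : z - y - (z - y') = y' - y) 1?distrC//; ring.
  rewrite /F -RintegralB//; [|exact: (path_integrable (mhat y))|exact: (path_integrable (mhat y'))].
  apply: le_trans (le_normr_Rintegral _ _) _ => //.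
    apply: (@path_integrable (fun z => hat n (z - y) - hat n (z - y')) (2 * n.+1%:R + 2 * n.+1%:R)).
      exact: measurable_funB.
    by move=> z; exact: le_trans (ler_normB _ _) (lerD (hatC _) (hatC _)).
  rewrite mulrC -(integral_cst_D (LN * `|y - y'|)); apply: le_Rintegral => //.
  - apply: (@path_integrable (fun z => `|hat n (z - y) - hat n (z - y')|) (2 * n.+1%:R + 2 * n.+1%:R)).
      by apply: measurableT_comp => //; apply: measurable_funB.
    by move=> z; rewrite normr_id (le_trans (ler_normB _ _))// lerD.
  - by apply: (@path_integrable (fun=> LN * `|y - y'|) (`|LN * `|y - y'| |)).
have cF : continuous F.
  move=> y; apply/cvgrPdist_le => d d0.
  have K : 0 < t * LN + 1 by have := mulr_ge0 t_ge0 (ltW LN0); lra.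
  near=> z; apply: le_trans (FL _ _) _.
  apply: (@le_trans _ _ ((t * LN + 1) * `|y - z|)).
    by rewrite mulrA ler_wpM2r// lerDl.
  rewrite mulrC -ler_pdivlMr//; near: z.
  by apply: cvgr_dist_le; [exact: cvg_id|rewrite divr_gt0].
have F_ge y : l y <= F y + e / 2 / (t + 1) by rewrite FE; have := Hn y; lra.
have Hsum y : `|t / m.+1%:R * (\sum_(j < m.+1) hat n (b (j%:R * (t / m.+1%:R)) - y)) - F y| <= t * (LN * w).
  apply: (@sampled_integral (fun a => hat n (a - y))); first exact: continuous_hat.
  move=> r s r0 s0 rs; apply: le_trans (hat_lipschitz _ _ _) _.
  rewrite ler_wpM2l ?(ltW LN0)//; rewrite (_ : _ - _ - _ = frozen r - frozen s); last by ring.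
  exact: Hm.
have HF : `|t / m.+1%:R * (\sum_(k < m.+1) F (b (k%:R * (t / m.+1%:R))))
    - \int[mu]_(s in `[0, t]) F (b s)| <= t * (t * (LN * w)).
  apply: sampled_integral => // r s r0 s0 rs; apply: le_trans (FL _ _) _.
  by rewrite !ler_wpM2l ?(ltW LN0)// Hm.
have [M M0 HM] := density_support.
have [C HC] := compact_support_decay l_cont M0 HM.
have lC y : `|l y| <= `|C|.
  apply: le_trans (HC y) _; rewrite (le_trans (ler_norm _))// normrM ler_piMr//.
  by rewrite ger0_norm ?gsb_ge0// gsb_le1.
have ml : measurable_fun setT l by exact: continuous_measurable_fun.
have [B HB] : exists B, forall y, `|F y| <= B.
  exists (t * (2 * n.+1%:R)) => y; rewrite /F; apply: le_trans (le_normr_Rintegral _ _) _ => //.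
    exact: (path_integrable (mhat y)).
  rewrite mulrC -(integral_cst_D (2 * n.+1%:R)); apply: le_Rintegral => //.
  - apply: (@path_integrable (fun z => `|hat n (z - y)|) (2 * n.+1%:R)).
      exact: measurableT_comp.
    by move=> z; rewrite normr_id.
  - by apply: (@path_integrable (fun=> 2 * n.+1%:R) `|2 * n.+1%:R|).
have mF : measurable_fun setT F by exact: continuous_measurable_fun.
set c := e / 2 / (t + 1) in F_ge.
have lF : nsq mu l <= \int[mu]_(s in `[0, t]) F (b s) + t * c.
  rewrite /nsq -(occupation_formula ml lC) [t * c]mulrC -(integral_cst_D c) -RintegralD//.
  - apply: le_Rintegral => //.
    + exact: (path_integrable ml lC).
    + apply: (@path_integrable (fun z => F z + c) (B + `|c|)); first exact: measurable_funD.
      by move=> z; rewrite (le_trans (ler_normD _ _))// lerD.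
  - exact: (path_integrable mF HB).
  - by apply: (@path_integrable (fun=> c) `|c|).
have tc : t * c <= e / 2.
  rewrite /c mulrCA ler_piMr//; first by lra.
  by rewrite ler_pdivrMr// mul1r; lra.
have tw : 2 * (t * (t * (LN * w))) <= e / 2.
  have -> : 2 * (t * (t * (LN * w))) = e / 2 * ((2 * t * LN * t) / (2 * t * LN * (t + 1) + 1)).
    by rewrite /w; field; rewrite gt_eqF.
  rewrite ler_piMr//; first by lra.
  by rewrite ler_pdivrMr// mul1r mulrDr mulr1; have := mulr_ge0 t_ge0 (ltW LN0); lra.
have self : t / m.+1%:R * (\sum_(k < m.+1) F (b (k%:R * (t / m.+1%:R)))) <=
    self_intersection n m + t * (t * (LN * w)).
  rewrite /self_intersection expr2 -[X in _ <= X + _]mulrA.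
  have -> : t * (t * (LN * w)) = t / m.+1%:R * \sum_(k < m.+1) (t * (LN * w)).
    by rewrite sumr_const card_ord -[X in _ = _ * X]mulr_natl; field.
  rewrite -mulrDr ler_wpM2l ?divr_ge0// mulr_sumr -big_split /=.
  apply: ler_sum => k _.
  by have := Hsum (b (k%:R * (t / m.+1%:R))); rewrite distrC ler_norml lerBlDl => /andP[].
move: HF; rewrite distrC ler_norml lerBlDl => /andP[_ HF].
apply: le_trans lF _; apply: le_trans (lerD (le_trans HF (lerD self (lexx _))) tc) _.
by move: tw; set z := t * (t * (LN * w)) => tw; rewrite -!addrA lerD2l; lra.
Unshelve. all: by end_near. Qed.

End occupation_density.

(** * The second moment of the self-intersection local time *)

Section fatou2.
Context (R : realType).

Lemma limn_einf_le (u : (\bar R)^nat) c : (\forall n \near \oo, (u n <= c)%E) -> (limn_einf u <= c)%E.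
Proof.
move=> Hu; rewrite limn_einf_lim; apply: lime_le; first exact: is_cvg_einfs.
near=> n; apply: le_trans (_ : (u n <= c)%E); last by near: n.
by apply: ereal_inf_lbound; exists n => //=.
Unshelve. all: by end_near. Qed.

Lemma limn_einf_ge (u : (\bar R)^nat) c : (\forall n \near \oo, (c <= u n)%E) -> (c <= limn_einf u)%E.
Proof.
move=> [N _ Hu]; rewrite limn_einf_lim; apply: lime_ge; first exact: is_cvg_einfs.
near=> n; apply: le_ereal_inf_tmp => _ [k /= nk <-].
by apply: Hu => /=; apply: leq_trans nk; near: n; exists N.
Unshelve. all: by end_near. Qed.

Context d (T : measurableType d) (mu : {measure set T -> \bar R}).

Lemma measurable_limn_einf (f : (T -> \bar R)^nat) : (forall n, measurable_fun setT (f n)) ->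
  measurable_fun setT (fun x => limn_einf (f^~ x)).
Proof.
move=> mf; apply: measurableT_comp; first exact: oppe_measurable.
apply: (@measurable_fun_limn_esup _ _ _ _ (fun n x => (- f n x)%E)) => n.
by apply: measurableT_comp; first exact: oppe_measurable.
Qed.

(** Fatou's lemma twice, in m and then in n, since how large m must be depends on n. *)
Lemma fatou_le2 (F : nat -> nat -> T -> R) (f : T -> R) (c : \bar R) :
  (forall n m, measurable_fun setT (F n m)) -> (forall n m x, 0 <= F n m x) ->
  measurable_fun setT f -> (forall x, 0 <= f x) ->
  {ae mu, forall x, forall e, 0 < e ->
    \forall n \near \oo, \forall m \near \oo, f x <= F n m x + e} ->
  (forall n, \forall m \near \oo, (\int[mu]_x (F n m x)%:E <= c)%E) ->
  (\int[mu]_x (f x)%:E <= c)%E.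
Proof.
move=> mF F0 mf f0 Ff Fc.
pose h n x := limn_einf (fun m => (F n m x)%:E).
have mh n : measurable_fun setT (h n).
  by apply: measurable_limn_einf => m; exact/measurable_EFinP.
have h0 n x : (0 <= h n x)%E by apply: limn_einf_ge; near=> m; rewrite lee_fin.
have hc n : (\int[mu]_x h n x <= c)%E.
  apply: le_trans (fatou mu measurableT _ _) (limn_einf_le (Fc n)).
  - by move=> m; exact/measurable_EFinP.
  - by move=> m x _; rewrite lee_fin.
pose k x := limn_einf (h^~ x).
have mk : measurable_fun setT k by exact: measurable_limn_einf.
have k0 x : (0 <= k x)%E by apply: limn_einf_ge; near=> n; exact: h0.
have kc : (\int[mu]_x k x <= c)%E.
  apply: le_trans (fatou mu measurableT mh _) (limn_einf_le _); first by [].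
  by near=> n; exact: hc.
apply: le_trans kc; apply: ae_ge0_le_integral => //.
- by move=> x _; rewrite lee_fin.
- exact/measurable_EFinP.
apply: filterS Ff => x Hx _; apply/lee_addgt0Pr => e e0.
rewrite -leeBlDr//; apply: limn_einf_ge.
apply: filterS (Hx e e0) => n Hn; apply: limn_einf_ge.
apply: filterS Hn => m Hm.
by rewrite -EFinB lee_fin lerBlDr.
Unshelve. all: by end_near. Qed.

End fatou2.

Section grid_kernel.
Context (R : realType).

(* a * smallness N delta bounds P(|N(0, delta)| < a) if a N >= 1, also when delta = 0. *)
Definition smallness (N delta : R) : R := if delta == 0 then N else (Num.sqrt delta)^-1.

Lemma smallness_ge0 N delta : 0 <= N -> 0 <= smallness N delta.
Proof. by move=> N0; rewrite /smallness; case: ifP => // _; rewrite invr_ge0. Qed.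

(** Comparison with the integral of s^(-1/2): h / sqrt(i h) <= 2 (sqrt(i h) - sqrt((i - 1) h))
    telescopes, and the term at 0 contributes h N. *)
Lemma sum_smallness_le (N h : R) n : 0 < h -> 0 <= N ->
  h * (\sum_(0 <= i < n) smallness N (i%:R * h)) <= h * N + 2 * Num.sqrt (n%:R * h).
Proof.
move=> h0 N0; case: n => [|n].
  by rewrite big_geq// mulr0 mul0r sqrtr0 mulr0 addr0 mulr_ge0// ltW.
apply: (@le_trans _ _ (h * N + 2 * Num.sqrt (n%:R * h))); last first.
  by rewrite lerD2l ler_wpM2l// ler_wsqrtr// ler_wpM2r ?(ltW h0)// ler_nat.
elim: n => [|n IHn].
  by rewrite big_nat1 !mul0r /smallness eqxx sqrtr0 mulr0 addr0.
rewrite big_nat_recr//= mulrDr; apply: le_trans (lerD IHn (lexx _)) _.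
rewrite -addrA lerD2l /smallness mulf_eq0 pnatr_eq0 (gt_eqF h0)/=.
set x := Num.sqrt (n.+1%:R * h); set y := Num.sqrt (n%:R * h).
have x0 : 0 < x by rewrite sqrtr_gt0 mulr_gt0.
have y0 : 0 <= y by exact: sqrtr_ge0.
have xy : y <= x by rewrite ler_wsqrtr// ler_wpM2r ?(ltW h0)// ler_nat.
have hE : h = x ^+ 2 - y ^+ 2.
  by rewrite !sqr_sqrtr ?mulr_ge0// ?ltW// -natr1; ring.
rewrite -lerBrDl ler_pdivrMr// [leLHS]hE subr_sqr -mulrBr mulrAC [leRHS]mulrC mulrA.
rewrite -mulrA ler_wpM2l ?subr_ge0//; lra.
Qed.

(** Every distance to i is attained at most twice, once on each side. *)
Lemma sum_distance_le (f : R -> R) (h : R) i n : (forall x, 0 <= f x) -> 0 <= h -> (i < n)%N ->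
  \sum_(0 <= j < n) f `|i%:R * h - j%:R * h| <= 2 * \sum_(0 <= j < n) f (j%:R * h).
Proof.
move=> f0 h0 i_n.
apply: (@le_trans _ _ (\sum_(0 <= j < n | (j <= i)%N) f ((i - j)%:R * h) +
                       \sum_(0 <= j < n | (i <= j)%N) f ((j - i)%:R * h))).
  rewrite [X in _ <= X + _]big_mkcond [X in _ <= _ + X]big_mkcond -big_split /=.
  apply: ler_sum => j _; rewrite -mulrBl normrM (ger0_norm h0).
  have [ji|ij] := leqP j i.
    by rewrite natrB// ger0_norm ?subr_ge0 ?ler_nat// lerDl; case: ifP.
  by rewrite (ltnW ij) add0r natrB ?(ltnW ij)// distrC ger0_norm// subr_ge0 ler_nat ltnW.
have sub m : (m <= n)%N -> \sum_(0 <= j < m) f (j%:R * h) <= \sum_(0 <= j < n) f (j%:R * h).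
  move=> mn; rewrite [leRHS](@big_cat_nat _ _ _ m)//= lerDl.
  by apply: sumr_ge0.
have -> (x : R) : 2 * x = x + x by ring.
apply: lerD.
  rewrite -[X in X <= _](@big_nat_widen _ _ _ 0%N i.+1 n xpredT)// big_nat_rev /= add0n.
  apply: le_trans (sub i.+1 i_n); rewrite big_nat [leRHS]big_nat.
  by apply: ler_sum => j /andP[_ ji]; rewrite subSS subKn.
rewrite -[X in X <= _](@big_nat_widenl _ _ _ i 0%N n xpredT)// -{1}(add0n i) big_addn.
apply: le_trans (sub (n - i)%N (leq_subr _ _)).
by apply: ler_sum => j _; rewrite addnK.
Qed.

End grid_kernel.

Section sub_sigma_algebra.
Context d (T : measurableType d) (R : realType) (F : set (set T)).
Hypothesis sF : sigma_algebra setT F.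

(** Translates the preimage condition used for filtrations into measurability on the type generated
    by [F], where the usual closure properties apply. *)
Lemma sub_measurable_funP (X : T -> R) :
  measurable_fun setT (X : g_sigma_algebraType F -> R) <->
  forall A : set R, measurable A -> F (X @^-1` A).
Proof.
split => [mX A mA|FX].
  by have := mX measurableT A mA; rewrite setTI /measurable /= sigma_algebra_id.
move=> _ A mA; rewrite setTI /measurable /=; rewrite sigma_algebra_id//; exact: FX.
Qed.

Lemma sub_measurable_fun (X : T -> R) : F `<=` measurable ->
  measurable_fun setT (X : g_sigma_algebraType F -> R) -> measurable_fun setT X.
Proof.
move=> FT /sub_measurable_funP FX _ A mA; rewrite setTI; apply: FT; exact: FX.
Qed.

End sub_sigma_algebra.

Lemma sqr_sum_le (R : realType) (M : nat) (a : 'I_M -> R) :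
  (\sum_(k < M) a k) ^+ 2 <= M%:R * \sum_(k < M) a k ^+ 2.
Proof.
rewrite expr2 mulr_suml; pose S := \sum_(k < M) a k ^+ 2.
have E : \sum_(i < M) \sum_(j < M) (a i ^+ 2 + a j ^+ 2) / 2 = M%:R * S.
  have -> : \sum_(i < M) \sum_(j < M) (a i ^+ 2 + a j ^+ 2) / 2 =
      \sum_(i < M) (M%:R * a i ^+ 2 + S) / 2.
    by apply: eq_bigr => i _; rewrite -mulr_suml big_split /= sumr_const card_ord -[a i ^+ 2 *+ M]mulr_natl.
  rewrite -mulr_suml big_split /= -mulr_sumr sumr_const card_ord -/S -[S *+ M]mulr_natl.
  by field.
rewrite -E; apply: ler_sum => i _; rewrite mulr_sumr; apply: ler_sum => j _.
by rewrite ler_pdivlMr//; have := sqr_ge0 (a i - a j); rewrite sqrrB; lra.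
Qed.

Lemma ge0_integral_sumr d (T : measurableType d) (R : realType) (mu : {measure set T -> \bar R})
  (I : Type) (r : seq I) (f : I -> T -> R) :
  (forall i, measurable_fun setT (f i)) -> (forall i x, 0 <= f i x) ->
  (\int[mu]_x (\sum_(i <- r) f i x)%:E = \sum_(i <- r) \int[mu]_x (f i x)%:E)%E.
Proof.
move=> mf f0; under eq_integral do rewrite -sumEFin.
rewrite ge0_integral_sum//; first by move=> i; exact/measurable_EFinP.
by move=> i x _; rewrite lee_fin.
Qed.

(** * From three nearly equal values of B to the moment bound *)

Section brownian_moments.
Context d (T : measurableType d) (R : realType) (P : probability T R).
Variables (Tm : R) (G : R -> set (set T)) (B : R -> {RV P >-> R}).
Hypothesis HF : filtration Tm G.
Hypothesis HB : brownian_motion Tm G B.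

Lemma adapted_measurable s t : 0 <= s -> s <= t -> t <= Tm ->
  measurable_fun setT (B s : g_sigma_algebraType (G t) -> R).
Proof.
move=> s0 st tT; apply/sub_measurable_funP.
  by apply: (filtration_sigma HF); rewrite (le_trans s0).
move=> A mA; apply: (filtration_homo HF s0 st tT).
by apply: (bm_adapted HB) => //; rewrite s0 (le_trans st).
Qed.

Definition close (a p q : R) : set T := [set w | `|B q w - B p w| < a].

Lemma closeE a p q : close a p q = (B q \- B p) @^-1` [set x | `|x| < a].
Proof. by []. Qed.

Lemma measurable_small (a : R) : measurable [set x : R | `|x| < a].
Proof.
rewrite (_ : [set x | _] = `]- a, a[%classic); first exact: measurable_itv.
by apply/seteqP; split => x /=; rewrite in_itv /= ltr_norml.
Qed.

Lemma measurable_close a p q : measurable (close a p q).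
Proof.
rewrite closeE -[X in measurable X]setTI.
by apply: (measurable_funB (f := B q) (g := B p)) => //; exact: measurable_small.
Qed.

Lemma close_filtration a p q : 0 <= p -> p <= q -> q <= Tm -> G q (close a p q).
Proof.
move=> p0 pq qT; have q0 := le_trans p0 pq.
have sG : sigma_algebra setT (G q) by apply: (filtration_sigma HF); rewrite q0.
rewrite closeE; apply: (sub_measurable_funP sG (B q \- B p)).1; last exact: measurable_small.
by apply: measurable_funB; exact: adapted_measurable.
Qed.

Lemma closeC a p q : close a p q = close a q p.
Proof. by apply/seteqP; split => w; rewrite /close /= distrC. Qed.

Lemma le_close a b p q : a <= b -> close a p q `<=` close b p q.
Proof. by move=> ab w; rewrite /close /= => /lt_le_trans; apply. Qed.

(** For q = p the event can have probability 1, which a N >= 1 absorbs; otherwise it is a small ball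
    for a normal increment. *)
Lemma prob_close (a N p q : R) : 0 <= a -> 1 <= a * N -> 0 <= p -> p <= q -> q <= Tm ->
  (P (close a p q) <= (a * smallness N (q - p))%:E)%E.
Proof.
move=> a0 aN p0 pq qT; rewrite /smallness subr_eq0; case: eqVneq => [_|qp].
  by apply: le_trans (probability_le1 P (measurable_close _ _ _)) _; rewrite lee_fin.
have pq' : 0 < q - p by rewrite subr_gt0 lt_neqAle eq_sym qp.
rewrite closeE (bm_gauss HB p0 pq qT (measurable_small a)).
rewrite gaussian_lawE ?(ltW pq')//; last exact: measurable_small.
rewrite (_ : _ @^-1` _ = [set z | `|Num.sqrt (q - p) * z| < a]).
  by apply: normal_small => //; rewrite sqrtr_gt0.
by apply/seteqP; split => z /=; rewrite add0r.
Qed.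

Lemma prob_close2 (a N p q r : R) : 0 <= a -> 1 <= a * N -> 0 <= p -> p <= q -> q <= r -> r <= Tm ->
  (P (close a p q `&` close a q r) <= (a ^+ 2 * (smallness N (q - p) * smallness N (r - q)))%:E)%E.
Proof.
move=> a0 aN p0 pq qr rT; have q0 := le_trans p0 pq; have qT := le_trans qr rT.
rewrite [X in _ `&` X]closeE (bm_indep HB q0 qr rT (close_filtration a p0 pq qT))//; last first.
  exact: measurable_small.
rewrite -closeE (_ : _ * _ = (a * smallness N (q - p)) * (a * smallness N (r - q))); last by ring.
by rewrite EFinM; apply: lee_pmul => //; exact: prob_close.
Qed.

(* Sort the three times and use the independence of the two increments; two values that
   are close to a third one are 2 e-close to each other. *)
Lemma prob_close_triple (e N i j k : R) : 0 <= e -> 1 <= 2 * e * N ->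
  0 <= i <= Tm -> 0 <= j <= Tm -> 0 <= k <= Tm ->
  (P (close e k i `&` close e k j) <= ((2 * e) ^+ 2 *
    (smallness N `|i - k| * smallness N `|j - k| + smallness N `|i - k| * smallness N `|j - i|
     + smallness N `|j - k| * smallness N `|i - j|))%:E)%E.
Proof.
move=> e0 eN; wlog ij : i j / i <= j => [H iT jT kT|].
  have [ij|ij] := leP i j; first exact: H.
  rewrite setIC; apply: le_trans (H _ _ (ltW ij) jT iT kT) _.
  rewrite lee_fin ler_wpM2l ?sqr_ge0//.
  rewrite [X in X + _ + _ <= _]mulrC -!addrA lerD2l addrC//.
move=> /andP[i0 iT] /andP[j0 jT] /andP[k0 kT].
have N0 : 0 <= N.
  rewrite leNgt; apply/negP => N0; have : 2 * e * N <= 0 by rewrite mulr_ge0_le0 ?mulr_ge0// ltW.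
  lra.
have S x : 0 <= smallness N x by exact: smallness_ge0.
have e2 : 0 <= 2 * e by rewrite mulr_ge0.
have ee : e <= 2 * e by lra.
(* Here p <= q <= r are the three times in order and z is at least the product for the two
   consecutive gaps; each order of i, j, k picks its own summand. *)
have H p q r z : 0 <= p -> p <= q -> q <= r -> r <= Tm ->
    close e k i `&` close e k j `<=` close (2 * e) p q `&` close (2 * e) q r ->
    smallness N (q - p) * smallness N (r - q) <= z ->
    (P (close e k i `&` close e k j) <= ((2 * e) ^+ 2 * z)%:E)%E.
  move=> p0 pq qr rT sub zle; apply: (@le_trans _ _ (P (close (2 * e) p q `&` close (2 * e) q r))).
    by apply: le_measure; rewrite ?inE//; apply: measurableI; exact: measurable_close.
  apply: le_trans (prob_close2 e2 eN p0 pq qr rT) _.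
  by rewrite lee_fin ler_wpM2l// sqr_ge0.
have [ki|ik] := leP k i; last have [kj|jk] := leP k j.
- apply: (H k i j) => //.
    move=> w [h1 h2]; split; first exact: le_close h1.
    by move: h1 h2; rewrite /close /= !ltr_norml => /andP[? ?] /andP[? ?]; apply/andP; split; lra.
  rewrite (ger0_norm (_ : 0 <= i - k)) ?subr_ge0// (ger0_norm (_ : 0 <= j - i)) ?subr_ge0//.
  by rewrite -addrA addrCA lerDl addr_ge0// mulr_ge0.
- apply: (H i k j) => //; first exact: ltW.
    move=> w [h1 h2]; split; last exact: le_close h2.
    by rewrite closeC; exact: le_close h1.
  rewrite (ler0_norm (_ : i - k <= 0)) ?subr_le0 ?(ltW ik)// opprB.
  rewrite (ger0_norm (_ : 0 <= j - k)) ?subr_ge0//.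
  by rewrite -addrA lerDl addr_ge0// mulr_ge0.
- apply: (H i j k) => //; first exact: ltW.
    move=> w [h1 h2]; split; last by rewrite closeC; exact: le_close h2.
    by move: h1 h2; rewrite /close /= !ltr_norml => /andP[? ?] /andP[? ?]; apply/andP; split; lra.
  rewrite (ler0_norm (_ : j - k <= 0)) ?subr_le0 ?(ltW jk)// opprB distrC.
  rewrite (ger0_norm (_ : 0 <= j - i)) ?subr_ge0//.
  rewrite (ler0_norm (_ : i - j <= 0)) ?subr_le0// opprB.
  by rewrite [leLHS]mulrC lerDr addr_ge0// mulr_ge0.
Qed.

(** The square of the double sum involves four times; Cauchy-Schwarz in the outer index, at the
    price of a factor m + 1, leaves triples with k in common. *)
Lemma self_intersection_le (t : R) n m w : 0 <= t ->
  self_intersection t (fun s => B s w) n m ^+ 2 <=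
  4 * n.+1%:R ^+ 2 * (t / m.+1%:R) ^+ 4 * m.+1%:R *
  \sum_(k < m.+1) \sum_(i < m.+1) \sum_(j < m.+1)
    \1_(close n.+1%:R^-1 (k%:R * (t / m.+1%:R)) (i%:R * (t / m.+1%:R)) `&`
        close n.+1%:R^-1 (k%:R * (t / m.+1%:R)) (j%:R * (t / m.+1%:R))) w.
Proof.
move=> t0; set h := t / m.+1%:R; set N : R := n.+1%:R.
pose I k j : R := \1_(close N^-1 (k%:R * h) (j%:R * h)) w.
have h0 : 0 <= h by rewrite divr_ge0.
have SI0 : 0 <= self_intersection t (fun s => B s w) n m.
  rewrite mulr_ge0 ?sqr_ge0// sumr_ge0// => k _; rewrite sumr_ge0// => j _.
  exact: hat_ge0.
have SI : self_intersection t (fun s => B s w) n m <=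
    2 * N * h ^+ 2 * \sum_(k < m.+1) \sum_(j < m.+1) I k j.
  rewrite /self_intersection -/h [leRHS](_ : _ = h ^+ 2 * (2 * N * \sum_(k < m.+1) \sum_(j < m.+1) I k j)); last by ring.
  rewrite ler_wpM2l ?sqr_ge0// mulr_sumr; apply: ler_sum => k _.
  rewrite mulr_sumr; apply: ler_sum => j _; apply: le_trans (hat_le _ _) _.
  rewrite ler_wpM2l ?mulr_ge0// /I indicE.
  have [H|H] := ltP (`|B (j%:R * h) w - B (k%:R * h) w|) N^-1; last by rewrite /= ler0n.
  by rewrite mem_set.
apply: (@le_trans _ _ ((2 * N * h ^+ 2 * \sum_(k < m.+1) \sum_(j < m.+1) I k j) ^+ 2)).
  by rewrite lerXn2r// nnegrE// (le_trans SI0).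
rewrite [leLHS]exprMn.
apply: (@le_trans _ _ ((2 * N * h ^+ 2) ^+ 2 * (m.+1%:R * \sum_(k < m.+1) (\sum_(j < m.+1) I k j) ^+ 2))).
  by rewrite ler_wpM2l ?sqr_ge0// sqr_sum_le.
rewrite (_ : (2 * N * h ^+ 2) ^+ 2 = 4 * N ^+ 2 * h ^+ 4); last by ring.
rewrite -[leRHS]mulrA le_eqVlt; apply/orP; left; apply/eqP; congr (_ * (_ * _)).
apply: eq_bigr => k _; rewrite expr2 mulr_suml; apply: eq_bigr => i _.
rewrite mulr_sumr; apply: eq_bigr => j _.
by rewrite /I indicI.
Qed.

Lemma measurable_self_intersection (t : R) n m :
  measurable_fun setT (fun w => self_intersection t (fun s => B s w) n m).
Proof.
have mh : measurable_fun setT (hat n : R -> R).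
  apply: continuous_measurable_fun.
  by have := @continuous_hat R n 0; under eq_fun do rewrite subr0.
apply: measurable_funM => //; apply: measurable_sum => k; apply: measurable_sum => j.
by apply: measurableT_comp => //; apply: measurable_funB.
Qed.

(** The grid must be finer than the kernel, h N <= 1, so that coinciding times cost only a constant.
    The powers of N cancel: 4 N^2 from the kernel against (2 / N)^2 from the probability. *)
Lemma self_intersection_moment (t : R) n m : 0 < t -> t <= Tm -> t / m.+1%:R * n.+1%:R <= 1 ->
  (\int[P]_w (self_intersection t (fun s => B s w) n m ^+ 2)%:E <=
   (192 * t ^+ 2 * (1 + 2 * Num.sqrt t) ^+ 2)%:E)%E.
Proof.
move=> t0 tT; set h := t / m.+1%:R; set N : R := n.+1%:R; set M : R := m.+1%:R => hN.
have h0 : 0 < h by rewrite divr_gt0.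
have N0 : 0 < N by rewrite ltr0n.
have hM : M * h = t by rewrite /h mulrC divfK// pnatr_eq0.
pose E (k i j : 'I_m.+1) := close N^-1 (k%:R * h) (i%:R * h) `&` close N^-1 (k%:R * h) (j%:R * h).
have mE k i j : measurable (E k i j) by apply: measurableI; exact: measurable_close.
pose C : R := 4 * N ^+ 2 * h ^+ 4 * M.
have C0 : 0 <= C by rewrite /C mulr_ge0 ?ler0n// mulr_ge0 ?(exprn_ge0 _ (ltW h0))// mulr_ge0 ?ler0n ?sqr_ge0.
pose K (x : R) := smallness N `|x|.
have K0 x : 0 <= K x by apply: smallness_ge0; exact: ltW.
pose Z (k i j : 'I_m.+1) : R := K (i%:R * h - k%:R * h) * K (j%:R * h - k%:R * h)
   + K (i%:R * h - k%:R * h) * K (j%:R * h - i%:R * h)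
   + K (j%:R * h - k%:R * h) * K (i%:R * h - j%:R * h).
have mI k i j : measurable_fun setT (\1_(E k i j) : T -> R) by exact: measurable_indic.
have I0 k i j w : 0 <= (\1_(E k i j) : T -> R) w by rewrite indicE.
have S1_ge0 k i w : 0 <= \sum_j (\1_(E k i j) : T -> R) w by exact: sumr_ge0.
have S2_ge0 k w : 0 <= \sum_i \sum_j (\1_(E k i j) : T -> R) w by exact: sumr_ge0.
have S3_ge0 w : 0 <= \sum_k \sum_i \sum_j (\1_(E k i j) : T -> R) w by exact: sumr_ge0.
have mS1 k i : measurable_fun setT (fun w => \sum_j (\1_(E k i j) : T -> R) w).
  by apply: measurable_sum => j.
have mS2 k : measurable_fun setT (fun w => \sum_i \sum_j (\1_(E k i j) : T -> R) w).
  by apply: measurable_sum => i.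
have mS3 : measurable_fun setT (fun w => \sum_k \sum_i \sum_j (\1_(E k i j) : T -> R) w).
  by apply: measurable_sum => i.
apply: (@le_trans _ _ (C%:E * \sum_k \sum_i \sum_j P (E k i j))%E).
  apply: (@le_trans _ _ (\int[P]_w (C * \sum_k \sum_i \sum_j (\1_(E k i j) : T -> R) w)%:E)%E).
    apply: ge0_le_integral => //.
    - by move=> w _; rewrite lee_fin sqr_ge0.
    - by apply/measurable_EFinP; apply: measurable_funX; exact: measurable_self_intersection.
    - by apply/measurable_EFinP; exact: measurable_funM.
    - by move=> w _; rewrite lee_fin; apply: self_intersection_le; exact: ltW.
  under eq_integral do rewrite EFinM.
  rewrite ge0_integralZl//; last 2 first.
  - exact/measurable_EFinP.
  - by move=> w _; rewrite lee_fin.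
  rewrite ge0_integral_sumr//; apply: lee_pmul => //.
    by apply: sume_ge0 => k _; apply: integral_ge0 => w _; rewrite lee_fin.
  apply: lee_sum => k _; rewrite ge0_integral_sumr//.
  apply: lee_sum => i _; rewrite ge0_integral_sumr//.
  by apply: lee_sum => j _; rewrite integral_indic// setIT.
apply: (@le_trans _ _ (C%:E * (\sum_k \sum_i \sum_j (2 * N^-1) ^+ 2 * Z k i j)%:E)%E).
  apply: lee_wpmul2l; first by rewrite lee_fin.
  rewrite -sumEFin; apply: lee_sum => k _; rewrite -sumEFin; apply: lee_sum => i _.
  rewrite -sumEFin; apply: lee_sum => j _.
  have T01 (l : 'I_m.+1) : 0 <= l%:R * h <= Tm.
    rewrite mulr_ge0 ?(ltW h0)//= (le_trans _ tT)// -hM ler_wpM2r ?(ltW h0)//.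
    by rewrite /M ler_nat ltnW.
  apply: prob_close_triple => //; first by rewrite invr_ge0 ltW.
  by rewrite -mulrA mulVf ?gt_eqF//; lra.
rewrite -EFinM lee_fin.
(* By [sum_distance_le] this bounds the sum of the weights over all distances from any fixed grid
   time. *)
pose S := 2 * \sum_(0 <= d < m.+1) smallness N (d%:R * h).
have S0 : 0 <= S by rewrite mulr_ge0// sumr_ge0// => i _; apply: smallness_ge0; exact: ltW.
have KS (i : 'I_m.+1) : \sum_(j < m.+1) K (i%:R * h - j%:R * h) <= S.
  rewrite -(big_mkord xpredT (fun j => K (i%:R * h - j%:R * h))).
  apply: sum_distance_le => //; last exact: ltW.
  by move=> x; apply: smallness_ge0; exact: ltW.
have KC x y : K (x - y) = K (y - x) by rewrite /K distrC.
have ZS : \sum_k \sum_i \sum_j Z k i j <= M * (3 * S ^+ 2).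
  rewrite (_ : M * _ = \sum_(k < m.+1) 3 * S ^+ 2); last first.
    by rewrite sumr_const card_ord -[RHS]mulr_natl.
  apply: ler_sum => k _.
  (* Summing first over the inner index, uniformly in the outer one, shows that each of the three
     products in [Z] contributes at most S^2. *)
  have prod_le (f : 'I_m.+1 -> R) (g : 'I_m.+1 -> 'I_m.+1 -> R) : (forall i, 0 <= f i) ->
      \sum_i f i <= S -> (forall i, \sum_j g i j <= S) -> \sum_i \sum_j f i * g i j <= S ^+ 2.
    move=> f0 fS gS; under eq_bigr do rewrite -mulr_sumr.
    apply: (@le_trans _ _ (\sum_i f i * S)); first by apply: ler_sum => i _; rewrite ler_wpM2l.
    by rewrite -mulr_suml expr2 ler_wpM2r.
  have KS' (i : 'I_m.+1) : \sum_(j < m.+1) K (j%:R * h - i%:R * h) <= S.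
    by under eq_bigr do rewrite KC; exact: KS.
  have -> : \sum_i \sum_j Z k i j =
      \sum_(i < m.+1) \sum_(j < m.+1) K (i%:R * h - k%:R * h) * K (j%:R * h - k%:R * h)
      + \sum_(i < m.+1) \sum_(j < m.+1) K (i%:R * h - k%:R * h) * K (j%:R * h - i%:R * h)
      + \sum_(j < m.+1) \sum_(i < m.+1) K (j%:R * h - k%:R * h) * K (i%:R * h - j%:R * h).
    rewrite [X in _ = _ + _ + X]exchange_big /= -!big_split /=; apply: eq_bigr => i _.
    by rewrite -!big_split.
  rewrite (_ : 3 * S ^+ 2 = S ^+ 2 + S ^+ 2 + S ^+ 2); last by ring.
  by apply: lerD; [apply: lerD|]; apply: prod_le.
have hS : h * S <= 2 * (1 + 2 * Num.sqrt t).
  have := sum_smallness_le m.+1 h0 (ltW N0); rewrite -/M hM /S; lra.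
under eq_bigr do under eq_bigr do rewrite -mulr_sumr.
under eq_bigr do rewrite -mulr_sumr.
rewrite -mulr_sumr.
apply: (@le_trans _ _ (C * ((2 * N^-1) ^+ 2 * (M * (3 * S ^+ 2))))).
  by rewrite ler_wpM2l// ler_wpM2l// sqr_ge0.
(* The factor 48 = 4 * 4 * 3 collects the kernel, the probability bound and the three products; h S
   <= 2 (1 + 2 sqrt t) then turns it into 192. *)
have -> : C * ((2 * N^-1) ^+ 2 * (M * (3 * S ^+ 2))) = 48 * (M * h) ^+ 2 * (h * S) ^+ 2.
  by rewrite /C; field; rewrite gt_eqF.
rewrite hM (_ : 192 * _ * _ = 48 * t ^+ 2 * (2 * (1 + 2 * Num.sqrt t)) ^+ 2); last by ring.
have hS0 : 0 <= h * S by rewrite mulr_ge0// ltW.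
rewrite ler_wpM2l ?(mulr_ge0 _ (sqr_ge0 t))//.
by rewrite lerXn2r// nnegrE (le_trans hS0 hS).
Qed.

Variable L : R -> R -> {RV P >-> R}.
Hypothesis HL : local_time Tm B L.
Variable t : R.
Hypotheses (t_ge0 : 0 <= t) (t_leT : t <= Tm).
Notation mu := (@lebesgue_measure R).

Lemma regular_path : {ae P, forall w,
  [/\ {within `[0, Tm], continuous (fun s => B s w)}, continuous (fun a => L a t w) &
    forall A : set R, measurable A ->
    mu (`[0, t]%classic `&` [set s | A (B s w)]) = (\int[mu]_(a in A) (L a t w)%:E)%E]}.
Proof.
have := bm_cont HB; have := lt_cont HL; have := lt_occupation HL.
apply: filterS3 => w Hocc Lc Bc; split => //; last by move=> A mA; apply: Hocc; rewrite ?t_ge0.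
apply: (@continuous_comp_within _ _ _ _ (fun a : R => (t, a)) (fun p : R * R => L p.2 p.1 w)) Lc.
  by move=> a; exact: (cvg_pair (@cvg_cst _ t _ (nbhs a) _) (@cvg_id _ (nbhs a))).
by move=> a; rewrite /= t_ge0.
Qed.

Lemma local_time_sqE w : local_time_sq L t w = nsq mu (fun a => L a t w).
Proof. by apply: eq_Rintegral => a _; rewrite real_normK ?num_real// expr2. Qed.

(** Formulated for a measurable [v], so that measurability of the squared norm itself need not be
    established. *)
Lemma local_time_sq_moment (v : T -> R) : measurable_fun setT v -> (forall w, 0 <= v w) ->
  {ae P, forall w, v w = local_time_sq L t w} ->
  (\int[P]_w (v w ^+ 2)%:E <= (192 * t ^+ 2 * (1 + 2 * Num.sqrt t) ^+ 2)%:E)%E.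
Proof.
move=> mv v0 vL.
apply: (@fatou_le2 R _ _ P (fun n m w => self_intersection t (fun s => B s w) n m ^+ 2)).
- by move=> n m; apply: measurable_funX; exact: measurable_self_intersection.
- by move=> n m w; exact: sqr_ge0.
- exact: measurable_funX.
- by move=> w; exact: sqr_ge0.
- apply: filterS2 vL regular_path => w vw [Bc Lc Hocc] e e0.
  have K0 : 0 < 2 * v w + 1 by have := v0 w; lra.
  (* If V < v <= V + d then v^2 - V^2 <= 2 v d, so this tolerance turns the bound on v into one on
     v^2. *)
  have d0 : 0 < e / (2 * v w + 1) by rewrite divr_gt0.
  apply: filterS (self_intersection_lower t_ge0 t_leT Bc Lc Hocc d0) => n.
  apply: filterS => m; rewrite -local_time_sqE -vw.
  set V := self_intersection _ _ _ _ => H.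
  have V0 : 0 <= V.
    rewrite mulr_ge0 ?sqr_ge0// sumr_ge0// => k _; rewrite sumr_ge0// => j _.
    exact: hat_ge0.
  have [vV|Vv] := leP (v w) V.
    apply: (@le_trans _ _ (V ^+ 2)); last by rewrite lerDl ltW.
    by rewrite lerXn2r// nnegrE.
  rewrite -lerBlDl subr_sqr.
  apply: (@le_trans _ _ (e / (2 * v w + 1) * (2 * v w + 1))); last by rewrite divfK// gt_eqF.
  by apply: ler_pM; have := v0 w; lra.
- move=> n; have [t0|t0] := ltP 0 t; last first.
    have -> : t = 0 by apply/eqP; rewrite eq_le t0 t_ge0.
    near=> m; under eq_integral do rewrite /self_intersection mul0r expr0n /= mul0r expr0n /=.
    by rewrite integral0 lee_fin mulr_ge0 ?mulr_ge0 ?sqr_ge0.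
  have H : t * n.+1%:R / m.+1%:R @[m --> \oo] --> (0 : R).
    by rewrite -[0 as Z in _ --> Z](mulr0 (t * n.+1%:R)); apply: cvgMr; exact: cvg_harmonic.
  near=> m; apply: self_intersection_moment => //.
  by rewrite mulrAC; near: m; apply: (cvgr_le _ H); exact: ltr01.
Unshelve. all: by end_near. Qed.

End brownian_moments.

(** * Measurable versions of the Hermite coefficients *)

Section coefficient_versions.
Context d (T : measurableType d) (R : realType) (P : probability T R).
Variables (Tm : R) (G : R -> set (set T)) (B : R -> {RV P >-> R}).
Hypothesis HF : filtration Tm G.
Hypothesis HB : brownian_motion Tm G B.
Variable L : R -> R -> {RV P >-> R}.
Hypothesis HL : local_time Tm B L.
Variables t x : R.
Hypotheses (t_ge0 : 0 <= t) (t_leT : t <= Tm).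
Notation mu := (@lebesgue_measure R).

Lemma ge0_integral_shift (f : R -> \bar R) : measurable_fun setT f -> (forall y, 0 <= f y)%E ->
  (\int[mu]_y f (y - x)%R = \int[mu]_y f y)%E.
Proof.
move=> mf f0; rewrite [RHS](@ge0_integral_affine R (- x) 1)// mul1e.
by apply: eq_integral => y _; rewrite mul1r addrC.
Qed.

Lemma regular_shifted_path : {ae P, forall w,
  [/\ {within `[0, Tm], continuous (fun s => x + B s w)},
    continuous (fun y => L (y - x) t w),
    forall A : set R, measurable A ->
      mu (`[0, t]%classic `&` [set s | A (x + B s w)]) = (\int[mu]_(y in A) (L (y - x) t w)%:E)%E &
    nsq mu (fun y => L (y - x) t w) = local_time_sq L t w]}.
Proof.
apply: filterS (regular_path HB HL t_ge0 t_leT) => w [Bc Lc Hocc].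
have L0 := density_ge0 t_ge0 t_leT Bc Lc Hocc.
have mL : measurable_fun setT (fun a => L a t w) by exact: continuous_measurable_fun.
split.
- by move=> s; apply: cvgD; [exact: cvg_cst|exact: Bc].
- move=> y; apply: (@continuous_comp _ _ _ (fun y => y - x) (fun a => L a t w)); last exact: Lc.
  by apply: cvgB; [exact: cvg_id|exact: cvg_cst].
- move=> A mA.
  have mA' : measurable ((fun a : R => x + a) @^-1` A).
    rewrite -[X in measurable X]setTI.
    by have /(_ measurableT A mA) : measurable_fun setT (fun a : R => x + a) by exact: measurable_funD.
  have := Hocc _ mA'; rewrite /= => ->.
  rewrite [LHS]integral_mkcond [RHS]integral_mkcond.
  rewrite -(@ge0_integral_shift ((fun a => (L a t w)%:E) \_ ((fun a : R => x + a) @^-1` A))).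
  + apply: eq_integral => y _; rewrite /patch; congr (if _ then _ else _).
    by apply/idP/idP; rewrite !inE /= addrC subrK.
  + apply/(measurable_restrictT _ _).1 => //; apply: measurable_funTS; exact/measurable_EFinP.
  + by move=> y; rewrite /patch; case: ifP => // _; rewrite lee_fin.
- rewrite local_time_sqE /nsq /ip /Rintegral; congr fine.
  apply: (@ge0_integral_shift (fun a => (L a t w * L a t w)%:E)).
  + by apply/measurable_EFinP; exact: measurable_funM.
  + by move=> y; rewrite lee_fin mulr_ge0.
Qed.

(* The limit of Riemann sums is measurable with respect to G Tm and not only
   for its completion. *)
Definition coef_version (j : nat) (w : T) : R := fine (limn_esup (fun m =>
  (t / m.+1%:R * (\sum_(i < m.+1) hermite_fun j.+1 (x + B (i%:R * (t / m.+1%:R)) w)))%:E)).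

(** By Parseval a version of the squared norm of the local time; the absolute value keeps it
    nonnegative on exceptional paths too. *)
Definition sq_version (w : T) : R :=
  `|fine (limn_esup (fun K => (\sum_(j < K) coef_version j w ^+ 2)%:E))|.

Lemma measurable_coef_version j : measurable_fun setT (coef_version j : g_sigma_algebraType (G Tm) -> R).
Proof.
apply: measurableT_comp; first exact: fine_measurable.
apply: (@measurable_fun_limn_esup _ (g_sigma_algebraType (G Tm)) R setT
  (fun m w => (t / m.+1%:R * (\sum_(i < m.+1) hermite_fun j.+1 (x + B (i%:R * (t / m.+1%:R)) w)))%:E)) => m.
apply/measurable_EFinP; apply: measurable_funM; first exact: measurable_cst.
apply: measurable_sum => i; apply: measurableT_comp.
  by apply: continuous_measurable_fun; exact: continuous_hermite_fun.
apply: measurable_funD; first exact: measurable_cst.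
apply: (adapted_measurable HF HB) => //; first by rewrite mulr_ge0// divr_ge0.
apply: le_trans t_leT; rewrite mulrCA ler_piMr// ler_pdivrMr// mul1r ler_nat.
exact: ltnW.
Qed.

Lemma measurable_sq_version : measurable_fun setT (sq_version : g_sigma_algebraType (G Tm) -> R).
Proof.
apply: measurableT_comp => //; apply: measurableT_comp; first exact: fine_measurable.
apply: (@measurable_fun_limn_esup _ (g_sigma_algebraType (G Tm)) R setT
  (fun K w => (\sum_(j < K) coef_version j w ^+ 2)%:E)) => K.
apply/measurable_EFinP; apply: measurable_sum => j; apply: measurable_funX.
exact: measurable_coef_version.
Qed.

Lemma sq_version_ge0 w : 0 <= sq_version w. Proof. exact: normr_ge0. Qed.

(** On a regular path the upper limits are limits: Riemann sums give the occupation coefficients,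
    which the occupation formula identifies as Hermite coefficients of the local time, and Parseval
    gives its squared norm. *)
Lemma versionsP : {ae P, forall w,
  [/\ forall j, occupation_coef B t x j.+1 w = coef_version j w,
      local_time_sq L t w = sq_version w,
      L2 mu (fun y => L (y - x) t w),
      (forall j, hermite_coef (fun y => L (y - x) t w) j = coef_version j w) /\
      nsq mu (fun y => L (y - x) t w) = sq_version w &
      \sum_(j < K) coef_version j w ^+ 2 @[K --> \oo] --> sq_version w]}.
Proof.
apply: filterS regular_shifted_path => w [Bc Lc Hocc HN].
have coefE j : coef_version j w = occupation_coef B t x j.+1 w.
  have H := cvg_sampled_integral t_ge0 t_leT Bc (@continuous_hermite_fun R j).
  have {H}/cvg_limn_einf_sup[_ E] : (t / m.+1%:R *
      (\sum_(i < m.+1) hermite_fun j.+1 (x + B (i%:R * (t / m.+1%:R)) w)))%:E @[m --> \oo] -->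
      (\int[mu]_(s in `[0, t]) hermite_fun j.+1 (x + B s w))%:E.
    by apply: cvg_EFin; [near=> m|exact: H].
  by rewrite /coef_version E.
have hcoefE j : hermite_coef (fun y => L (y - x) t w) j = coef_version j w.
  rewrite coefE /hermite_coef ipC /occupation_coef; apply/esym.
  have [C HC] := @hermite_fun_decay R j.
  apply: (@occupation_formula R Tm t (fun s => x + B s w) _ t_ge0 t_leT Bc Lc Hocc _ `|C|).
    by apply: continuous_measurable_fun; exact: continuous_hermite_fun.
  move=> y; apply: le_trans (HC y) _; rewrite (le_trans (ler_norm _))// normrM ler_piMr//.
  by rewrite ger0_norm ?gsb_ge0// gsb_le1//; lra.
have [M M0 HM] := density_support t_ge0 t_leT Bc Lc Hocc.
have HC := hermite_closure_compact Lc M0 HM.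
have [_ sq] := hermite_closure_parseval HC.
have sqE : sq_version w = nsq mu (fun y => L (y - x) t w).
  rewrite /sq_version; under eq_fun do under eq_bigr do rewrite -hcoefE.
  have /cvg_limn_einf_sup[_ ->] : (\sum_(j < K) hermite_coef (fun y => L (y - x) t w) j ^+ 2)%:E
    @[K --> \oo] --> (nsq mu (fun y => L (y - x) t w))%:E.
    by apply: cvg_EFin; [near=> K|exact: sq].
  by rewrite /= ger0_norm// nsq_ge0.
split=> //.
- by rewrite -HN sqE.
- exact: hermite_closure_L2 HC.
- by rewrite sqE; under eq_fun do under eq_bigr do rewrite -hcoefE.
Unshelve. all: by end_near. Qed.

Lemma sq_version_moment : (\int[P]_w (sq_version w ^+ 2)%:E < +oo)%E.
Proof.
apply: le_lt_trans (ltry _); apply: (local_time_sq_moment HF HB HL t_ge0 t_leT).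
- apply: sub_measurable_fun; last exact: measurable_sq_version.
  + by apply: (filtration_sigma HF); rewrite (le_trans t_ge0)/=.
  + by apply: (filtration_sub HF); rewrite (le_trans t_ge0)/=.
- exact: sq_version_ge0.
- by apply: filterS versionsP => w [].
Qed.

End coefficient_versions.

Lemma mfun_of d (T : measurableType d) (R : realType) (f : T -> R) : measurable_fun setT f ->
  exists Z : {mfun T >-> R}, (Z : T -> R) = f.
Proof.
move=> mf; pose Z : {mfun T >-> R} := HB.pack_for {mfun T >-> R} f (isMeasurableFun.Build _ _ _ _ f mf).
by exists Z.
Qed.

Lemma L2_cst d (T : measurableType d) (R : realType) (P : probability T R) (c : R) : L2 P (fun=> c).
Proof.
apply: L2_lty => //; rewrite integral_cst//=.
by rewrite lte_mul_pinfty// ?lee_fin ?sqr_ge0// (le_lt_trans (probability_le1 P measurableT)) ?ltry.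
Qed.

(** Cauchy-Schwarz against the constant 1, which has norm 1 under a probability. *)
Lemma integral_norm_le_nsq d (T : measurableType d) (R : realType) (P : probability T R) (q : T -> R) :
  L2 P q -> (\int[P]_x `|q x|%:E <= (Num.sqrt (nsq P q))%:E)%E.
Proof.
move=> q2; have a2 : L2 P (fun x => `|q x|).
  have [mq iq] := q2; apply: (ae_le_L2 (g := fun x => `|q x|)).
  - exact: measurableT_comp.
  - by under [X in P.-integrable _ (EFin \o X)]eq_fun do rewrite real_normK ?num_real//.
  - by apply: aeW => x /=; rewrite normr_id.
have c2 := L2_cst P 1.
have E : (\int[P]_x `|q x|%:E = (ip P (fun x => `|q x|) (fun=> 1))%:E)%E.
  rewrite /ip /Rintegral fineK.
    by apply: eq_integral => x _; rewrite mulr1.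
  exact: (integrable_fin_num _ (L2M a2 c2)).
rewrite E lee_fin -(@ler_pXn2r _ 2) ?nnegrE ?sqrtr_ge0//; last first.
  by apply: Rintegral_ge0 => x _; rewrite mulr1.
rewrite sqr_sqrtr ?nsq_ge0//; apply: le_trans (ip_CS a2 c2) _.
have -> : nsq P (fun=> 1) = 1.
  rewrite /nsq /ip Rintegral_cst// mulr1 mul1r.
  by rewrite (_ : fine _ = fine 1%E)//; congr fine; exact: probability_setT.
rewrite mulr1 (_ : nsq P (fun x => `|q x|) = nsq P q)//.
by apply: eq_Rintegral => x _; rewrite -normrM ger0_norm// -expr2 sqr_ge0.
Qed.

(** * Wiener integrals of random integrands *)

Section product_space.
Context d1 (Om1 : measurableType d1) d2 (Om2 : measurableType d2) (R : realType).
Variables (PW : probability Om1 R) (PB : probability Om2 R).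
Notation J := (joint_prob PW PB).

Lemma joint_integral (f : Om1 * Om2 -> \bar R) : measurable_fun setT f -> (forall z, 0 <= f z)%E ->
  (\int[J]_z f z = \int[PB]_b \int[PW]_w f (w, b))%E.
Proof. by move=> mf f0; exact: (@fubini_tonelli2 _ _ _ _ _ PW PB f mf f0). Qed.

Lemma measurable_partial_integral (f : Om1 * Om2 -> \bar R) :
  measurable_fun setT f -> (forall z, 0 <= f z)%E ->
  measurable_fun setT (fun b => \int[PW]_w f (w, b))%E.
Proof. by move=> mf f0; exact: (@measurable_fun_fubini_tonelli_G _ _ _ _ _ PW f mf f0). Qed.

Lemma joint_integral_snd (f : Om2 -> \bar R) : measurable_fun setT f -> (forall b, 0 <= f b)%E ->
  (\int[J]_z f z.2 = \int[PB]_b f b)%E.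
Proof.
move=> mf f0; rewrite (joint_integral (f := fun z => f z.2))//; last exact: measurableT_comp.
apply: eq_integral => b _ /=; rewrite (_ : \int[PW]_w f b = \int[PW]_w cst (f b) w)%E//.
rewrite integral_cst// [X in (_ * X)%E](_ : _ = 1%E) ?mule1//; exact: probability_setT.
Qed.

Lemma joint_ae_snd (Q : Om2 -> Prop) : {ae PB, forall b, Q b} -> {ae J, forall z, Q z.2}.
Proof.
move=> [N [mN N0 QN]]; exists (setT `*` N); split; first exact: measurableX.
  rewrite /joint_prob /=.
  have := @product_measure1E _ _ _ _ _ PW PB setT N measurableT mN => /= ->.
  by rewrite N0 mule0.
by move=> z Qz; split=> //; exact: QN.
Qed.

Lemma L2_joint_snd (q : Om2 -> R) : L2 PB q -> L2 J (fun z => q z.2) /\ nsq J (fun z => q z.2) = nsq PB q.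
Proof.
move=> q2; have mq := L2_measurable q2.
have mq2 : measurable_fun setT (fun z : Om1 * Om2 => q z.2) by exact: measurableT_comp.
have E : (\int[J]_z (q z.2 ^+ 2)%:E = (nsq PB q)%:E)%E.
  rewrite -integral_sqr// (joint_integral_snd (f := fun b => (q b ^+ 2)%:E))//.
    by apply/measurable_EFinP; exact: measurable_funX.
  by move=> b; rewrite lee_fin sqr_ge0.
have q2' : L2 J (fun z => q z.2) by apply: L2_lty => //; rewrite E ltry.
by split=> //; apply: EFin_inj; rewrite -integral_sqr.
Qed.

Variable W : R -> {RV PW >-> R}.
Hypothesis HW : two_sided_brownian_motion W.
Notation mu := (@lebesgue_measure R).

(** By Tonelli and the isometry on sections, the squared norm of F is the mean of [nsq mu (g b)], at
    most the mean of |q| and hence the norm of q. Pathwise errors small in L^2(PB) thus give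
    convergence on the product space. *)
Lemma wiener_joint_L2 (F : Om1 * Om2 -> R) (g : Om2 -> R -> R) (q : Om2 -> R) :
  measurable_fun setT F -> L2 PB q ->
  {ae PB, forall b, wiener_integral W (g b) (fun w => F (w, b)) /\ nsq mu (g b) <= `|q b|} ->
  L2 J F /\ nsq J F <= Num.sqrt (nsq PB q).
Proof.
move=> mF q2 HF.
have mF2 : measurable_fun setT (fun z => (F z ^+ 2)%:E).
  by apply/measurable_EFinP; exact: measurable_funX.
have F0 z : (0 <= (F z ^+ 2)%:E)%E by rewrite lee_fin sqr_ge0.
have H : (\int[J]_z (F z ^+ 2)%:E <= (Num.sqrt (nsq PB q))%:E)%E.
  rewrite joint_integral//; apply: le_trans (integral_norm_le_nsq q2).
  apply: ae_ge0_le_integral => //.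
  - by move=> b _; exact: integral_ge0.
  - exact: (measurable_partial_integral (f := fun z => (F z ^+ 2)%:E)).
  - by apply/measurable_EFinP; apply: measurableT_comp => //; exact: L2_measurable q2.
  apply: filterS HF => b [Hb gq] _; have [_ F2 E _] := wiener_integral_law HW Hb.
  by rewrite integral_sqr// E lee_fin.
have F2 : L2 J F by apply: L2_lty => //; exact: le_lt_trans H (ltry _).
by split=> //; rewrite -lee_fin -integral_sqr.
Qed.

End product_space.

Lemma ae_eq_L2 d (T : measurableType d) (R : realType) (P : {measure set T -> \bar R}) (f g : T -> R) :
  measurable_fun setT f -> L2 P g -> {ae P, forall x, f x = g x} -> L2 P f.
Proof.
move=> mf [mg ig] fg; apply: (ae_le_L2 (g := fun x => `|g x|)) => //.
  by under [X in P.-integrable _ (EFin \o X)]eq_fun do rewrite real_normK ?num_real//.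
by apply: filterS fg => x ->.
Qed.

Lemma measurable_section d1 (T1 : measurableType d1) d2 (T2 : measurableType d2) d3 (T3 : measurableType d3)
  (F : T1 * T2 -> T3) (b : T2) : measurable_fun setT F -> measurable_fun setT (fun w => F (w, b)).
Proof. by move=> mF; apply: (measurableT_comp mF); exact: pair2_measurable. Qed.

(** * A random integrand described by its Hermite coefficients *)

Section random_integrand.
Context d1 (Om1 : measurableType d1) d2 (Om2 : measurableType d2) (R : realType).
Variables (PW : probability Om1 R) (PB : probability Om2 R).
Notation J := (joint_prob PW PB).
Variable W : R -> {RV PW >-> R}.
Hypothesis HW : two_sided_brownian_motion W.
Notation mu := (@lebesgue_measure R).
Variables (c : nat -> Om2 -> R) (v : Om2 -> R) (h : Om2 -> R -> R).
Hypothesis mc : forall j, measurable_fun setT (c j).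
Hypothesis v2 : L2 PB v.
Hypothesis v_ge0 : forall b, 0 <= v b.
Hypothesis ch : {ae PB, forall b, [/\ L2 mu (h b), forall j, hermite_coef (h b) j = c j b,
  nsq mu (h b) = v b & \sum_(j < K) c j b ^+ 2 @[K --> \oo] --> v b]}.

Let remainder K b := v b - \sum_(j < K) c j b ^+ 2.

Lemma nsq_remainder : {ae PB, forall b K,
  nsq mu (fun y => hermite_sum (c^~ b) K y - h b y) = remainder K b}.
Proof.
apply: filterS ch => b [h2 hc hv _] K; rewrite nsqBC nsq_sub_hermite_sum//.
rewrite [X in _ + X]big1 ?addr0; last by move=> j _; rewrite hc subrr expr0n.
by rewrite hv /remainder; under eq_bigr do rewrite hc.
Qed.

Lemma measurable_partial_sum K : measurable_fun setT (fun b => \sum_(j < K) c j b ^+ 2).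
Proof. by apply: measurable_sum => j; exact: measurable_funX. Qed.

(** The remainder lies between 0 and [v], so square integrability of [v] provides the domination. *)
Lemma remainder_cvg : (forall K, L2 PB (remainder K)) /\ nsq PB (remainder K) @[K --> \oo] --> (0 : R).
Proof.
have [] := @dominated_nsq _ _ _ PB remainder (fun=> 0) v.
- by move=> K; apply: measurable_funB (measurable_partial_sum K); exact: L2_measurable v2.
- exact: measurable_cst.
- exact: v2.2.
- apply: filterS ch => b [_ _ _ H]; rewrite -[0 as Z in _ --> Z](subrr (v b)).
  by apply: cvgB; [exact: cvg_cst|exact: H].
- apply: filterS nsq_remainder => b H K; rewrite ger0_norm; last by rewrite -H nsq_ge0.
  by rewrite /remainder gerBl sumr_ge0// => j _; exact: sqr_ge0.
by move=> r2 _; under eq_fun do under eq_fun do rewrite subr0.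
Qed.

Lemma L2_partial_sum K : L2 PB (fun b => \sum_(j < K) c j b ^+ 2).
Proof.
have := L2B v2 (remainder_cvg.1 K); congr L2; apply/funext => b.
by rewrite /remainder opprB addrC subrK.
Qed.

(** A version X_j of each Hermite integral is fixed once, independently of the path; the sums of
    c_j(b) X_j(w) are then jointly measurable and correct for every b. *)
Lemma partial_integrals : exists I : nat -> {mfun (Om1 * Om2)%type >-> R}, forall K b,
  wiener_integral W (hermite_sum (c^~ b) K) (fun w => I K (w, b)).
Proof.
have [X HX] : {X : nat -> Om1 -> R & forall j, wiener_integral W (hermite_fun j.+1) (X j)}.
  apply: (@choice _ _ (fun j X => wiener_integral W (hermite_fun j.+1) X)) => j.
  have [C HC] := @hermite_fun_decay R j.
  by apply: (wiener_integral_exists HW _ _ HC); [lra|exact: continuous_hermite_fun].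
have [I HI] : {I : nat -> {mfun (Om1 * Om2)%type >-> R} & forall K,
    (I K : _ -> R) = fun z => \sum_(j < K) c j z.2 * X j z.1}.
  apply: (@choice _ _ (fun K (I : {mfun (Om1 * Om2)%type >-> R}) =>
    (I : _ -> R) = fun z => \sum_(j < K) c j z.2 * X j z.1)) => K.
  apply: mfun_of; apply: measurable_sum => j; apply: measurable_funM.
    exact: measurableT_comp.
  apply: measurableT_comp => //; have [_ X2 _ _] := wiener_integral_law HW (HX j).
  exact: L2_measurable X2.
exists I => K b; rewrite HI /=.
exact: (wiener_integral_sum HW (index_enum 'I_K) (fun j : 'I_K => c j b) (fun j : 'I_K => HX j)).
Qed.

Lemma integral_difference K (I0 I1 : {mfun (Om1 * Om2)%type >-> R}) :
  {ae PB, forall b, wiener_integral W (hermite_sum (c^~ b) K) (fun w => I0 (w, b))} ->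
  {ae PB, forall b, wiener_integral W (h b) (fun w => I1 (w, b))} ->
  L2 J (fun z => I0 z - I1 z) /\
  nsq J (fun z => I0 z - I1 z) <= Num.sqrt (nsq PB (remainder K)).
Proof.
move=> H0 H1; apply: (wiener_joint_L2 HW _ (remainder_cvg.1 K)
  (g := fun b y => hermite_sum (c^~ b) K y - h b y)).
  exact: measurable_funB.
apply: filterS3 H0 H1 nsq_remainder => b b0 b1 br; split; first exact: wiener_integralB.
by rewrite br ler_norm.
Qed.

(** The L^2 limit on the product space is jointly measurable by construction; along a subsequence it
    is also the limit on almost every section, which identifies the sections as integrals of
    [h b]. *)
Lemma limit_integral : exists I : {mfun (Om1 * Om2)%type >-> R},
  {ae PB, forall b, wiener_integral W (h b) (fun w => I (w, b))}.
Proof.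
have [I HI] := partial_integrals; have [r2 rc] := remainder_cvg.
have I2 K : L2 J (I K).
  have [] // := @wiener_joint_L2 _ _ _ _ R PW PB W HW (I K) (fun b => hermite_sum (c^~ b) K) _ _ (L2_partial_sum K).
  by apply: aeW => b /=; split; [exact: HI|rewrite nsq_hermite_sum ler_norm].
have [Y Y2 YI] : exists2 Y, L2 J Y & nsq J (fun z => I n z - Y z) @[n --> \oo] --> (0 : R).
  apply: L2_complete => // e e0.
  (* The squared norm of 2 r_m + 2 r_n is at most 8 times the sum of those of r_m and r_n, hence at
     most e^2. *)
  have d0 : 0 < e ^+ 2 / 16 by rewrite divr_gt0// exprn_gt0.
  have [N _ HN] := cvgr_le _ rc _ d0; exists N => m n Nm Nn.
  have q2 : L2 PB (fun b => 2 * remainder m b + 2 * remainder n b) by apply: L2D; exact: L2Z.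
  have mD : measurable_fun setT (fun z => I m z - I n z) by exact: measurable_funB.
  have [|_ H] := wiener_joint_L2 (g := fun b y => hermite_sum (c^~ b) m y - hermite_sum (c^~ b) n y)
      HW mD q2.
    apply: filterS2 ch nsq_remainder => b [h2 _ _ _] br; split; first exact: wiener_integralB.
    apply: le_trans (ler_norm _); rewrite -!br [X in _ <= _ + 2 * X]nsqBC.
    by apply: nsqB_triangle => //; exact: L2_hermite_sum.
  apply: le_trans H _; rewrite -(ger0_norm (ltW e0)) -sqrtr_sqr ler_wsqrtr//.
  apply: le_trans (nsqD_le (L2Z _ (r2 m)) (L2Z _ (r2 n))) _.
  rewrite !nsqZ//; have := HN m Nm; have := HN n Nn; rewrite /=; lra.
have mY := L2_measurable Y2.
have mD n : measurable_fun setT (fun z => ((I n z - Y z) ^+ 2)%:E).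
  by apply/measurable_EFinP; apply: measurable_funX; exact: measurable_funB.
have D0 n z : (0 <= ((I n z - Y z) ^+ 2)%:E)%E by rewrite lee_fin sqr_ge0.
(* The squared distance on the section at b. Its mean is at most the squared distance on the product
   space, so a subsequence tends to 0 for almost every b. *)
pose F n b := fine (\int[PW]_w ((I n (w, b) - Y (w, b)) ^+ 2)%:E)%E.
have mF n : measurable_fun setT (F n).
  apply: measurableT_comp; first exact: fine_measurable.
  exact: (measurable_partial_integral PW (mD n) (D0 n)).
have F0 n b : 0 <= F n b by apply: fine_ge0; apply: integral_ge0 => w _; exact: D0.
have cF : (\int[PB]_b (F n b)%:E)%E @[n --> \oo] --> 0%E.
  apply: (@squeeze_cvge _ _ _ _ (fun=> 0%E) _ (fun n => (nsq J (fun z => I n z - Y z))%:E)).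
  - near=> n; apply/andP; split; first by apply: integral_ge0 => b _; rewrite lee_fin.
    rewrite -integral_sqr; last exact: L2B.
    rewrite (@joint_integral _ _ _ _ _ _ _ (fun z => ((I n z - Y z) ^+ 2)%:E))//.
    apply: ge0_le_integral => //.
    + by move=> b _; rewrite lee_fin.
    + exact/measurable_EFinP.
    + exact: (measurable_partial_integral PW (mD n) (D0 n)).
    + move=> b _; rewrite /F; set X := (\int[PW]_w _)%E.
      have X0 : (0 <= X)%E by apply: integral_ge0 => w _; exact: D0.
      by case: X X0 => [r| |]//= _; rewrite ?lexx ?leey.
  - exact: cvg_cst.
  - by apply: cvg_EFin; [near=> n|exact: YI].
have [k [kn kF]] := ae_cvg0_subseq mF F0 cF.
have [I1 HI1] := mfun_of mY; exists I1.
have Yfin : {ae PB, forall b, (\int[PW]_w (Y (w, b) ^+ 2)%:E < +oo)%E}.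
  have mY2 : measurable_fun setT (fun z => (Y z ^+ 2)%:E).
    by apply/measurable_EFinP; exact: measurable_funX.
  have Y0 z : (0 <= (Y z ^+ 2)%:E)%E by rewrite lee_fin sqr_ge0.
  have iY : PB.-integrable setT (fun b => \int[PW]_w (Y (w, b) ^+ 2)%:E)%E.
    apply/integrableP; split.
      exact: (measurable_partial_integral PW mY2 Y0).
    under eq_integral do rewrite gee0_abs ?integral_ge0//.
    rewrite -(@joint_integral _ _ _ _ _ PW PB (fun z => (Y z ^+ 2)%:E))//.
    by rewrite integral_sqr// ltry.
  apply: filterS (integrable_ae measurableT iY) => b /(_ Logic.I).
  by rewrite fin_numE => /andP[_]; rewrite -ltey.
apply: filterS3 ch (filterI nsq_remainder kF) Yfin => b [h2 _ _ sv] [br bF] Yb.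
rewrite HI1; have Yb2 : L2 PW (fun w => Y (w, b)).
  by apply: L2_lty => //; exact: measurable_section.
have FE n : F n b = nsq PW (fun w => I n (w, b) - Y (w, b)).
  rewrite /F integral_sqr//; apply: L2B => //.
  by have [_ ? _ _] := wiener_integral_law HW (HI n b).
have kc : k n @[n --> \oo] --> \oo.
  by apply/cvgnyPge => A; near=> n; apply: leq_trans (kn n); near: n; exists A.
apply: (@wiener_integral_limit _ _ _ _ W HW (fun n => hermite_sum (c^~ b) (k n)) (fun n w => I (k n) (w, b))) => //.
- have H : remainder (k n) b @[n --> \oo] --> v b - v b.
    by apply: cvgB; [exact: cvg_cst|exact: (cvg_comp _ _ kc sv)].
  by rewrite subrr in H; under eq_fun do rewrite br.
Unshelve. all: by end_near. Qed.

(** The difference of the exponents is (I_K - I) + remainder / 2, and both terms are controlled by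
    the norm of the remainder, whatever versions of the integrals are given. *)
Lemma exponent_cvg (I_ Z_ : nat -> {mfun (Om1 * Om2)%type >-> R}) (I Z : {mfun (Om1 * Om2)%type >-> R}) :
  (forall K, {ae PB, forall b, wiener_integral W (hermite_sum (c^~ b) K) (fun w => I_ K (w, b))}) ->
  {ae PB, forall b, wiener_integral W (h b) (fun w => I (w, b))} ->
  (forall K, {ae J, forall z, Z_ K z = I_ K z - 2^-1 * \sum_(j < K) c j z.2 ^+ 2}) ->
  {ae J, forall z, Z z = I z - 2^-1 * v z.2} ->
  cvg_L2 J (fun K => Z_ K) Z.
Proof.
move=> HI_ HI HZ_ HZ.
have [r2 rc] := remainder_cvg.
have I2 : L2 J I.
  have [] // := @wiener_joint_L2 _ _ _ _ R PW PB W HW I h _ _ v2.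
  by apply: filterS2 ch HI => b [_ _ -> _] ?; rewrite ler_norm.
have I_2 K : L2 J (I_ K).
  have [] // := @wiener_joint_L2 _ _ _ _ R PW PB W HW (I_ K) (fun b => hermite_sum (c^~ b) K) _ _ (L2_partial_sum K).
  by apply: filterS (HI_ K) => b ?; split=> //; rewrite nsq_hermite_sum ler_norm.
have Z2 : L2 J Z.
  apply: ae_eq_L2 HZ => //; apply: L2B => //; apply: L2Z.
  exact: (L2_joint_snd PW v2).1.
have Z_2 K : L2 J (Z_ K).
  apply: ae_eq_L2 (HZ_ K) => //; apply: L2B => //; apply: L2Z.
  exact: (L2_joint_snd PW (L2_partial_sum K)).1.
split; [by move=> K; apply/L2P|by apply/L2P|].
apply/(cvg_Lnorm (f := fun K z => Z_ K z - Z z)); first by move=> K; exact: L2B.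
have bound K : nsq J (fun z => Z_ K z - Z z) <=
    2 * Num.sqrt (nsq PB (remainder K)) + 2^-1 * nsq PB (remainder K).
  have [D2 Dle] := integral_difference (HI_ K) HI.
  have [R2 RE] := L2_joint_snd PW (r2 K).
  rewrite (@ae_eq_nsq _ _ _ J _ (fun z => (I_ K z - I z) + 2^-1 * remainder K z.2)); first last.
  - apply: filterS2 (HZ_ K) HZ => z -> ->; rewrite /remainder; ring.
  - by apply: L2D => //; exact: L2Z.
  - exact: L2B.
  apply: le_trans (nsqD_le D2 (L2Z _ R2)) _; rewrite nsqZ// RE; lra.
apply: (@squeeze_cvgr _ _ _ _ (fun=> 0) (fun K => 2 * Num.sqrt (nsq PB (remainder K)) + 2^-1 * nsq PB (remainder K))).
- by near=> K; rewrite nsq_ge0 bound.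
- exact: cvg_cst.
have H0 : 2 * Num.sqrt (0 : R) + 2^-1 * 0 = 0 :> R by rewrite sqrtr0 !mulr0 addr0.
rewrite -[0 as Z in _ --> Z]H0; apply: cvgD; apply: cvgMr => //.
apply: (cvg_comp _ _ rc); exact: sqrt_continuous.
Unshelve. all: by end_near. Qed.

End random_integrand.

(** * The conditional law given the path *)

Section conditional_law.
Context d1 (Om1 : measurableType d1) d2 (Om2 : measurableType d2) (R : realType).
Variables (PW : probability Om1 R) (PB : probability Om2 R).
Notation J := (joint_prob PW PB).
Variable W : R -> {RV PW >-> R}.
Hypothesis HW : two_sided_brownian_motion W.
Notation mu := (@lebesgue_measure R).
Notation N01 := (@normal_prob R 0 1).
Variable F : set (set Om2).
Hypotheses (sF : sigma_algebra setT F) (FT : F `<=` measurable).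

(** The value at b is the [N01]-measure of the section at b of a set that is measurable for the
    product of F and the Borel sets. *)
Lemma sub_measurable_gaussian (m s : Om2 -> R) (A : set R) : measurable A ->
  measurable_fun setT (m : g_sigma_algebraType F -> R) ->
  measurable_fun setT (s : g_sigma_algebraType F -> R) ->
  measurable_fun setT ((fun b => N01 [set y | A (m b + s b * y)]) : g_sigma_algebraType F -> \bar R).
Proof.
move=> mA mm ms.
pose f (p : g_sigma_algebraType F * R) : R := m p.1 + s p.1 * p.2.
have mf : measurable_fun setT f.
  apply: measurable_funD; first exact: measurableT_comp.
  by apply: measurable_funM => //; exact: measurableT_comp.
have mS : measurable (f @^-1` A) by rewrite -[X in measurable X]setTI; exact: mf.
have := @measurable_fun_xsection _ _ (g_sigma_algebraType F) _ R N01 _ mS.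
congr measurable_fun; apply/funext => b /=; congr (N01 _).
by apply/seteqP; split => y; rewrite /xsection /= inE.
Qed.

Variables (v l : Om2 -> R) (h : Om2 -> R -> R).
Hypothesis mv : measurable_fun setT (v : g_sigma_algebraType F -> R).
Hypothesis v_ge0 : forall b, 0 <= v b.
Hypothesis hv : {ae PB, forall b, nsq mu (h b) = v b /\ l b = v b}.

(** With the path frozen, the integral is N(0, v b) and the correction is a constant. The
    F-measurable version of the conditional probability is computed with [v], since [l] is only
    known to agree with it almost surely. *)
Lemma exponent_cond_law (I Z : {mfun (Om1 * Om2)%type >-> R}) :
  {ae PB, forall b, wiener_integral W (h b) (fun w => I (w, b))} ->
  {ae J, forall z, Z z = I z - 2^-1 * v z.2} ->
  has_cond_law J (preimage_set_system [set: Om1 * Om2] snd F) Z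
    (fun z => gaussian_law (- (2^-1 * l z.2)) (l z.2)).
Proof.
move=> HI HZ A mA.
have mv2 := sub_measurable_fun sF FT mv.
pose G b := N01 [set y | A (- (2^-1 * v b) + Num.sqrt (v b) * y)].
have Gfin b : G b \is a fin_num.
  by apply: fin_num_measure; rewrite -[X in measurable X]setTI; apply: measurable_funD => //;
     exact: measurable_funM.
have mGF : measurable_fun setT (G : g_sigma_algebraType F -> \bar R).
  apply: sub_measurable_gaussian => //.
    by apply: measurableT_comp => //; exact: measurable_funM.
  by apply: measurableT_comp => //; apply: continuous_measurable_fun; exact: sqrt_continuous.
pose g b := fine (G b).
have mgF : measurable_fun setT (g : g_sigma_algebraType F -> R).
  by apply: measurableT_comp => //; exact: fine_measurable.
have mg : measurable_fun setT g := sub_measurable_fun sF FT mgF.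
have gE b : (g b)%:E = G b by rewrite /g fineK.
have g0 b : 0 <= g b by rewrite fine_ge0.
exists (fun z => g z.2); split.
- move=> Y mY; exists (g @^-1` Y); first exact: (sub_measurable_funP sF g).1.
  by rewrite setTI.
- apply: (joint_ae_snd PW (Q := fun b => (g b)%:E = gaussian_law (- (2^-1 * l b)) (l b) A)).
  by apply: filterS hv => b [_ ->]; rewrite gE gaussian_lawE.
move=> _ [E0 FE0 <-]; rewrite setTI.
have mE0 : measurable E0 by exact: FT.
pose Z' z := I z - 2^-1 * v z.2.
have mZ' : measurable_fun setT Z'.
  by apply: measurable_funB => //; apply: measurable_funM => //; exact: measurableT_comp.
have mpre (f : Om1 * Om2 -> R) : measurable_fun setT f -> measurable (snd @^-1` E0 `&` f @^-1` A).
  move=> mf; apply: measurableI; last by rewrite -[X in measurable X]setTI; exact: mf.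
  by rewrite -[X in measurable X]setTI; exact: measurable_snd.
have probE S : measurable S -> J S = (\int[J]_z (\1_S z)%:E)%E.
  by move=> mS; rewrite integral_indic// setIT.
(* [Z] is known only up to a joint null set, whereas the explicit [Z'] has controlled sections. *)
have -> : J (snd @^-1` E0 `&` Z @^-1` A) = J (snd @^-1` E0 `&` Z' @^-1` A).
  rewrite probE; last exact: mpre.
  rewrite probE; last exact: mpre.
  apply: ae_eq_integral => //.
  - by apply/measurable_EFinP; apply: measurable_indic; exact: mpre.
  - by apply/measurable_EFinP; apply: measurable_indic; exact: mpre.
  apply: filterS HZ => z Zz _; congr EFin; rewrite !indicE; congr (_%:R); congr nat_of_bool.
  by apply/idP/idP; rewrite !inE /= /Z' Zz.
rewrite [RHS]probE; last exact: mpre.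
rewrite joint_integral//; last by apply/measurable_EFinP; apply: measurable_indic; exact: mpre.
rewrite integral_mkcond.
have mgE0 : measurable_fun setT ((fun b => (g b)%:E) \_ E0).
  by apply/(measurable_restrictT _ _).1 => //; apply: measurable_funTS; exact/measurable_EFinP.
have gE0_ge0 b : (0 <= ((fun b => (g b)%:E) \_ E0) b)%E.
  by rewrite /patch; case: ifP => // _; rewrite lee_fin.
transitivity (\int[PB]_b ((fun b => (g b)%:E) \_ E0) b)%E.
  rewrite -(@joint_integral_snd _ _ _ _ R PW PB _ mgE0 gE0_ge0); apply: eq_integral => z _.
  by rewrite /patch; congr (if _ then _ else _); apply/idP/idP; rewrite !inE.
apply: ae_eq_integral => //.
- apply: (@measurable_partial_integral _ _ _ _ R PW
    (fun z => (\1_(snd @^-1` E0 `&` Z' @^-1` A) z)%:E)) => //.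
  by apply/measurable_EFinP; apply: measurable_indic; exact: mpre.
apply: filterS2 hv HI => b [hb _] Ib _.
have [_ I2 _ HL] := wiener_integral_law HW Ib.
rewrite /patch; case: ifPn => bE.
  rewrite gE.
  have -> : (\int[PW]_w (\1_(snd @^-1` E0 `&` Z' @^-1` A) (w, b))%:E =
      \int[PW]_w (\1_((fun w => I (w, b)) @^-1` [set u | A (u - 2^-1 * v b)]) w)%:E)%E.
    apply: eq_integral => w _; congr EFin; rewrite !indicE; congr (_%:R); congr nat_of_bool.
    apply/idP/idP; rewrite !inE /= /Z' /=; first by case.
    by move=> ?; split=> //; rewrite inE in bE.
  have mA' : measurable [set u | A (u - 2^-1 * v b)].
    rewrite -[X in measurable X]setTI.
    have mu : measurable_fun setT (fun u : R => u - 2^-1 * v b) by exact: measurable_funB.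
    exact: (mu measurableT A mA).
  rewrite integral_indic//; last first.
    by rewrite -[X in measurable X]setTI; exact: (L2_measurable I2).
  rewrite setIT; apply: etrans (esym (HL _ mA')); rewrite hb gaussian_lawE// /G; congr (N01 _).
  by apply/seteqP; split => y /=; rewrite add0r addrC.
rewrite (_ : (fun w => _) = fun=> 0%E) ?integral0//; apply/funext => w.
congr EFin; rewrite indicE; apply/eqP; rewrite pnatr_eq0 eqb0.
by apply: contra bE => /set_mem[bE0 _]; exact: mem_set.
Qed.

End conditional_law.

(** * The local time as random integrand *)

Theorem theorem4p2 (R : realType)
  (d1 d2 : measure_display)
  (Om1 : measurableType d1) (Om2 : measurableType d2)
  (PW : probability Om1 R) (PB : probability Om2 R)
  (W : R -> {RV PW >-> R})
  (PW_complete : measure_is_complete PW)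
  (W_brownian : two_sided_brownian_motion W)
  (W_generates : generated_by_wiener_integrals W)
  (Tm : R) (Tm_gt0 : 0 < Tm)
  (G : R -> set (set Om2)) (G_filtration : filtration Tm G)
  (B : R -> {RV PB >-> R}) (B_brownian : brownian_motion Tm G B)
  (L : R -> R -> {RV PB >-> R}) (L_local_time : local_time Tm B L)
  (t x : R) (t_ge0 : 0 <= t) (t_leT : t <= Tm) :
  [/\ forall K : nat, exists Z : {RV (joint_prob PW PB) >-> R},
        is_PsiK W B t x K Z,
      exists Z : {RV (joint_prob PW PB) >-> R}, is_Psi W L t x Z &
      forall (PsiK : nat -> {RV (joint_prob PW PB) >-> R})
        (Psi : {RV (joint_prob PW PB) >-> R}),
        (forall K : nat, is_PsiK W B t x K (PsiK K)) -> is_Psi W L t x Psi ->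
        cvg_L2 (joint_prob PW PB) (fun K => PsiK K) Psi /\
        has_cond_law (joint_prob PW PB)
          (preimage_set_system [set: Om1 * Om2] snd (G Tm)) Psi
          (fun z => gaussian_law (- (2^-1 * local_time_sq L t z.2))
                                 (local_time_sq L t z.2))].
Proof.
have sG : sigma_algebra setT (G Tm) by apply: (filtration_sigma G_filtration); rewrite ltW//=.
have GT : G Tm `<=` measurable by apply: (filtration_sub G_filtration); rewrite ltW//=.
(* These versions, measurable for [G Tm], stand in for the coefficients and the squared norm
   wherever measurability matters. *)
pose c := coef_version B t x; pose v := sq_version B t x; pose h b y := L (y - x) t b.
have mcG j := measurable_coef_version G_filtration B_brownian x t_ge0 t_leT j.
have mvG := measurable_sq_version G_filtration B_brownian x t_ge0 t_leT.
have mc j : measurable_fun setT (c j) := sub_measurable_fun sG GT (mcG j).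
have mv : measurable_fun setT v := sub_measurable_fun sG GT mvG.
have v2 : L2 PB v.
  by apply: L2_lty => //; exact: (sq_version_moment G_filtration B_brownian L_local_time x t_ge0 t_leT).
have v_ge0 b : 0 <= v b := sq_version_ge0 B t x b.
have vers := versionsP B_brownian L_local_time x t_ge0 t_leT.
have ch : {ae PB, forall b, [/\ L2 lebesgue_measure (h b), forall j, hermite_coef (h b) j = c j b,
    nsq lebesgue_measure (h b) = v b & \sum_(j < K) c j b ^+ 2 @[K --> \oo] --> v b]}.
  by apply: filterS vers => b [_ _ ? [? ?] ?].
(* A shift from indices starting at 1 to ordinals, together with the passage to the measurable
   versions; one null set serves all K and y. *)
have hK : {ae PB, forall b, forall K y,
    \sum_(1 <= j < K.+1) occupation_coef B t x j b * hermite_fun j y = hermite_sum (c^~ b) K y}.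
  apply: filterS vers => b [occ _ _ _ _] K y.
  by rewrite big_add1 big_mkord; apply: eq_bigr => j _; rewrite occ.
have sK : {ae PB, forall b, forall K,
    \sum_(1 <= j < K.+1) occupation_coef B t x j b ^+ 2 = \sum_(j < K) c j b ^+ 2}.
  apply: filterS vers => b [occ _ _ _ _] K.
  by rewrite big_add1 big_mkord; apply: eq_bigr => j _; rewrite occ.
have hv : {ae PB, forall b, nsq lebesgue_measure (h b) = v b /\ local_time_sq L t b = v b}.
  by apply: filterS vers => b [_ ? _ [_ ?] _].
have mv2 : measurable_fun setT (fun z : Om1 * Om2 => v z.2) by exact: measurableT_comp.
split.
- move=> K; have [I HI] := partial_integrals W_brownian mc.
  have [Z ZE] : exists Z : {mfun (Om1 * Om2)%type >-> R},
      (Z : _ -> R) = fun z => I K z - 2^-1 * \sum_(j < K) c j z.2 ^+ 2.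
    apply: mfun_of; apply: measurable_funB => //; apply: measurable_funM => //.
    by apply: measurable_sum => j; apply: measurable_funX; exact: measurableT_comp.
  exists Z, (I K).
    apply: filterS hK => b hKb.
    by rewrite (_ : (fun y => _) = hermite_sum (c^~ b) K); [exact: HI|apply/funext => y; exact: hKb].
  by apply: filterS (joint_ae_snd PW sK) => z sz; rewrite ZE sz.
- have [I HI] := limit_integral W_brownian mc v2 ch.
  have [Z ZE] : exists Z : {mfun (Om1 * Om2)%type >-> R}, (Z : _ -> R) = fun z => I z - 2^-1 * v z.2.
    by apply: mfun_of; apply: measurable_funB => //; exact: measurable_funM.
  exists Z, I => //.
  by apply: filterS (joint_ae_snd PW hv) => z [_ vz]; rewrite ZE vz.
move=> PsiK Psi HPsiK [I HI HPsi].
have HZ : {ae joint_prob PW PB, forall z, Psi z = I z - 2^-1 * v z.2}.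
  by apply: filterS2 HPsi (joint_ae_snd PW hv) => z -> [_ ->].
split; last exact: (exponent_cond_law W_brownian sG GT mvG v_ge0 hv HI HZ).
pose is_I_ K (X : {RV joint_prob PW PB >-> R}) :=
  pathwise_wiener_integral W
    (fun b y => \sum_(1 <= j < K.+1) occupation_coef B t x j b * hermite_fun j y) X /\
  {ae joint_prob PW PB, forall z, PsiK K z = X z
    - 2^-1 * \sum_(1 <= j < K.+1) occupation_coef B t x j z.2 ^+ 2}.
(* Each [PsiK K] only asserts that some integral exists; choice selects one for every K. *)
have [I_ HI_] : {I_ & forall K, is_I_ K (I_ K)}.
  by apply: choice => K; have [X H1 H2] := HPsiK K; exists X.
apply: (exponent_cvg W_brownian mc v2 ch (I_ := I_) (I := I)) => //.
- move=> K; apply: filterS2 (HI_ K).1 hK => b + hKb.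
  by rewrite (_ : (fun y => _) = hermite_sum (c^~ b) K)//; apply/funext => y; exact: hKb.
- by move=> K; apply: filterS2 (HI_ K).2 (joint_ae_snd PW sK) => z -> ->.
Qed.
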